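(* Let $\alpha\in\mathbb{C}$ with $\mathrm{Re}(\alpha)>0$ and let $(f,g)\in\mathrm{Dom}(\mathcal{W}_\alpha)$. Consider the damped wave problem (P) on $\Gamma$ with vertex parameter $\alpha$ and initial data $(f,g)$. (i) Assume $\alpha\ne N$. Then (P) has a unique solution $u$ on $\mathbb{R}_+=[0,+\infty[$. Moreover there exists $C>0$, independent of $\alpha$ and $(f,g)$, such that for all $t\ge 0$ $$E(u;t)\le C\left(1+\frac{1}{|\alpha-N|^2}\right)E(u;0).$$ (ii) Assume $\alpha=N$. Let $$t_0=\sup\Big\{t\ge 0:\ \sum_{j=1}^N\big(f_j'(s)+g_j(s)\big)=0\ \ \forall s\in[0,t]\Big\}\in[0,+\infty].$$ If $t_0>0$, then (P) has an infinite number of solutions on $[0,t_0[$; in particular there exists a solution $u$ on $[0,t_0[$ such that $E(u;t)\to+\infty$ as $t\to t_0$. If $t_0$ is finite, then for any $\varepsilon>0$ the problem (P) has no solution on $[0,t_0+\varepsilon[$.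
   Context: Fix $N\in\mathbb{N}^*=\{1,2,\dots\}$, put $\mathcal{N}=\{1,\dots,N\}$ and $\mathbb{R}_+^*=]0,+\infty[$. The star graph $\Gamma$ consists of $N$ copies of $\mathbb{R}_+^*$ joined at a central vertex $0$. A function $u$ on $\Gamma$ is a tuple $u=(u_j)_{j\in\mathcal{N}}$ of functions on $\mathbb{R}_+^*$; derivatives are taken componentwise. Put $L^2(\Gamma)=L^2(\mathbb{R}_+^* )^N$ (complex-valued functions, natural Hilbert structure) and, for $k\in\mathbb{N}^*$, $H^k(\Gamma^* )=H^k(\mathbb{R}_+^* )^N$, $\dot H^k(\Gamma^* )=\dot H^k(\mathbb{R}_+^* )^N$, where $\dot H^k(\mathbb{R}_+^* )$ is the space of locally integrable functions whose $k$-th distributional derivative is in $L^2(\mathbb{R}_+^* )$. A function $u\in\dot H^1(\Gamma^* )$ is continuous at $0$ if $u_j(0)=u_k(0)$ for all $j,k\in\mathcal{N}$; the common value is $u(0)$. Put $\dot H^1(\Gamma)=\{u\in\dot H^1(\Gamma^* ): u \text{ continuous at } 0\}$, $H^1(\Gamma)=\{u\in H^1(\Gamma^* ): u \text{ continuous at } 0\}$, and let $\tilde H^1(\Gamma)$ be the quotient of $\dot H^1(\Gamma)$ by constant functions, a Hilbert space for $\langle u,v\rangle_{\tilde H^1(\Gamma)}=\langle u',v'\rangle_{L^2(\Gamma)}$. Functions in $\dot H^1(\Gamma)$ are identified with their classes in $\tilde H^1(\Gamma)$ (so statements are understood up to addition of a constant to such functions). For $\alpha\in\mathbb{C}$, $$\mathrm{Dom}(\mathcal{W}_\alpha)=\Big\{(u,v)\in\big(\tilde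 H^1(\Gamma)\cap\dot H^2(\Gamma^* )\big)\times H^1(\Gamma):\ \sum_{j=1}^N u_j'(0)+\alpha v(0)=0\Big\}.$$ Problem (P) on an interval $I\subset\mathbb{R}$ containing $0$, with data $(f,g)$, consists of: (a) $\partial_{tt}u_j(t,x)-\partial_{xx}u_j(t,x)=0$ for all $j\in\mathcal{N}$, $t\in I$, $x\ge 0$; (b) $u_j(t,0)=u_k(t,0)$ for all $j,k\in\mathcal{N}$, $t\in I$; (c) $\sum_{j=1}^N\partial_x u_j(t,0)+\alpha\,\partial_t u(t,0)=0$ for all $t\in I$; (d) $(u_j,\partial_t u_j)|_{t=0}=(f_j,g_j)$ for all $j\in\mathcal{N}$. A (strong) solution of (P) on $I$ is a continuous function $u:I\to\tilde H^1(\Gamma)\cap\dot H^2(\Gamma^* )$ with continuous derivative $\partial_t u:I\to H^1(\Gamma)$ and continuous second derivative $\partial_{tt}u:I\to L^2(\Gamma)$, such that (a) holds in $L^2(\Gamma)$ for all $t\in I$, (b) and (c) hold for all $t\in I$, and (d) holds in $\tilde H^1(\Gamma)\times L^2(\Gamma)$. The energy of a solution is $$E(u;t)=\|\partial_t u(t)\|_{L^2(\Gamma)}^2+\|\partial_x u(t)\|_{L^2(\Gamma)}^2 .$$ *)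

(* Defs.v *)
From HB Require Import structures.
From mathcomp Require Import all_boot all_order all_algebra.
From mathcomp Require Import all_classical all_reals all_analysis.
From mathcomp Require Import complex.

Set Implicit Arguments.
Unset Strict Implicit.
Unset Printing Implicit Defensive.

Import Order.TTheory GRing.Theory Num.Theory.
Import numFieldNormedType.Exports.

Local Open Scope classical_set_scope.
Local Open Scope ring_scope.
Local Open Scope complex_scope.

(* Functions on the half-line are total functions R -> R[i]; only their values
   on ]0, +oo[ (up to null sets) matter. Elements of L^2, H^k, ... are functions
   rather than classes: equalities in these spaces are stated almost everywhere,
   and modulo constants where a quotient by constants is involved. *)
Section HalfLine.
Context {R : realType}.
Local Notation C := R[i].
Local Notation mu := (@lebesgue_measure R).

Definition halfline : set R := `]0, +oo[.

Definition ae_eq_half (u v : R -> C) : Prop :=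
  {ae mu, forall x, halfline x -> u x = v x}.

Definition cmeasurable (u : R -> C) : Prop :=
  measurable_fun halfline (fun x => complex.Re (u x)) /\
  measurable_fun halfline (fun x => complex.Im (u x)).

Definition cloc_integrable (u : R -> C) : Prop :=
  locally_integrable halfline (fun x => complex.Re (u x)) /\
  locally_integrable halfline (fun x => complex.Im (u x)).

Definition cintegral (u : R -> C) : C :=
  (\int[mu]_(x in halfline) complex.Re (u x)) +i*
  (\int[mu]_(x in halfline) complex.Im (u x)).

Definition normL2sq (u : R -> C) : \bar R :=
  (\int[mu]_(x in halfline) ((Normc.normc (u x)) ^+ 2)%:E)%E.

Definition L2 (u : R -> C) : Prop := cmeasurable u /\ (normL2sq u < +oo)%E.

(* Test functions in C_c^oo(]0, +oo[). Real-valued ones suffice, since the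
   pairing with a test function is complex-linear in it. *)
Definition test_function (phi : R -> R) : Prop :=
  (forall n x, derivable (derive1n n phi) x 1) /\
  (exists K : set R, [/\ compact K, K `<=` halfline &
                         forall x, ~ K x -> phi x = 0]).

Definition is_wderiv (k : nat) (u w : R -> C) : Prop :=
  [/\ cloc_integrable u, cloc_integrable w &
      forall phi : R -> R, test_function phi ->
        cintegral (fun x => u x * (derive1n k phi x)%:C) =
        (-1) ^+ k * cintegral (fun x => w x * (phi x)%:C)].

(* The k-th distributional derivative when it is a locally integrable function
   (well defined up to null sets), and 0 otherwise. *)
Definition wderiv (k : nat) (u : R -> C) : R -> C :=
  xget (fun=> 0) [set w | is_wderiv k u w].

Definition dotH (k : nat) (u : R -> C) : Prop :=
  exists w, is_wderiv k u w /\ L2 w.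

Definition H1 (u : R -> C) : Prop := L2 u /\ dotH 1 u.

(* The representative of u that is continuous on [0, +oo[; when it exists, its
   values on [0, +oo[ are uniquely determined. Pointwise values u(x), and in
   particular traces u(0), are those of this representative. *)
Definition crep (u : R -> C) : R -> C :=
  xget (fun=> 0) [set w : R -> C |
    [/\ {within `[0, +oo[, continuous (fun x => complex.Re (w x))},
        {within `[0, +oo[, continuous (fun x => complex.Im (w x))} &
        ae_eq_half u w]].

End HalfLine.

Section StarGraph.
Context {R : realType} {N : nat}.
Local Notation C := R[i].

Definition graph_fun := 'I_N -> R -> C.
Implicit Types (u v w f g : graph_fun) (I : set R) (U : R -> graph_fun).

Definition diffG u v : graph_fun := fun j x => u j x - v j x.
Definition derivG (k : nat) u : graph_fun := fun j => wderiv k (u j).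

Definition eqL2G u v : Prop := forall j, ae_eq_half (u j) (v j).

(* Equality in the quotient by constant functions: the constant is the same on
   all edges. *)
Definition eq_mod_cst u v : Prop :=
  exists c : C, forall j, ae_eq_half (diffG u v j) (fun=> c).

Definition L2G u : Prop := forall j, L2 (u j).
Definition continuous0 u : Prop := forall j k, crep (u j) 0 = crep (u k) 0.
Definition dotH1G u : Prop := (forall j, dotH 1 (u j)) /\ continuous0 u.
Definition H1G u : Prop := (forall j, H1 (u j)) /\ continuous0 u.
Definition tH1dotH2G u : Prop := dotH1G u /\ forall j, dotH 2 (u j).

Definition nsqL2G u : \bar R := (\sum_(j < N) normL2sq (u j))%E.
Definition nsq_tH1G u : \bar R := nsqL2G (derivG 1 u).
Definition nsq_tH1dotH2G u : \bar R :=
  (nsqL2G (derivG 1 u) + nsqL2G (derivG 2 u))%E.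
Definition nsqH1G u : \bar R := (nsqL2G u + nsqL2G (derivG 1 u))%E.

(* sum_j u_j'(0) + alpha v(0) = 0, where v(0) is the common value of the v_k(0)
   (v being continuous at 0). *)
Definition vertex_cond (alpha : C) u v : Prop :=
  forall k, \sum_(j < N) crep (derivG 1 u j) 0 + alpha * crep (v k) 0 = 0.

Definition DomW (alpha : C) (fg : graph_fun * graph_fun) : Prop :=
  [/\ tH1dotH2G fg.1, H1G fg.2 & vertex_cond alpha fg.1 fg.2].

(* Continuity on I of a map into the space with squared norm nsq. *)
Definition continuous_into (nsq : graph_fun -> \bar R) I U : Prop :=
  forall t, I t ->
    nsq (diffG (U s) (U t)) @[s --> within I (nbhs t)] --> 0%E.

(* v is the derivative at t, relative to I, of U for the squared norm nsq. *)
Definition is_tderiv (nsq : graph_fun -> \bar R) I U (t : R) v : Prop :=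
  nsq (diffG (fun j x => ((s - t)^-1)%:C * (U s j x - U t j x)) v)
    @[s --> within I (t^')] --> 0%E.

(* d/dt of a tilde H^1-valued map, as the unique element of H^1(Gamma) in the
   class (no nonzero constant lies in H^1(Gamma)); 0 if there is none. *)
Definition dt I U : R -> graph_fun := fun t =>
  xget (fun _ _ => 0) [set v | H1G v /\ is_tderiv nsq_tH1G I U t v].

(* d^2/dt^2: the L^2-derivative of dt; 0 if there is none. *)
Definition dtt I U : R -> graph_fun := fun t =>
  xget (fun _ _ => 0) [set w | L2G w /\ is_tderiv nsqL2G I (dt I U) t w].

Record solution (I : set R) (alpha : C) (f g : graph_fun)
    (u : R -> graph_fun) : Prop := Solution {
  sol_space : forall t, I t -> tH1dotH2G (u t);
  sol_cont : continuous_into nsq_tH1dotH2G I u;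
  sol_dt : forall t, I t ->
    H1G (dt I u t) /\ is_tderiv nsq_tH1G I u t (dt I u t);
  sol_dt_cont : continuous_into nsqH1G I (dt I u);
  sol_dtt : forall t, I t ->
    L2G (dtt I u t) /\ is_tderiv nsqL2G I (dt I u) t (dtt I u t);
  sol_dtt_cont : continuous_into nsqL2G I (dtt I u);
  sol_wave : forall t, I t -> eqL2G (dtt I u t) (derivG 2 (u t));
  sol_continuous0 : forall t, I t -> continuous0 (u t);
  sol_vertex : forall t, I t -> vertex_cond alpha (u t) (dt I u t);
  sol_init : eq_mod_cst (u 0) f /\ eqL2G (dt I u 0) g
}.

(* Equality of maps I -> tilde H^1(Gamma). *)
Definition same_on I (u1 u2 : R -> graph_fun) : Prop :=
  forall t, I t -> eq_mod_cst (u1 t) (u2 t).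

(* The set of solutions as maps I -> tilde H^1(Gamma), each given by its
   equivalence class. *)
Definition solution_classes (I : set R) (alpha : C) (f g : graph_fun) :
    set (set (R -> graph_fun)) :=
  [set [set w | same_on I u w] | u in [set u | solution I alpha f g u]].

Definition energy I U (t : R) : \bar R :=
  (nsqL2G (dt I U t) + nsqL2G (derivG 1 (U t)))%E.

(* t_0, as the supremum of a set containing 0 when (f, g) is in Dom(W_N). *)
Definition t_crit f g : \bar R :=
  ereal_sup [set t%:E | t in [set t : R | 0 <= t /\
    forall s, 0 <= s <= t ->
      \sum_(j < N) (crep (derivG 1 f j) s + crep (g j) s) = 0]].

End StarGraph.

Arguments graph_fun : clear implicits.

(* The interval [0, b[, with b possibly infinite. *)
Definition Ico0 {R : realType} (b : \bar R) : set R :=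
  [set t | 0 <= t /\ (t%:E < b)%E].

(* Main.v *)
(** Along each edge u_t + u_x and u_t - u_x are transported, towards and away from
the vertex. Hence the trace at the vertex at time t of the incoming wave is
[inc f g j t] = f_j'(t) + g_j(t), and summing over the edges the vertex condition
becomes sum_j inc_j(t) = (N - alpha) v(t), where v = u_t(., 0). If alpha <> N this
determines v, and d'Alembert's formula with outgoing trace 2 v - inc_j gives the
solution; its energy is that of the data, minus what came in, plus what went out,
which is bounded because |N - alpha|^2 |v|^2 <= N sum_j |inc_j|^2. If alpha = N
the incoming traces must sum to 0 and v, apart from v(0) = g(0), is arbitrary:
different v give different solutions, and a v that is not square integrable up to
t_0 makes the energy blow up. A transported wave is unique because the squared norm
of a difference has derivative -|trace|^2 for incoming waves, +|trace|^2 for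
outgoing ones, and the outgoing traces agree once v does. *)

Require Import Defs.
From mathcomp Require Import all_boot all_order all_algebra.
From mathcomp Require Import all_classical all_reals all_analysis.
From mathcomp Require Import complex measurable_realfun.
From mathcomp Require Import ring lra.
Import Order.TTheory GRing.Theory Num.Theory.
Import numFieldNormedType.Exports.

Set Implicit Arguments.
Unset Strict Implicit.
Unset Printing Implicit Defensive.

Local Open Scope classical_set_scope.
Local Open Scope ring_scope.


(** * Test functions and the du Bois-Reymond lemma *)

(** Sobolev functions are given by weak derivatives and only almost everywhere, while the argument
    lives on traces. Hence [prim]: the du Bois-Reymond lemma turns a weak derivative in L^2 into a
    primitive continuous up to 0, and every pair of a function and its derivative is then handled in
    that form. Time derivatives exist only in norm, so a solution cannot be followed pointwise along
    characteristics: uniqueness goes through norms, and explicit waves are differentiated through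
    difference quotients of translates. A translate may leave the half-line, so profiles are
    extended to the whole line, the incoming one by a constant, the outgoing one by boundary data
    read backwards in time. These data may fail to be square integrable up to the end of the time
    interval, which is what permits blow-up, so that the outgoing extension is rebuilt for each T
    inside the interval. Since [dt] and [dtt] are chosen by [xget], uniqueness of derivatives in
    norm is what identifies them with the constructed curves. In the energy bound a coarser factor
    2^N replaces the N of Cauchy-Schwarz. *)

Section Smooth.
Context {R : realType}.
Implicit Types (f g phi : R -> R) (n : nat) (x a b c s : R).

(* A record rather than a definition, to keep it from being unfolded. *)
Record ndiff n f : Prop := Ndiff {
  ndiffE : forall k x, (k < n)%N -> derivable (derive1n k f) x 1 }.

Definition smooth f : Prop := forall n x, derivable (derive1n n f) x 1.

Lemma smooth_ndiff f : smooth f <-> forall n, ndiff n f.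
Proof.
split=> [sf n|nf n x]; first by split=> k x _; exact: sf.
exact: (ndiffE (nf n.+1)).
Qed.

Lemma ndiffW n f : ndiff n.+1 f -> ndiff n f.
Proof. by case=> nf; split=> k x kn; apply: nf; exact: ltnW. Qed.

Lemma is_derive_derive1 f df :
  (forall x, is_derive x 1 f (df x)) -> derive1 f = df.
Proof. by move=> fdf; apply/funext => x; rewrite derive1E; apply: derive_val. Qed.

(** The induction step of the closure lemmas that follow: no iterated derivative ever has to be
    computed. *)
Lemma ndiff_isD n f df : (forall x, is_derive x 1 f (df x)) -> ndiff n df ->
  ndiff n.+1 f.
Proof.
move=> fdf ndf; split=> -[|k] x; first by move=> _; rewrite derive1n0; exact: ex_derive.
by rewrite ltnS => kn; rewrite derive1Sn (is_derive_derive1 fdf); exact: (ndiffE ndf).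
Qed.

Lemma ndiffS n f : ndiff n.+1 f ->
  (forall x, is_derive x 1 f (derive1 f x)) /\ ndiff n (derive1 f).
Proof.
move=> [nf]; split=> [x|]; last split=> k x kn.
  by apply: DeriveDef; [exact: (nf 0%N)|rewrite derive1E].
by rewrite -derive1Sn; exact: nf.
Qed.

Lemma ndiff0 f : ndiff 0 f. Proof. by split. Qed.

Lemma ndiff_cst n c : ndiff n (fun=> c).
Proof.
elim: n c => [|n IH]; first by move=> *; exact: ndiff0.
move=> c.
have D x : is_derive x 1 (fun=> c : R) (0 : R) by exact: is_derive_cst.
exact: (ndiff_isD D (IH 0)).
Qed.

Lemma ndiffD n f g : ndiff n f -> ndiff n g -> ndiff n (fun x => f x + g x).
Proof.
elim: n f g => [|n IH]; first by move=> *; exact: ndiff0.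
move=> f g /ndiffS[df nf] /ndiffS[dg ng].
have D x : is_derive x 1 (fun x => f x + g x) (derive1 f x + derive1 g x).
  exact: (is_deriveD (df x) (dg x)).
exact: (ndiff_isD D (IH _ _ nf ng)).
Qed.

Lemma ndiffM n f g : ndiff n f -> ndiff n g -> ndiff n (fun x => f x * g x).
Proof.
elim: n f g => [|n IH]; first by move=> *; exact: ndiff0.
move=> f g nf ng.
have /ndiffS[df nf'] := nf; have /ndiffS[dg ng'] := ng.
have D x : is_derive x 1 (fun x => f x * g x) (f x * derive1 g x + g x * derive1 f x).
  exact: (is_deriveM (df x) (dg x)).
apply: (ndiff_isD D).
exact: (ndiffD (IH _ _ (ndiffW nf) ng') (IH _ _ (ndiffW ng) nf')).
Qed.

Lemma ndiff_affine n f a b : ndiff n f -> ndiff n (fun x => f (a * x + b)).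
Proof.
elim: n f => [|n IH]; first by move=> *; exact: ndiff0.
move=> f /ndiffS[df nf].
have D x : is_derive x 1 (fun x => f (a * x + b)) (derive1 f (a * x + b) * a).
  have A : is_derive x 1 (fun x : R => a * x + b) a.
    have := is_deriveD (is_deriveM (is_derive_cst a x 1) (is_derive_id x 1))
      (is_derive_cst b x 1).
    by rewrite scaler0 addr0 addr0 /GRing.scale/= mulr1.
  exact: (@is_derive1_comp _ f (fun x => a * x + b) x _ _ (df _) A).
exact: (ndiff_isD D (ndiffM (IH _ nf) (ndiff_cst n a))).
Qed.

(** For k = 0 this is the classical smooth function e^(-1/s), extended by 0. The powers of 1/s make
    the family stable under differentiation. *)
Definition flat (k : nat) s := if 0 < s then (s^-1) ^+ k * expR (- s^-1) else 0.

Lemma flat_ge0 k s : 0 <= flat k s.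
Proof.
rewrite /flat; case: ifPn => // s0.
by rewrite mulr_ge0 ?expR_ge0// exprn_ge0// invr_ge0 ltW.
Qed.

Lemma flatE k s : 0 < s -> flat k s = (s^-1) ^+ k * expR (- s^-1).
Proof. by rewrite /flat => ->. Qed.

(** With y = 1/s, the exponential series gives e^y >= y^(k+1) / (k+1)!. A bound linear in s is what
    yields a zero derivative at the origin. *)
Lemma flat_le k s : 0 < s -> flat k s <= (k.+1)`!%:R * s.
Proof.
move=> s0; rewrite flatE// expRN.
have y0 : 0 < s^-1 by rewrite invr_gt0.
have := @expR_ge1Dxn R s^-1 k (ltW y0).
set y := s^-1 => /(le_trans _) H.
have {}H : y ^+ k.+1 / (k.+1)`!%:R <= expR y by apply: H; rewrite lerDr.
rewrite ler_pdivrMr ?expR_gt0// -[s]invrK -/y.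
apply: le_trans (ler_wpM2l _ H); last by rewrite mulr_ge0// invr_ge0 ltW.
rewrite exprS le_eqVlt; apply/orP; left; apply/eqP; field.
by rewrite [y == 0]gt_eqF// gt_eqF// ltr0n fact_gt0.
Qed.

(** Away from 0 this is the product rule. At 0 the difference quotient of [flat k] is [flat k.+1],
    which [flat_le] sends to 0. *)
Lemma is_derive_flat k s : is_derive s 1 (flat k) (flat k.+2 s - k%:R * flat k.+1 s).
Proof.
have [s0|s0|->] := ltgtP s 0.
- rewrite /flat !ltNge (ltW s0)/= mulr0 subr0.
  apply: (@near_eq_is_derive _ _ _ (fun=> 0)).
  near=> t; rewrite ltNge ifF//; apply/negbTE; rewrite negbK.
  by apply/ltW; near: t; exact: lt_nbhsl.
- have sN0 : s != 0 by rewrite gt_eqF.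
  have dV : is_derive s 1 (fun t : R => t^-1) (- s ^- 2).
    by have := @is_deriveV _ id s 1 1 sN0 _; rewrite /GRing.scale/= mulr1; apply.
  have dX : is_derive s 1 (fun t : R => (t^-1) ^+ k) (k%:R * s^-1 ^+ k.-1 * (- s ^- 2)).
    by have := is_deriveX k dV; rewrite exprfctE.
  have dN : is_derive s 1 (fun t : R => - t^-1) (s ^- 2).
    by have := @is_deriveN _ _ _ _ _ _ _ dV; rewrite opprK.
  have dE : is_derive s 1 (fun t : R => expR (- t^-1)) (expR (- s^-1) * (s ^- 2)).
    exact: (is_derive1_comp (is_derive_expR _) dN).
  have := is_deriveM dX dE.
  have -> : s^-1 ^+ k *: (expR (- s^-1) * s ^- 2) +
      expR (- s^-1) *: (k%:R * s^-1 ^+ k.-1 * - s ^- 2) =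
      flat k.+2 s - k%:R * flat k.+1 s.
    rewrite !flatE// /GRing.scale/= -!exprVn.
    by case: k {dX} => [|k]/=; rewrite !exprS; ring.
  apply: near_eq_is_derive; near=> t; rewrite flatE//.
  by near: t; exact: lt_nbhsr.
- rewrite /flat ltxx mulr0 subr0.
  suff H : h^-1 *: ((flat k \o shift 0) (h *: 1) - flat k 0) @[h --> 0^'] --> (0 : R).
    by apply: DeriveDef; [apply/cvg_ex; exists 0|apply: cvg_lim].
  apply/cvgr0Pnorm_le => e e0.
  have f0 : 0 < (k.+2)`!%:R :> R by rewrite ltr0n fact_gt0.
  near=> h; rewrite /flat ltxx subr0 /= addr0 /GRing.scale/= mulr1.
  have hN0 : h != 0 by near: h; exact: nbhs_dnbhs_neq.
  case: ifPn => h0; last by rewrite mulr0 normr0 ltW.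
  have -> : h^-1 * (h^-1 ^+ k * expR (- h^-1)) = flat k.+1 h by rewrite flatE// exprS mulrA.
  rewrite ger0_norm ?flat_ge0// (le_trans (flat_le _ h0))// mulrC -ler_pdivlMr//.
  rewrite -[leLHS]gtr0_norm//; near: h; apply: dnbhs0_le; exact: divr_gt0.
Unshelve. all: by end_near. Qed.

Lemma ndiff_flat n k : ndiff n (flat k).
Proof.
elim: n k => [|n IH]; first by move=> *; exact: ndiff0.
move=> k.
apply: (ndiff_isD (is_derive_flat k)).
apply: (ndiffD (IH _)).
rewrite (_ : (fun x => _) = (fun x => (- k%:R) * flat k.+1 x)); last first.
  by apply/funext => x; rewrite mulNr.
exact: (ndiffM (ndiff_cst _ _) (IH _)).
Qed.

End Smooth.

(** * Integrability of real functions and local integrability on the half-line *)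

Section Integrals.
Context {R : realType}.
Local Notation mu := (@lebesgue_measure R).
Implicit Types (D E : set R) (f g : R -> R) (a b c x : R).

Lemma ae_imp (P Q : R -> Prop) : (forall x, P x -> Q x) ->
  {ae mu, forall x, P x} -> {ae mu, forall x, Q x}.
Proof. by move=> PQ; apply: filterS => [|x]; [exact: (ae_filter_ringOfSetsType mu)|exact: PQ]. Qed.

Lemma ae_and (P Q : R -> Prop) : {ae mu, forall x, P x} ->
  {ae mu, forall x, Q x} -> {ae mu, forall x, P x /\ Q x}.
Proof. exact: (@filterI _ _ (ae_filter_ringOfSetsType mu)). Qed.

Lemma ae_all (P : R -> Prop) : (forall x, P x) -> {ae mu, forall x, P x}.
Proof. by move=> HP; apply: (@filterE _ _ (ae_filter_ringOfSetsType mu)). Qed.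

Definition itg D f : Prop := mu.-integrable D (EFin \o f).

Lemma itg_meas D f : itg D f -> measurable_fun D f.
Proof. by case/integrableP => /measurable_EFinP. Qed.

Lemma itg_le D f g : measurable D -> measurable_fun D f ->
  (forall x, D x -> `|f x| <= g x) -> itg D g -> itg D f.
Proof.
move=> mD mf fg ig; apply: le_integrable ig => //; first exact/measurable_EFinP.
by move=> x Dx; rewrite /= lee_fin (le_trans (fg x Dx))// ler_norm.
Qed.

Lemma itgD D f g : measurable D -> itg D f -> itg D g -> itg D (fun x => f x + g x).
Proof. by move=> mD fi gi; apply: (@integrableD _ _ _ mu D _ _ _ fi gi). Qed.

Lemma itgB D f g : measurable D -> itg D f -> itg D g -> itg D (fun x => f x - g x).
Proof. by move=> mD fi gi; apply: (@integrableB _ _ _ mu D _ _ _ fi gi). Qed.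

Lemma itgZ D f c : measurable D -> itg D f -> itg D (fun x => c * f x).
Proof. by move=> mD fi; apply: (@integrableZl _ _ _ mu D _ c _ fi). Qed.

Lemma itg_abs D f : itg D f -> itg D (fun x => `|f x|).
Proof. by move=> fi; have := integrable_abse fi. Qed.

Lemma itgS D E f : measurable D -> measurable E -> D `<=` E -> itg E f -> itg D f.
Proof. by move=> mD mE DE; exact: integrableS. Qed.

Lemma itg_eq D f g : measurable D -> (forall x, D x -> f x = g x) -> itg D f -> itg D g.
Proof.
move=> mD fg; apply: eq_integrable => // x; rewrite inE => Dx.
by rewrite /= fg.
Qed.

Lemma itg_cst a b c : itg `[a, b] (fun=> c).
Proof.
apply: continuous_compact_integrable; first exact: segment_compact.
by move=> x; exact: cvg_cst.
Qed.

Lemma itg_cont a b f : {within `[a, b], continuous f} -> itg `[a, b] f.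
Proof. by move=> cf; apply: continuous_compact_integrable => //; exact: segment_compact. Qed.

Lemma itg_lty D f : measurable_fun D f -> (\int[mu]_(x in D) (`|f x|)%:E < +oo)%E ->
  itg D f.
Proof. by move=> mf fi; apply/integrableP; split=> //; exact/measurable_EFinP. Qed.

Lemma itgP D f : itg D f <->
  measurable_fun D f /\ (\int[mu]_(x in D) (`|f x|)%:E < +oo)%E.
Proof.
split; last by case=> mf; exact: itg_lty.
by move=> fi; split; [exact: itg_meas|have /integrableP[] := fi].
Qed.

Lemma itgE D f : measurable D -> itg D f ->
  (\int[mu]_(x in D) (f x)%:E = (\int[mu]_(x in D) f x)%:E)%E.
Proof. by move=> mD fi; rewrite /Rintegral fineK//; exact: integrable_fin_num. Qed.

Lemma Rint_sub D E f : measurable D -> measurable E -> D `<=` E ->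
  (forall x, E x -> ~ D x -> f x = 0) ->
  \int[mu]_(x in E) f x = \int[mu]_(x in D) f x.
Proof.
move=> mD mE DE f0; rewrite [RHS]Rintegral_mkcond [LHS]Rintegral_mkcond.
congr Rintegral; apply/funext => x; rewrite !patchE.
have [xD|xD] := boolP (x \in D).
  by rewrite ifT//; apply/mem_set/DE/set_mem.
case: ifPn => // xE; apply: f0; first exact: set_mem.
by move=> Dx; move: xD; rewrite mem_set.
Qed.

Lemma itg_ext D E f : measurable D -> measurable E -> D `<=` E ->
  (forall x, E x -> ~ D x -> f x = 0) -> itg D f -> itg E f.
Proof.
move=> mD mE DE f0 fi; have H := (integrable_mkcond (mu := mu) _ mD).1 fi.
apply: (integrable_mkcond (mu := mu) _ mE).2; apply: eq_integrable H => // x _.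
rewrite !patchE; have [xD|xD] := boolP (x \in D).
  by rewrite ifT//; apply/mem_set/DE/set_mem.
case: ifPn => // xE; rewrite /= f0 //; first exact: set_mem.
by move=> Dx; move: xD; rewrite mem_set.
Qed.

Lemma Rint_eq D f g : (forall x, D x -> f x = g x) ->
  \int[mu]_(x in D) f x = \int[mu]_(x in D) g x.
Proof. by move=> fg; apply: eq_Rintegral => x /[!inE]; exact: fg. Qed.

Lemma Rint_ae D f g : measurable D -> measurable_fun D f -> measurable_fun D g ->
  {ae mu, forall x, D x -> f x = g x} ->
  \int[mu]_(x in D) f x = \int[mu]_(x in D) g x.
Proof.
move=> mD mf mg fg; congr fine; apply: ae_eq_integral => //.
- exact/measurable_EFinP.
- exact/measurable_EFinP.
- by apply: ae_imp fg => x H Dx; rewrite H.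
Qed.

Lemma itg_ae D f g : measurable D -> measurable_fun D g ->
  {ae mu, forall x, D x -> f x = g x} -> itg D f -> itg D g.
Proof.
move=> mD mg fg /itgP[mf fi]; apply: itg_lty => //.
suff <- : (\int[mu]_(x in D) (`|f x|)%:E = \int[mu]_(x in D) (`|g x|)%:E)%E by [].
apply: ae_eq_integral => //.
- by apply/measurable_EFinP; exact: measurableT_comp.
- by apply/measurable_EFinP; exact: measurableT_comp.
- by apply: ae_imp fg => x H Dx; rewrite H.
Qed.

Lemma itg_bounded D f g M : measurable D -> measurable_fun D g ->
  (forall x, D x -> `|g x| <= M) -> itg D f -> itg D (fun x => f x * g x).
Proof.
move=> mD mg gM fi; apply: (@itg_le _ _ (fun x => M * `|f x|)) => //.
- by apply: measurable_funM => //; exact: itg_meas.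
- move=> x Dx; rewrite normrM mulrC ler_wpM2r//; exact: gM.
- by apply: itgZ => //; exact: itg_abs.
Qed.

Lemma halfline_meas : measurable (@halfline R).
Proof. exact: measurable_itv. Qed.

Lemma halflineE x : halfline x = (0 < x).
Proof. by rewrite /halfline /= in_itv/= andbT. Qed.

Lemma locint_itg f a b : 0 < a -> locally_integrable halfline f -> itg `[a, b] f.
Proof.
move=> a0 [mf _ fi]; apply: itg_lty.
  apply: measurable_funS mf; first exact: halfline_meas.
  move=> x /=; rewrite in_itv/= => /andP[ax _].
  by rewrite halflineE (lt_le_trans a0).
apply: fi; last exact: segment_compact.
move=> x /=; rewrite in_itv/= => /andP[ax _].
by rewrite halflineE (lt_le_trans a0).
Qed.

Lemma compact_halfline_sub (K : set R) : compact K -> K `<=` halfline ->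
  exists a b, [/\ 0 < a, a < b & K `<=` `[a, b]].
Proof.
move=> cK Kh; have [->|K0] := eqVneq K set0.
  by exists 1, 2; split=> //; lra.
have /set0P K0' := K0.
have ci : {within K, continuous (@idfun R)} by apply: continuous_subspaceT => x; exact: cvg_id.
have [a aK Ka] := compact_EVT_min K0' cK ci.
have [b bK Kb] := compact_EVT_max K0' cK ci.
have a0 : 0 < a by rewrite -halflineE; apply/Kh/set_mem.
exists a, (b + 1); split=> //.
  by have := Kb _ aK; rewrite /=; lra.
move=> x Kx /=; rewrite in_itv/= (Ka _ (mem_set Kx))/=.
by have := Kb _ (mem_set Kx); rewrite /=; lra.
Qed.

Lemma locintP f : measurable_fun halfline f ->
  (forall a b, 0 < a -> a < b -> itg `[a, b] f) -> locally_integrable halfline f.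
Proof.
move=> mf fi; split=> //.
move=> K Kh cK; have [a [b [a0 ab Kab]]] := compact_halfline_sub cK Kh.
have /itgP[mab fab] := fi _ _ a0 ab.
apply: le_lt_trans fab; apply: ge0_subset_integral => //.
  exact: compact_measurable.
by apply/measurable_EFinP; exact: measurableT_comp.
Qed.

End Integrals.

(** * Test functions on the half-line *)

Section TestFunctions.
Context {R : realType}.
Local Notation mu := (@lebesgue_measure R).
Implicit Types (D E : set R) (f g u v w phi psi : R -> R) (a b c x : R).

Lemma ndiff_continuous f : ndiff 1 f -> continuous f.
Proof.
move=> nf x; apply: differentiable_continuous; apply/derivable1_diffP.
exact: (@ndiffE _ _ _ nf 0%N).
Qed.

Lemma test_ndiff n phi : test_function phi -> ndiff n phi.
Proof. by case=> /smooth_ndiff. Qed.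

(** A compact subset of the open half-line lies in a segment away from 0, so supports can be handled
    as intervals. *)
Lemma test_functionP phi : test_function phi <->
  (forall n, ndiff n phi) /\
  exists a b, [/\ 0 < a, a < b & forall x, ~~ (a <= x <= b) -> phi x = 0].
Proof.
split=> [[sphi [K [cK Kh phi0]]]|[nphi [a [b [a0 ab phi0]]]]].
  split; first exact/smooth_ndiff.
  have [a [b [a0 ab Kab]]] := compact_halfline_sub cK Kh.
  exists a, b; split=> // x xab; apply: phi0 => Kx.
  by move: (Kab _ Kx); rewrite /= in_itv/=; exact/negP.
split; first exact/smooth_ndiff.
exists `[a, b]%classic; split; first exact: segment_compact.
  by move=> x /=; rewrite in_itv/= => /andP[ax _]; rewrite halflineE (lt_le_trans a0).
by move=> x xab; apply: phi0; apply/negP => H; apply: xab; rewrite /= in_itv.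
Qed.

(* The support is strictly inside [a, b], so that phi vanishes at the ends. *)
Lemma test_supp phi : test_function phi ->
  exists a b, [/\ 0 < a, a < b & forall x, ~~ (a < x < b) -> phi x = 0].
Proof.
move=> /test_functionP[_ [a [b [a0 ab phi0]]]].
exists (a / 2), (b + 1); split=> [||x xab]; [lra|lra|apply: phi0].
apply: contra xab; lra.
Qed.

Lemma test_derive phi : test_function phi -> test_function (derive1 phi).
Proof.
move=> tphi; have [a [b [a0 ab phi0]]] := test_supp tphi.
apply/test_functionP; split.
  by move=> n; have /ndiffS[] := test_ndiff n.+1 tphi.
exists a, b; split=> // x xab.
rewrite derive1E; apply: derive_val.
apply: (near_eq_is_derive _ (is_derive_cst (0 : R) x 1)).
move: xab; rewrite negb_and -!ltNge => /orP[xa|xb]; near=> t; rewrite phi0//.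
  rewrite negb_and -!leNgt; apply/orP; left; apply/ltW.
  by near: t; exact: lt_nbhsl.
rewrite negb_and -!leNgt; apply/orP; right; apply/ltW.
by near: t; exact: lt_nbhsr.
Unshelve. all: by end_near. Qed.

Lemma testD phi psi c : test_function phi -> test_function psi ->
  test_function (fun x => phi x + c * psi x).
Proof.
move=> tphi tpsi; have [a [b [a0 ab phi0]]] := test_supp tphi.
have [a' [b' [a0' ab' psi0]]] := test_supp tpsi.
apply/test_functionP; split.
  move=> n; apply: ndiffD; first exact: test_ndiff.
  by apply: ndiffM; [exact: ndiff_cst|exact: test_ndiff].
exists (Num.min a a'), (Num.max b b'); split.
- by rewrite lt_min a0.
- by rewrite gt_min !lt_max ab.
- move=> x; rewrite ge_min le_max => H.
  rewrite phi0 ?psi0 ?mulr0 ?addr0//; apply: contra H => /andP[/ltW -> /ltW ->]//.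
  by rewrite !orbT.
Qed.

Lemma test_cont phi : test_function phi -> continuous phi.
Proof. by move=> tphi; apply: ndiff_continuous; exact: test_ndiff. Qed.

Lemma test_is_derive phi x : test_function phi -> is_derive x 1 phi (derive1 phi x).
Proof. by move=> tphi; have /ndiffS[] := test_ndiff 1 tphi. Qed.

Lemma cont_meas D f : measurable D -> continuous f -> measurable_fun D f.
Proof.
move=> mD cf; apply: measurable_funTS.
exact: continuous_measurable_fun.
Qed.

Lemma test_bounded phi : test_function phi -> exists M, 0 <= M /\ forall x, `|phi x| <= M.
Proof.
move=> tphi; have [a [b [a0 ab phi0]]] := test_supp tphi.
have cphi : {within `[a, b], continuous (fun x => `|phi x|)}.
  apply: continuous_subspaceT => x; apply: continuous_comp; first exact: test_cont.
  exact: norm_continuous.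
have [c _ Mc] := EVT_max (ltW ab) cphi.
exists `|phi c|; split=> // x; have [xab|xab] := boolP (a < x < b).
  by apply: Mc; rewrite in_itv/=; lra.
by rewrite phi0// normr0.
Qed.

Lemma sub_halfline a b : 0 < a -> `[a, b] `<=` (@halfline R).
Proof. by move=> a0 x /=; rewrite halflineE in_itv/=; lra. Qed.

Lemma itg_test u phi : locally_integrable halfline u -> test_function phi ->
  itg halfline (fun x => u x * phi x).
Proof.
move=> lu tphi; have [a [b [a0 ab phi0]]] := test_supp tphi.
have [M [M0 phiM]] := test_bounded tphi.
have mab : measurable (`[a, b] : set R) by exact: measurable_itv.
apply: (itg_ext mab halfline_meas (sub_halfline (b := b) a0)).
- move=> x _ xab; rewrite phi0 ?mulr0//; apply/negP => H; apply: xab.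
  by rewrite /= in_itv/=; lra.
- apply: (@itg_bounded _ _ _ _ M) => //; last exact: locint_itg.
  by apply: cont_meas => //; exact: test_cont.
Qed.

Lemma Rint_test u phi a b : 0 < a -> (forall x, ~~ (a < x < b) -> phi x = 0) ->
  \int[mu]_(x in halfline) (u x * phi x) = \int[mu]_(x in `[a, b]) (u x * phi x).
Proof.
move=> a0 phi0.
have mab : measurable (`[a, b] : set R) by exact: measurable_itv.
apply: (Rint_sub mab halfline_meas (sub_halfline (b := b) a0)).
move=> x _ xab; rewrite phi0 ?mulr0//; apply/negP => H; apply: xab.
by rewrite /= in_itv/=; lra.
Qed.

(** Inside ]a, b[ the factor l divides both exponents, so that the function tends to the indicator
    of ]a, b[ as l grows, with values between 0 and 1 and the same support for all l. *)
Definition bump (l a b x : R) : R := flat 0 (l * x - l * a) * flat 0 (- l * x + l * b).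

Lemma bump_ndiff n l a b : ndiff n (bump l a b).
Proof. exact: (ndiffM (ndiff_affine _ _ (ndiff_flat _ _)) (ndiff_affine _ _ (ndiff_flat _ _))). Qed.

Lemma bump0 l a b x : 0 < l -> ~~ (a < x < b) -> bump l a b x = 0.
Proof.
move=> l0; rewrite negb_and -!leNgt => H; rewrite /bump mulNr [X in _ * flat 0 X]addrC -!mulrBr /flat !pmulr_rgt0// !subr_gt0.
case: ifPn => [H1|_]; rewrite ?mul0r//.
by rewrite ifF ?mulr0//; apply/negbTE; lra.
Qed.

Lemma bumpE l a b x : 0 < l -> a < x -> x < b ->
  bump l a b x = expR (- (x - a)^-1 / l) * expR (- (b - x)^-1 / l).
Proof.
move=> l0 ax xb; rewrite /bump mulNr [X in _ * flat 0 X]addrC -!mulrBr.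
rewrite !flatE ?mulr_gt0 ?subr_gt0//.
by rewrite !expr0 !mul1r !invfM ![l^-1 * _]mulrC -!mulNr.
Qed.

Lemma bump_ge0 l a b x : 0 <= bump l a b x.
Proof. by rewrite mulr_ge0// flat_ge0. Qed.

Lemma bump_le1 l a b x : 0 < l -> bump l a b x <= 1.
Proof.
move=> l0; have [/andP[ax xb]|H] := boolP (a < x < b); last by rewrite bump0.
rewrite bumpE// -[1]mulr1; apply: ler_pM; rewrite ?expR_ge0// -expR0 ler_expR mulNr oppr_le0.
  by rewrite divr_ge0 ?invr_ge0 ?subr_ge0 ?(ltW ax) ?(ltW xb) ?(ltW l0).
by rewrite divr_ge0 ?invr_ge0 ?subr_ge0 ?(ltW ax) ?(ltW xb) ?(ltW l0).
Qed.

Lemma bump_test l a b : 0 < l -> 0 < a -> a < b -> test_function (bump l a b).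
Proof.
move=> l0 a0 ab; apply/test_functionP; split; first by move=> n; exact: bump_ndiff.
by exists a, b; split=> // x H; apply: bump0 => //; apply: contra H; lra.
Qed.

Lemma cvg_harmonicM (c : R) : c / n.+1%:R @[n --> \oo] --> (0 : R).
Proof.
rewrite -[X in _ --> X](mulr0 c).
by apply: cvgM; [exact: cvg_cst|exact: cvg_harmonic].
Qed.

Lemma bump_cvg a b x :
  bump n.+1%:R a b x @[n --> \oo] --> (if a < x < b then 1 else 0 : R).
Proof.
case: ifPn => xab; last first.
  rewrite (_ : (fun n => _) = fun=> 0); first exact: cvg_cst.
  by apply/funext => n; rewrite bump0.
have /andP[ax xb] := xab.
rewrite (_ : (fun n => _) = fun n => expR (- (x - a)^-1 / n.+1%:R) * expR (- (b - x)^-1 / n.+1%:R)); last first.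
  by apply/funext => n; rewrite bumpE.
have cE (c : R) : expR (c / n.+1%:R) @[n --> \oo] --> (1 : R).
  rewrite -[X in _ --> X](@expR0 R); apply: (continuous_cvg _ (@continuous_expR R 0)).
  exact: cvg_harmonicM.
by rewrite -[X in _ --> X](mulr1 (1 : R)); apply: cvgM; exact: cE.
Qed.

End TestFunctions.

(** * Locally integrable functions tested against smooth functions *)

Section DuBoisReymond.
Context {R : realType}.
Local Notation mu := (@lebesgue_measure R).
Implicit Types (D E : set R) (f g u v w phi psi : R -> R) (a b c x : R).

(** Dominated convergence along the bumps that tend to the indicator of ]a, b[; they are bounded by
    1, so |u| dominates. *)
Lemma locint_test_int0 u : locally_integrable halfline u ->
  (forall phi, test_function phi -> \int[mu]_(x in halfline) (u x * phi x) = 0) ->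
  forall a b, 0 < a -> a < b -> \int[mu]_(x in `[a, b]) u x = 0.
Proof.
move=> lu u0 a b a0 ab.
have mab : measurable (`[a, b]%classic : set R) by exact: measurable_itv.
have mab' : measurable (`]a, b[%classic : set R) by exact: measurable_itv.
have sab : `]a, b[%classic `<=` (`[a, b]%classic : set R) by exact: subset_itv_oo_cc.
have iu := locint_itg b a0 lu.
have mu_ := itg_meas iu.
pose un n x := (u x * bump n.+1%:R a b x)%:E.
pose i1 x : R := if a < x < b then 1 else 0.
pose u1 x := (u x * i1 x)%:E.
have mun n : measurable_fun `[a, b] (un n).
  apply/measurable_EFinP; apply: measurable_funM => //.
  by apply: cont_meas => //; apply: ndiff_continuous; exact: bump_ndiff.
have mi1 : measurable_fun `[a, b] i1.
  rewrite (_ : i1 = \1_(`]a, b[%classic : set R)); first exact: measurable_indic.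
  apply/funext => x; rewrite /i1 indicE; case: ifPn => H.
    by rewrite mem_set//= in_itv.
  by rewrite memNset//= in_itv/=; exact/negP.
have mu1 : measurable_fun `[a, b] u1.
  by apply/measurable_EFinP; apply: measurable_funM.
have cu : {ae mu, forall x, `[a, b]%classic x -> un ^~ x n @[n --> \oo] --> u1 x}.
  apply: ae_all => x _; apply: cvg_EFin; first by near=> n.
  by apply: cvgM; [exact: cvg_cst|exact: bump_cvg].
have du : {ae mu, forall x, forall n, `[a, b]%classic x -> (`|un n x| <= (`|u x|)%:E)%E}.
  apply: ae_all => x n _; rewrite /un /= lee_fin normrM ler_piMr//.
  by rewrite ger0_norm ?bump_ge0// bump_le1.
have [_ _] := @dominated_convergence _ _ _ mu `[a, b] mab un u1 _ mun mu1 cu (itg_abs iu) du.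
rewrite (_ : (fun n => _) = fun=> 0%E); last first.
  apply/funext => n; have tb := bump_test (ltr0Sn R n) a0 ab.
  rewrite /un itgE//.
    by rewrite -Rint_test ?u0// => x; exact: bump0.
  apply: (itgS mab halfline_meas (sub_halfline a0)).
  exact: itg_test.
move=> /cvg_lim; rewrite lim_cst// => /(_ (@ereal_hausdorff R)) H.
transitivity (\int[mu]_(x in `[a, b]) (u x * i1 x)); last by rewrite /Rintegral -H.
rewrite [RHS](Rint_sub mab' mab sab); last first.
  by move=> x _ H1; rewrite /i1/= ifF ?mulr0//; apply/negP => H2; apply: H1; rewrite /= in_itv.
have -> : \int[mu]_(x in `]a, b[) (u x * i1 x) = \int[mu]_(x in `]a, b[) u x.
  by apply: Rint_eq => x; rewrite /= in_itv/= /i1 => ->; rewrite mulr1.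
rewrite Rintegral_itv_bndo_bndc; last exact: itgS iu.
rewrite Rintegral_itv_obnd_cbnd//; apply: itgS iu => //.
by move=> x /=; rewrite !in_itv/= => /andP[/ltW -> ->].
Unshelve. all: by end_near. Qed.

(** Lebesgue differentiation: the primitive of u from c vanishes identically, and its derivative is
    u almost everywhere. The extension f of u by 0 is there because the differentiation theorem asks
    for local integrability on the whole line. *)
Lemma int0_ae0_above u c : measurable_fun `[c, +oo[ u ->
  (forall b, c < b -> itg `[c, b] u) ->
  (forall b, c < b -> \int[mu]_(x in `[c, b]) u x = 0) ->
  {ae mu, forall x, c < x -> u x = 0}.
Proof.
move=> mu_ iu u0.
pose f := u \_ `[c, +oo[.
have mc : measurable (`[c, +oo[%classic : set R) by exact: measurable_itv.
have fE x b : `[c, b]%classic x -> f x = u x.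
  rewrite /f patchE /= in_itv/= => /andP[cx _]; rewrite mem_set//=.
  by rewrite in_itv/= cx.
have ifb b : itg `[c, b] f.
  have [cb|bc] := ltP c b.
    by apply: itg_eq (iu b cb) => // x H; rewrite (fE _ b).
  have i0 : itg `[c, c + 1] u by apply: iu; lra.
  apply: (@itg_eq _ _ u) => //; first by move=> x H; rewrite (fE _ b).
  by apply: itgS i0 => // x /=; rewrite !in_itv/=; lra.
have locf : locally_integrable setT f.
split; [exact/(measurable_restrictT _ _).1|exact: openT|].
  move=> K _ cK.
  have [M [_ HM]] := compact_bounded cK.
  have KM : forall x, K x -> `|x| <= `|M| + 1.
    by move=> x Kx; apply: (HM (`|M| + 1)) => //; rewrite (le_lt_trans (ler_norm M))// ltrDl.
  have := ifb (`|M| + 1) => /itgP[mfM fM].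
  have mK : measurable K by exact: compact_measurable.
  rewrite integral_mkcond; apply: le_lt_trans fM.
  rewrite [leRHS]integral_mkcond; apply: ge0_le_integral => //.
  - by move=> x _; rewrite patchE; case: ifPn => //= _; rewrite lee_fin.
  - apply/(measurable_restrictT _ _).1 => //.
    apply/measurable_EFinP; apply: measurableT_comp => //.
    by apply: measurable_funTS; exact/(measurable_restrictT _ _).1.
  - by apply/(measurable_restrictT _ _).1 => //; apply/measurable_EFinP; exact: measurableT_comp.
  - move=> x _; rewrite !patchE; case: ifPn => xK; last by case: ifP => //= _; rewrite lee_fin.
    case: ifPn => // xM; rewrite lee_fin /f patchE ifF ?normr0//.
    apply/negbTE; apply: contra xM; rewrite !inE/= !in_itv/= andbT => ->/=.
    by apply: le_trans (KM _ (set_mem xK)); exact: ler_norm.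
have := FTC1 ifb locf.
apply: ae_imp => x H cx.
have [|_] := H; first by move: (ltW cx).
rewrite (fE _ x); last by rewrite /= in_itv/= lexx ltW.
move=> <-; rewrite derive1E; apply: derive_val.
apply: (near_eq_is_derive _ (is_derive_cst (0 : R) x 1)).
near=> y; have cy : c < y by near: y; exact: lt_nbhsr.
rewrite -(u0 y cy); apply: Rint_eq => z zcy.
by rewrite (fE _ y).
Unshelve. all: by end_near. Qed.

Lemma locint_test0 u : locally_integrable halfline u ->
  (forall phi, test_function phi -> \int[mu]_(x in halfline) (u x * phi x) = 0) ->
  {ae mu, forall x, halfline x -> u x = 0}.
Proof.
move=> lu u0; have I0 := locint_test_int0 lu u0.
(* u need not be integrable near 0, so the half-line is exhausted by the intervals above 1/(n+1). *)
have H n : {ae mu, forall x, n.+1%:R^-1 < x -> u x = 0}.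
  have n0 : 0 < n.+1%:R^-1 :> R by rewrite invr_gt0.
  apply: int0_ae0_above.
  - case: lu => mu_ _ _; apply: measurable_funS mu_; first exact: halfline_meas.
    by move=> x /=; rewrite halflineE in_itv/= andbT; exact: lt_le_trans.
  - by move=> b nb; exact: locint_itg.
  - by move=> b nb; exact: I0.
have := @ae_foralln _ _ _ mu (fun n x => n.+1%:R^-1 < x -> u x = 0) H.
apply: ae_imp => x Hx; rewrite halflineE => x0.
have [n nx] := ltr_add_invr x0.
by apply: (Hx n); rewrite add0r in nx.
Qed.

(** The primitive from minus infinity vanishes to the left of the support, and to the right of it
    equals the total integral, which is 0: it is again compactly supported. *)
Lemma test_primitive psi : test_function psi ->
  \int[mu]_(x in halfline) psi x = 0 ->
  exists phi, test_function phi /\ derive1 phi = psi.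
Proof.
move=> tpsi psi0; have [a [b [a0 ab psiab]]] := test_supp tpsi.
have mab : measurable (`[a, b]%classic : set R) by exact: measurable_itv.
pose phi x := \int[mu]_(t in `]-oo, x]) psi t.
have ipsi : itg setT psi.
  apply: (@itg_ext _ `[a, b] setT) => //.
    move=> x _ xab; apply: psiab; apply/negP => H; apply: xab.
    by rewrite /= in_itv/=; lra.
  by apply: itg_cont; apply: continuous_subspaceT; exact: test_cont.
have D x : is_derive x 1 phi (psi x).
  have [||||dphi phiE] := @continuous_FTC1 R psi -oo%O x (x + 1) _ _ _ _.
  - by rewrite ltrDl.
  - exact: (itgS _ _ (subsetT _) ipsi).
  - exact: ltNyr.
  - exact: test_cont.
  - by apply: DeriveDef; [exact: dphi|rewrite -derive1E; exact: phiE].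
exists phi; split; last exact: is_derive_derive1.
apply/test_functionP; split.
  by case=> [|n]; [exact: ndiff0|apply: (ndiff_isD D); exact: test_ndiff].
exists a, b; split=> // x; rewrite negb_and -!ltNge => /orP[xa|bx].
  rewrite /phi (@Rint_sub _ set0)// ?Rintegral_set0// => y /=; rewrite in_itv/= => yx _.
  by apply: psiab; lra.
rewrite -psi0 /phi.
have sab : `[a, b] `<=` `]-oo, x] by move=> y /=; rewrite !in_itv/=; lra.
have z y : ~ `[a, b]%classic y -> psi y = 0.
  move=> yab; apply: psiab; apply/negP => H; apply: yab.
  by rewrite /= in_itv/=; lra.
rewrite (Rint_sub mab _ sab)//; last by move=> y _; exact: z.
by rewrite (Rint_sub mab halfline_meas (sub_halfline a0))// => y _; exact: z.
Unshelve. all: by [].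
Qed.

Lemma flat0_homo s r : 0 < s -> s <= r -> flat 0 s <= flat 0 r :> R.
Proof.
move=> s0 sr; have r0 := lt_le_trans s0 sr.
by rewrite !flatE// !expr0 !mul1r ler_expR lerN2 lef_pV2 ?posrE.
Qed.

Lemma exists_bump : exists rho, test_function rho /\
  0 < \int[mu]_(x in halfline) rho x.
Proof.
have h14 : 0 < 4^-1 :> R by rewrite invr_gt0.
have rt : test_function (bump 1 1 2 : R -> R) by apply: bump_test; lra.
exists (bump 1 1 2); split=> //.
(* On [5/4, 7/4] both arguments x - 1 and 2 - x are at least 1/4, so c is a lower bound of the bump
   there. *)
pose c : R := flat 0 4^-1 * flat 0 4^-1.
have c0 : 0 < c by rewrite /c flatE// expr0 mul1r mulr_gt0 ?expR_gt0.
have m1 : measurable (`[5/4 : R, 7/4]%classic : set R) by exact: measurable_itv.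
have irho : itg halfline (bump 1 1 2 : R -> R).
  apply: (@itg_eq _ _ (fun x => 1 * bump 1 1 2 x)) => //.
  - exact: halfline_meas.
  - by move=> x _; rewrite mul1r.
  apply: (itg_test (u := fun=> 1)) => //.
  by apply: locintP => // a b _ _; exact: itg_cst.
have sub : `[5/4 : R, 7/4] `<=` halfline by apply: sub_halfline; lra.
apply: (@lt_le_trans _ _ (\int[mu]_(x in `[5/4 : R, 7/4]) c)).
  rewrite Rintegral_cst//; apply: mulr_gt0 => //.
  have E : mu (`[5/4, 7/4]%classic : set R) = (7/4 - 5/4)%:E.
    by rewrite lebesgue_measure_itv/= lte_fin ifT ?EFinB//; lra.
  by rewrite (_ : fine _ = 7/4 - 5/4); [lra|exact: (congr1 fine E)].
apply: (@le_trans _ _ (\int[mu]_(x in `[5/4 : R, 7/4]) bump 1 1 2 x)).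
  apply: le_Rintegral => //; first exact: itg_cst.
    exact: (itgS m1 halfline_meas sub irho).
  move=> x; rewrite /= in_itv/= => xI; rewrite /bump/c.
  by apply: ler_pM; rewrite ?flat_ge0//; apply: flat0_homo => //; lra.
rewrite [leLHS]Rintegral_mkcond [leRHS]Rintegral_mkcond.
apply: le_Rintegral => //.
- by rewrite -restrict_EFin; apply/(integrable_mkcond (mu := mu) _ m1); exact: (itgS m1 halfline_meas sub irho).
- by rewrite -restrict_EFin; apply/(integrable_mkcond (mu := mu) _ halfline_meas).
- move=> x _; rewrite !patchE; case: ifPn => xI; last by case: ifP => // _; exact: bump_ge0.
  by rewrite mem_set//; apply: sub; exact: set_mem.
Qed.

Lemma test_itg psi : test_function psi -> itg halfline psi.
Proof.
move=> tpsi; have [a [b [a0 ab psi0]]] := test_supp tpsi.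
have mab : measurable (`[a, b]%classic : set R) by exact: measurable_itv.
apply: (itg_ext mab halfline_meas (sub_halfline (b := b) a0)).
  move=> x _ xab; apply: psi0; apply/negP => H; apply: xab.
  by rewrite /= in_itv/=; lra.
by apply: itg_cont; apply: continuous_subspaceT; exact: test_cont.
Qed.

Lemma locint_cst c : locally_integrable (@halfline R) (fun=> c).
Proof. by apply: locintP => // a b _ _; exact: itg_cst. Qed.

(** Subtracting from psi the multiple of rho with the same integral leaves a function of zero mean,
    hence the derivative of a test function, on which u vanishes. The constant is therefore the mean
    of u weighted by rho. *)
Lemma locint_derive0 u : locally_integrable halfline u ->
  (forall phi, test_function phi -> \int[mu]_(x in halfline) (u x * derive1 phi x) = 0) ->
  exists c, {ae mu, forall x, halfline x -> u x = c}.
Proof.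
move=> lu u0; have [rho [trho m0]] := exists_bump.
set m := Rintegral _ _ _ in m0.
pose c := (\int[mu]_(x in halfline) (u x * rho x)) / m; exists c.
suff : {ae mu, forall x, halfline x -> u x - c = 0}.
  by apply: ae_imp => x H /H /eqP; rewrite subr_eq0 => /eqP.
have mh := @halfline_meas R.
apply: locint_test0; first exact: (locally_integrableB lu (locint_cst c)).
move=> psi tpsi; pose k := (\int[mu]_(x in halfline) psi x) / m.
have t0 := testD (- k) tpsi trho.
have [|phi [tphi phiE]] := test_primitive t0.
  rewrite RintegralD//; [|exact: test_itg|by apply: itgZ => //; exact: test_itg].
  rewrite RintegralZl//; last exact: test_itg.
  by rewrite -/m /k; field; rewrite gt_eqF.
have := u0 _ tphi; rewrite phiE.
have iup := itg_test lu tpsi; have iur := itg_test lu trho.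
have -> : \int[mu]_(x in halfline) (u x * (psi x + - k * rho x)) =
    \int[mu]_(x in halfline) (u x * psi x) - k * \int[mu]_(x in halfline) (u x * rho x).
  rewrite -RintegralZl// -RintegralB//; last exact: itgZ.
  by apply: Rint_eq => x _; ring.
move=> E.
have -> : \int[mu]_(x in halfline) ((u x - c) * psi x) =
    \int[mu]_(x in halfline) (u x * psi x) - c * \int[mu]_(x in halfline) psi x.
  rewrite -RintegralZl//; last exact: test_itg.
  rewrite -RintegralB//; last by apply: itgZ => //; exact: test_itg.
  by apply: Rint_eq => x _; ring.
by rewrite -[RHS]E /c /k; ring.
Qed.

End DuBoisReymond.

(** * Primitives and weak derivatives on the half-line *)

Section Primitives.
Context {R : realType}.
Local Notation mu := (@lebesgue_measure R).
Implicit Types (D E : set R) (f g u v w phi psi F : R -> R) (a b c x : R).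

Lemma continuous_density_L1 a b w e : itg `[a, b] w -> 0 < e ->
  exists g, continuous g /\ \int[mu]_(x in `[a, b]) `|w x - g x| < e.
Proof.
move=> iw e0; have mab : measurable (`[a, b]%classic : set R) by exact: measurable_itv.
have fab : (mu (`[a, b]%classic : set R) < +oo)%E.
  by rewrite lebesgue_measure_itv/=; case: ifP => _; rewrite -?EFinD ltry.
have [g [cg _ cvg_g]] := approximation_continuous_integrable mab fab iw.
move/fine_cvgP : cvg_g => [_ /cvgr0Pnorm_lt/(_ _ e0)].
case=> n _ Hn; exists (g n); split; first exact: cg.
by have := Hn n (leqnn n); apply: le_lt_trans; exact: ler_norm.
Qed.

Lemma Rint_abs D f : measurable D -> itg D f ->
  `|\int[mu]_(x in D) f x| <= \int[mu]_(x in D) `|f x|.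
Proof. by move=> mD fi; exact: (le_normr_Rintegral _ fi). Qed.

Lemma small_eq0 (r K : R) : (forall e, 0 < e -> `|r| <= K * e) -> r = 0.
Proof.
move=> H; apply/eqP; rewrite -normr_le0; apply/ler_addgt0Pr => e e0; rewrite add0r.
have K1 : 0 < `|K| + 1 by rewrite ltr_pwDr.
apply: (le_trans (H (e / (`|K| + 1)) _)); first by rewrite divr_gt0.
rewrite mulrCA ger_pMr// ler_pdivrMr// mul1r.
by have := ler_norm K; lra.
Qed.

(** Integrability up to the end point 0, stronger than local integrability on the open half-line;
    this is what gives a primitive its trace at 0. *)
Definition locitg0 w := forall b, itg `[0, b] w.

(** The pointwise form of F' = w used throughout: it makes sense for w known up to null sets and it
    reaches the end point 0. *)
Definition prim F w := forall x, 0 <= x -> F x = F 0 + \int[mu]_(t in `[0, x]) w t.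

Lemma itg_sub_itv a b c d f : c <= a -> b <= d -> itg `[c, d] f -> itg `[a, b] f.
Proof.
move=> ca bd; apply: itgS => // x /=; rewrite !in_itv/= => /andP[ax xb].
by rewrite (le_trans ca ax) (le_trans xb bd).
Qed.

Lemma Rint_chasles f a b c : a <= b -> b <= c -> itg `[a, c] f ->
  \int[mu]_(x in `[a, c]) f x =
  \int[mu]_(x in `[a, b]) f x + \int[mu]_(x in `[b, c]) f x.
Proof.
move=> ab bc fi.
have := @Rintegral_itvB R f (BLeft a) (BRight c) b fi.
rewrite !bnd_simp => /(_ ab bc)/eqP; rewrite subr_eq addrC => /eqP ->; congr (_ + _).
rewrite Rintegral_itv_obnd_cbnd//; apply: itgS fi => //.
by move=> x /=; rewrite !in_itv/= => /andP[bx ->]; rewrite (le_trans ab (ltW bx)).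
Qed.

Lemma prim_sub F w x y : locitg0 w -> prim F w -> 0 <= x -> x <= y ->
  F y - F x = \int[mu]_(t in `[x, y]) w t.
Proof.
move=> iw FE x0 xy; rewrite (FE y) ?(le_trans x0)// (FE x)//.
by rewrite (Rint_chasles x0 xy)//; ring.
Qed.

Lemma within_eq D f g : (forall x, D x -> f x = g x) ->
  {within D, continuous f} -> {within D, continuous g}.
Proof.
move=> fg cf; refine (@subspace_eq_continuous _ D _ f g _ cf).
by move=> x /[!inE]; exact: fg.
Qed.

Lemma prim_within F w b : 0 <= b ->
  (forall x, 0 <= x <= b -> F x = F 0 + \int[mu]_(t in `[0, x]) w t) ->
  itg `[0, b] w -> {within `[0, b], continuous F}.
Proof.
move=> b0 FE iw; have cG := parameterized_integral_continuous b0 iw.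
apply: (@within_eq _ (fun x => F 0 + \int[mu]_(t in `[0, x]) w t)).
  by move=> x; rewrite /= in_itv/= => /FE.
by move=> x; apply: cvgD; [exact: cvg_cst|exact: cG].
Qed.

Lemma prim_continuous F w : locitg0 w -> prim F w ->
  {within `[0, +oo[, continuous F}.
Proof.
move=> iw FE; have W b (b0 : 0 <= b) : {within `[0, b], continuous F}.
  by apply: prim_within b0 _ (iw b) => x /andP[x0 _]; exact: FE.
apply/continuous_within_itvcyP; split.
  move=> x; rewrite in_itv/= andbT => x0.
  have x1 : 0 < x + 1 by lra.
  have /(continuous_within_itvP _ x1)[+ _ _] := W _ (ltW x1).
  by apply; rewrite in_itv/=; lra.
by have /(continuous_within_itvP _ ltr01)[] := W _ ler01.
Qed.

Lemma prim_itg F w b : locitg0 w -> prim F w -> 0 <= b -> itg `[0, b] F.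
Proof.
move=> iw FE b0; apply/itg_cont/(prim_within b0 _ (iw b)) => x /andP[x0 _].
exact: FE.
Qed.

Lemma prim_meas F w : locitg0 w -> prim F w -> measurable_fun halfline F.
Proof.
move=> iw FE; have m : measurable_fun (`[0, +oo[%classic : set R) F.
  by apply: subspace_continuous_measurable_fun => //; exact: prim_continuous iw FE.
apply: measurable_funS m => //.
by move=> x /=; rewrite halflineE in_itv/= andbT; exact: ltW.
Qed.

Lemma locitg0_meas w : locitg0 w -> measurable_fun halfline w.
Proof.
move=> iw; rewrite (_ : halfline = \bigcup_n `]0, n%:R]%classic).
  apply/measurable_fun_bigcup => // n.
  apply: measurable_funS (itg_meas (iw n%:R)) => //.
  by move=> x /=; rewrite !in_itv/= => /andP[/ltW -> ->].
apply/seteqP; split=> x.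
  rewrite halflineE => x0; exists (Num.bound x) => //=.
  by rewrite in_itv/= x0/=; apply/ltW; exact: archi_boundP (ltW x0).
by case=> n _ /=; rewrite halflineE in_itv/= => /andP[].
Qed.

Lemma locitg0_locint w : locitg0 w -> locally_integrable halfline w.
Proof.
move=> iw; apply: locintP; first exact: locitg0_meas.
by move=> a b a0 ab; exact: itg_sub_itv (ltW a0) (lexx b) (iw b).
Qed.

Lemma prim_locint F w : locitg0 w -> prim F w -> locally_integrable halfline F.
Proof.
move=> iw FE; apply: locintP; first exact: prim_meas iw FE.
move=> a b a0 ab.
have b0 : 0 <= b by lra.
exact: itg_sub_itv (ltW a0) (lexx b) (prim_itg iw FE b0).
Qed.

Lemma prim_cont_is_derive g c x : continuous g -> 0 < x ->
  is_derive x 1 (fun x => c + \int[mu]_(t in `[0, x]) g t) (g x).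
Proof.
move=> cg x0.
have ig b : itg `[0, b] g by apply: itg_cont; exact: continuous_subspaceT.
have xx1 : x < x + 1 by lra.
have [dG GE] := continuous_FTC1_closed xx1 (ig (x + 1)) x0 (cg x).
have D : is_derive x 1 (fun x => \int[mu]_(t in `[0, x]) g t) (g x).
  by apply: DeriveDef; [exact: dG|rewrite -derive1E; exact: GE].
have := is_deriveD (is_derive_cst c x 1) D.
by rewrite add0r.
Qed.

Lemma is_derive_cont f df x : is_derive x 1 f df -> {for x, continuous f}.
Proof.
move=> D; apply: differentiable_continuous; apply/derivable1_diffP.
exact: ex_derive.
Qed.

Lemma derivable_cc F f a c : a < c -> (forall x, a <= x <= c -> is_derive x 1 F (f x)) ->
  derivable_oo_LRcontinuous F a c.
Proof.
move=> ac D; have aac : a <= a <= c by rewrite lexx ltW.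
have acc : a <= c <= c by rewrite lexx ltW.
split.
- move=> x; rewrite in_itv/= => /andP[ax xc].
  have axc : a <= x <= c by rewrite (ltW ax) (ltW xc).
  by have := D x axc => -[].
- by apply: cvg_at_right_filter; exact: is_derive_cont (D _ aac).
- by apply: cvg_at_left_filter; exact: is_derive_cont (D _ acc).
Qed.

Lemma cont_prim_ibp g c phi a b : continuous g -> test_function phi ->
  0 < a -> a < b -> (forall x, ~~ (a < x < b) -> phi x = 0) ->
  \int[mu]_(x in `[a, b]) ((c + \int[mu]_(t in `[0, x]) g t) * derive1 phi x) =
  - \int[mu]_(x in `[a, b]) (g x * phi x).
Proof.
move=> cg tphi a0 ab phi0.
pose G x := c + \int[mu]_(t in `[0, x]) g t.
have DG x : a <= x -> is_derive x 1 G (g x).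
  by move=> ax; apply: prim_cont_is_derive => //; exact: lt_le_trans ax.
have Dphi x : a <= x -> is_derive x 1 phi (derive1 phi x).
  by move=> _; exact: test_is_derive.
have cphi' := test_cont (test_derive tphi).
have cW f : continuous f -> {within `[a, b], continuous f}.
  by move=> cf; exact: continuous_subspaceT.
have E1 : {in `]a, b[, derive1 G =1 g}.
  move=> x; rewrite in_itv/= => /andP[ax _].
  by rewrite derive1E; have := DG x (ltW ax) => -[].
have := integration_by_parts ab (cW _ cg) (derivable_cc ab (fun x xab => DG x (proj1 (andP xab)))) E1 (cW _ cphi')
  (derivable_cc ab (fun x xab => Dphi x (proj1 (andP xab)))) (fun x _ => erefl).
rewrite !phi0 ?ltxx ?andbF// !mulr0 subr0 sub0e => E.
by rewrite /Rintegral -/(G _) E fineN.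
Qed.

(** On the support of phi, w is approximated in L^1 by a continuous g, for whose primitive G the
    classical integration by parts holds; the errors w - g and F - G are then paired with bounded
    functions. *)
Lemma prim_ibp F w phi : locitg0 w -> prim F w -> test_function phi ->
  \int[mu]_(x in halfline) (F x * derive1 phi x) =
  - \int[mu]_(x in halfline) (w x * phi x).
Proof.
move=> iw FE tphi; have tphi' := test_derive tphi.
have [a [b [a0 ab phi0 phi'0]]] : exists a b, [/\ 0 < a, a < b,
    forall x, ~~ (a < x < b) -> phi x = 0 &
    forall x, ~~ (a < x < b) -> derive1 phi x = 0].
  have [a [b [a0 ab phi0]]] := test_supp tphi.
  have [a' [b' [a'0 ab' phi'0]]] := test_supp tphi'.
  exists (Num.min a a'), (Num.max b b'); split.
  - by rewrite lt_min a0.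
  - by rewrite gt_min !lt_max ab.
  - move=> x; rewrite gt_min lt_max => H; apply: phi0; apply: contra H => /andP[-> ->]//.
  - move=> x; rewrite gt_min lt_max => H; apply: phi'0; apply: contra H => /andP[-> ->]//.
    by rewrite !orbT.
have [M [M0 phiM]] := test_bounded tphi.
have [M' [M'0 phiM']] := test_bounded tphi'.
have mab : measurable (`[a, b]%classic : set R) by exact: measurable_itv.
have [b0 lab] : 0 <= b /\ a <= b by lra.
have iF : itg `[a, b] F.
  exact: itg_sub_itv (ltW a0) (lexx b) (prim_itg iw FE b0).
rewrite !(@Rint_test _ _ _ a b)//.
suff: \int[mu]_(x in `[a, b]) (F x * derive1 phi x) + \int[mu]_(x in `[a, b]) (w x * phi x) = 0 by lra.
(* On [a, b], F - G is bounded by the L^1 norm of w - g, hence by e: paired with the derivative of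
   phi it costs M' (b - a) e, while w - g paired with phi costs M e. *)
apply: (@small_eq0 _ (M' * (b - a) + M)) => e e0.
have [g [cg wg]] := continuous_density_L1 (iw b) e0.
have ig c d : itg `[c, d] g by apply: itg_cont; exact: continuous_subspaceT.
pose G x := F 0 + \int[mu]_(t in `[0, x]) g t.
have iG : itg `[a, b] G.
  apply: (itg_sub_itv (ltW a0) (lexx b)); apply: (@prim_itg _ g) => // x x0.
  by rewrite /G set_itv1 Rintegral_set1 addr0.
have ibp := cont_prim_ibp (F 0) cg tphi a0 ab phi0.
have cphi := test_cont tphi; have cphi' := test_cont tphi'.
have mphi : measurable_fun `[a, b] phi by exact: cont_meas.
have mphi' : measurable_fun `[a, b] (derive1 phi) by exact: cont_meas.
have iwab := itg_sub_itv (ltW a0) (lexx b) (iw b).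
have B f psi K : measurable_fun `[a, b] psi -> (forall x, `|psi x| <= K) -> itg `[a, b] f ->
    itg `[a, b] (fun x => f x * psi x).
  by move=> mpsi HK; apply: (itg_bounded (M := K)).
have E : \int[mu]_(x in `[a, b]) (F x * derive1 phi x) + \int[mu]_(x in `[a, b]) (w x * phi x) =
    \int[mu]_(x in `[a, b]) ((F x - G x) * derive1 phi x) +
    \int[mu]_(x in `[a, b]) ((w x - g x) * phi x).
  have E1 : \int[mu]_(x in `[a, b]) ((F x - G x) * derive1 phi x) =
     \int[mu]_(x in `[a, b]) (F x * derive1 phi x) - \int[mu]_(x in `[a, b]) (G x * derive1 phi x).
    by rewrite -RintegralB//; [apply: Rint_eq => x _; ring|exact: B phiM' _|exact: B phiM' _].
  have E2 : \int[mu]_(x in `[a, b]) ((w x - g x) * phi x) =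
     \int[mu]_(x in `[a, b]) (w x * phi x) - \int[mu]_(x in `[a, b]) (g x * phi x).
    by rewrite -RintegralB//; [apply: Rint_eq => x _; ring|exact: B phiM _|exact: B phiM _].
  by rewrite E1 E2 ibp; ring.
rewrite E; apply: le_trans (ler_normD _ _) _; rewrite mulrDl; apply: lerD.
  apply: (le_trans (Rint_abs mab _)).
    by apply: B phiM' _ => //; exact: itgB.
  rewrite (_ : M' * (b - a) * e = \int[mu]_(x in `[a, b]) (e * M')); last first.
    rewrite Rintegral_cst// (_ : fine _ = b - a); first by ring.
    have mE : mu (`[a, b]%classic : set R) = (b - a)%:E.
      by rewrite lebesgue_measure_itv/= lte_fin ab EFinB.
    exact: (congr1 fine mE).
  apply: le_Rintegral => //.
  - by apply: itg_abs; apply: B phiM' _ => //; exact: itgB.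
  - exact: itg_cst.
  - move=> x; rewrite /= in_itv/= => /andP[ax xb]; rewrite normrM.
    apply: ler_pM => //.
    have x0 : 0 <= x by lra.
    have iwx := itg_sub_itv (lexx 0) xb (iw b).
    rewrite (FE x)// /G opprD addrACA subrr add0r -RintegralB//; last exact: ig.
    apply: (le_trans (Rint_abs _ _)) => //; first exact: itgB.
    apply: le_trans (ltW wg).
    rewrite (@Rint_chasles _ 0 x b)//; last by apply: itg_abs; apply: itgB.
    by rewrite lerDl; apply: Rintegral_ge0.
apply: (le_trans (Rint_abs mab _)).
  by apply: B phiM _ => //; exact: itgB.
apply: (@le_trans _ _ (M * \int[mu]_(x in `[a, b]) `|w x - g x|)).
  rewrite -RintegralZl//; last by apply: itg_abs; apply: itgB.
  apply: le_Rintegral => //.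
  - by apply: itg_abs; apply: B phiM _ => //; exact: itgB.
  - by apply: itgZ => //; apply: itg_abs; apply: itgB.
  - by move=> x _; rewrite normrM mulrC ler_wpM2r.
rewrite ler_wpM2l//; apply: le_trans (ltW wg).
rewrite (@Rint_chasles _ 0 a b)//; [|exact: ltW|by apply: itg_abs; apply: itgB].
by rewrite lerDr; apply: Rintegral_ge0.
Qed.

End Primitives.

(** * Square-integrable functions and their squared norms *)

Section SquareIntegrable.
Context {R : realType}.
Local Notation mu := (@lebesgue_measure R).
Implicit Types (D E : set R) (f g u v w phi psi F : R -> R) (a b c x : R).

Definition sqi D f : Prop := measurable_fun D f /\ itg D (fun x => f x ^+ 2).

Definition n2 D f : R := \int[mu]_(x in D) (f x) ^+ 2.

Lemma n2_ge0 D f : 0 <= n2 D f.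
Proof. by apply: Rintegral_ge0 => x _; exact: sqr_ge0. Qed.

Lemma meas_sqr D f : measurable_fun D f -> measurable_fun D (fun x => f x ^+ 2).
Proof. by move=> mf; exact: measurable_funX. Qed.

Lemma sqiM D f g : measurable D -> sqi D f -> sqi D g -> itg D (fun x => f x * g x).
Proof.
move=> mD [mf if_] [mg ig]; apply: (@itg_le _ _ _ (fun x => f x ^+ 2 + g x ^+ 2)) => //.
- exact: measurable_funM.
- move=> x _; rewrite normrM -[f x ^+ 2]real_normK ?num_real// -[g x ^+ 2]real_normK ?num_real//.
  by have := sqr_ge0 (`|f x| - `|g x|); have := sqr_ge0 (`|f x| + `|g x|); nra.
- exact: itgD.
Qed.

Lemma sqiD D f g : measurable D -> sqi D f -> sqi D g -> sqi D (fun x => f x + g x).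
Proof.
move=> mD sf sg; split; first by apply: measurable_funD; [case: sf|case: sg].
apply: (@itg_eq _ _ (fun x => f x ^+ 2 + (2 * (f x * g x) + g x ^+ 2))) => //.
  by move=> x _; ring.
apply: itgD => //; first by case: sf.
by apply: itgD => //; [apply: itgZ => //; exact: sqiM|case: sg].
Qed.

Lemma sqiZ D f c : measurable D -> sqi D f -> sqi D (fun x => c * f x).
Proof.
move=> mD [mf fi]; split; first exact: measurable_funM.
apply: (@itg_eq _ _ (fun x => c ^+ 2 * f x ^+ 2)) => //; first by move=> x _; rewrite exprMn.
exact: itgZ.
Qed.

Lemma sqi_eq D f g : measurable D -> (forall x, D x -> f x = g x) -> sqi D f -> sqi D g.
Proof.
move=> mD fg [mf fi]; split.
  by apply: eq_measurable_fun mf => x /[!inE]; exact: fg.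
by apply: itg_eq fi => // x Dx; rewrite fg.
Qed.

Lemma sqiN D f : measurable D -> sqi D f -> sqi D (fun x => - f x).
Proof.
move=> mD sf; apply: (sqi_eq mD _ (sqiZ (-1) mD sf)) => x _.
by rewrite mulN1r.
Qed.

Lemma sqiB D f g : measurable D -> sqi D f -> sqi D g -> sqi D (fun x => f x - g x).
Proof. by move=> mD sf sg; apply: sqiD => //; exact: sqiN. Qed.

Lemma sqi0 D : measurable D -> sqi D (fun=> 0).
Proof.
move=> mD; split; first exact: measurable_cst.
apply: (@itg_eq _ _ (fun=> 0)) => //; first by move=> x _; rewrite expr0n.
by apply: itg_lty => //; under eq_integral do rewrite normr0; rewrite integral0 ltry.
Qed.

Lemma sqiS D E f : measurable D -> measurable E -> D `<=` E -> sqi E f -> sqi D f.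
Proof.
move=> mD mE DE [mf fi]; split; first exact: measurable_funS mf.
exact: itgS fi.
Qed.

Lemma sqi_itv a b f : sqi `[a, b] f -> itg `[a, b] f.
Proof.
move=> [mf fi]; apply: (@itg_le _ _ _ (fun x => 1 + f x ^+ 2)) => //.
  move=> x _; rewrite -[f x ^+ 2]real_normK ?num_real//.
  by have := sqr_ge0 (`|f x| - 1); nra.
by apply: itgD => //; exact: itg_cst.
Qed.

Lemma sqi_cont a b f : {within `[a, b], continuous f} -> sqi `[a, b] f.
Proof.
move=> cf; split; first exact: itg_meas (itg_cont cf).
apply: itg_cont => x; apply: (@continuous_comp _ _ _ _ (fun y : R => y ^+ 2)); first exact: cf.
exact: exprn_continuous.
Qed.

Lemma sqi_ae D f g : measurable D -> measurable_fun D g ->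
  {ae mu, forall x, D x -> f x = g x} -> sqi D f -> sqi D g.
Proof.
move=> mD mg fg [mf fi]; split=> //.
apply: itg_ae fi => //; first exact: meas_sqr.
by apply: ae_imp fg => x H Dx; rewrite H.
Qed.

Lemma n2_ae D f g : measurable D -> measurable_fun D f -> measurable_fun D g ->
  {ae mu, forall x, D x -> f x = g x} -> n2 D f = n2 D g.
Proof.
move=> mD mf mg fg; apply: Rint_ae => //; [exact: meas_sqr|exact: meas_sqr|].
by apply: ae_imp fg => x H Dx; rewrite H.
Qed.

Lemma n2_eq D f g : (forall x, D x -> f x = g x) -> n2 D f = n2 D g.
Proof. by move=> fg; apply: Rint_eq => x Dx; rewrite fg. Qed.

Lemma n2Z D f c : measurable D -> sqi D f -> n2 D (fun x => c * f x) = c ^+ 2 * n2 D f.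
Proof.
move=> mD [mf fi]; rewrite -RintegralZl//.
by apply: Rint_eq => x _; rewrite exprMn.
Qed.

Lemma n2D D f g : measurable D -> sqi D f -> sqi D g ->
  n2 D (fun x => f x + g x) = n2 D f + 2 * \int[mu]_(x in D) (f x * g x) + n2 D g.
Proof.
move=> mD sf sg; have fgi := sqiM mD sf sg; case: sf => mf if_; case: sg => mg ig.
rewrite /n2 -RintegralZl// -RintegralD//; last exact: itgZ.
rewrite -RintegralD//; last by apply: itgD => //; exact: itgZ.
by apply: Rint_eq => x _; ring.
Qed.

(** Young's inequality: expand |e f + s g|^2 >= 0 for s = 1 and s = -1, and divide by e. *)
Lemma n2_dot D f g e : measurable D -> 0 < e -> sqi D f -> sqi D g ->
  `|2 * \int[mu]_(x in D) (f x * g x)| <= e * n2 D f + e^-1 * n2 D g.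
Proof.
move=> mD e0 sf sg; have fgi := sqiM mD sf sg.
have e0' : e != 0 by rewrite gt_eqF.
have H (s : R) : 0 <= e * n2 D f + 2 * (s * \int[mu]_(x in D) (f x * g x)) + e^-1 * (s ^+ 2 * n2 D g).
  have := n2_ge0 D (fun x => e * f x + s * g x).
  rewrite n2D//; [|exact: sqiZ|exact: sqiZ]; rewrite !n2Z// => H.
  have E : \int[mu]_(x in D) (e * f x * (s * g x)) = e * (s * \int[mu]_(x in D) (f x * g x)).
    rewrite mulrA -RintegralZl//.
    by apply: Rint_eq => x _; ring.
  rewrite E in H; move: H; set I := Rintegral _ _ _ => H.
  have := mulr_ge0 (ltW (_ : 0 < e^-1)) H; rewrite invr_gt0 => /(_ e0).
  congr (_ <= _); field.
  exact: e0'.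
rewrite ler_norml; apply/andP; split.
  by have := H 1; rewrite expr1n !mul1r; lra.
by have := H (-1); rewrite sqrrN expr1n mul1r mulN1r; lra.
Qed.

Lemma n2D_le D f g : measurable D -> sqi D f -> sqi D g ->
  n2 D (fun x => f x + g x) <= 2 * n2 D f + 2 * n2 D g.
Proof.
move=> mD sf sg; rewrite n2D//.
have := n2_dot mD ltr01 sf sg; rewrite invr1 !mul1r ler_norml => /andP[_].
lra.
Qed.

Lemma n2N D f : n2 D (fun x => - f x) = n2 D f.
Proof. by apply: Rint_eq => x _; rewrite sqrrN. Qed.

Lemma n2B_le D f g : measurable D -> sqi D f -> sqi D g ->
  n2 D (fun x => f x - g x) <= 2 * n2 D f + 2 * n2 D g.
Proof. by move=> mD sf sg; have := n2D_le mD sf (sqiN mD sg); rewrite n2N. Qed.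

Lemma n2_eq0 D f : measurable D -> sqi D f -> n2 D f = 0 ->
  {ae mu, forall x, D x -> f x = 0}.
Proof.
move=> mD [mf fi] f0.
have E : (\int[mu]_(x in D) `|(f x ^+ 2)%:E| = 0)%E.
  rewrite -[RHS](congr1 EFin f0) -[RHS]itgE//.
  by apply: eq_integral => x _; rewrite abse_EFin ger0_norm ?sqr_ge0.
have mf2 : measurable_fun D (fun x => (f x ^+ 2)%:E).
  by apply/measurable_EFinP; exact: meas_sqr.
have H := (@ae_eq_integral_abs _ _ _ mu D mD (fun x => (f x ^+ 2)%:E) mf2).1 E.
apply: ae_imp H => x /= Hx Dx; have := Hx Dx => -[] /eqP.
by rewrite sqrf_eq0 => /eqP.
Qed.

Lemma n2S D E f : measurable D -> measurable E -> D `<=` E -> sqi E f -> n2 D f <= n2 E f.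
Proof.
move=> mD mE DE sf; have sD := sqiS mD mE DE sf.
rewrite -lee_fin /n2 -!itgE//; [|by case: sf|by case: sD].
apply: ge0_subset_integral => //.
- by apply/measurable_EFinP; apply: meas_sqr; case: sf.
- by move=> x _; rewrite lee_fin sqr_ge0.
Qed.

Lemma itg_oc_cc a b f : a <= b -> itg `]a, b] f -> itg `[a, b] f.
Proof.
move=> ab /itgP[mf fi].
have E : [set a] `|` `]a, b]%classic = `[a, b]%classic by exact: setU1itv.
have m : measurable_fun (`[a, b]%classic : set R) f.
  rewrite -E; apply/measurable_funU => //; split=> //.
  exact: measurable_fun_set1.
apply: itg_lty => //; rewrite -integral_itv_obnd_cbnd//.
by apply/measurable_EFinP; exact: measurableT_comp.
Qed.

Lemma sqi_half_itv w b : sqi halfline w -> sqi `[0, b] w.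
Proof.
move=> sw; have [b0|b0] := leP 0 b.
  have [mw iw] : sqi `]0, b] w.
    apply: sqiS sw => //; first exact: halfline_meas.
    by move=> x; rewrite halflineE /= in_itv/=; lra.
  have i2 := itg_oc_cc b0 iw.
  split=> //; have E : [set 0] `|` `]0, b]%classic = (`[0, b]%classic : set R) by exact: setU1itv.
  rewrite -E; apply/measurable_funU => //; split=> //.
  exact: measurable_fun_set1.
rewrite set_itv_ge ?bnd_simp -?ltNge//.
apply: sqiS sw => //; exact: halfline_meas.
Qed.

Lemma sqi_locitg0 w : sqi halfline w -> locitg0 w.
Proof. by move=> sw b; apply: sqi_itv; exact: sqi_half_itv. Qed.

End SquareIntegrable.

(** * Weak derivatives of real functions *)

Section WeakDerivative.
Context {R : realType}.
Local Notation mu := (@lebesgue_measure R).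
Implicit Types (D E : set R) (f g u v w phi psi F : R -> R) (a b c x : R) (k : nat).

(** The real-valued [is_wderiv]; a complex weak derivative amounts to two of these, one for each
    part. *)
Definition rwd k u w : Prop :=
  [/\ locally_integrable halfline u, locally_integrable halfline w &
    forall phi, test_function phi ->
      \int[mu]_(x in halfline) (u x * derive1n k phi x) =
      (-1) ^+ k * \int[mu]_(x in halfline) (w x * phi x)].

Lemma test_deriven k phi : test_function phi -> test_function (derive1n k phi).
Proof.
elim: k => [|k IH] tphi; first by rewrite derive1n0.
by rewrite derive1nS; apply: test_derive; exact: IH.
Qed.

Lemma locint_meas u : locally_integrable halfline u -> measurable_fun halfline u.
Proof. by case. Qed.

Lemma locint_eq u u' : locally_integrable halfline u -> measurable_fun halfline u' ->
  {ae mu, forall x, halfline x -> u x = u' x} -> locally_integrable halfline u'.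
Proof.
move=> lu mu' uu'; apply: locintP => // a b a0 ab.
have lab : `[a, b] `<=` (@halfline R) := sub_halfline a0.
apply: itg_ae (locint_itg b a0 lu) => //; first exact: measurable_funS halfline_meas lab mu'.
by apply: ae_imp uu' => x H /lab; exact: H.
Qed.

Lemma locintZ u c : locally_integrable halfline u ->
  locally_integrable halfline (fun x => c * u x).
Proof.
move=> lu; apply: locintP; first by apply: measurable_funM => //; exact: locint_meas.
by move=> a b a0 ab; apply: itgZ => //; exact: locint_itg.
Qed.

Lemma Rint_test_ae u u' phi : locally_integrable halfline u ->
  locally_integrable halfline u' -> test_function phi ->
  {ae mu, forall x, halfline x -> u x = u' x} ->
  \int[mu]_(x in halfline) (u x * phi x) = \int[mu]_(x in halfline) (u' x * phi x).
Proof.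
move=> lu lu' tphi uu'; apply: Rint_ae.
- exact: halfline_meas.
- exact: itg_meas (itg_test lu tphi).
- exact: itg_meas (itg_test lu' tphi).
- by apply: ae_imp uu' => x H /H ->.
Qed.

Lemma rwd_ae k u w u' w' : rwd k u w ->
  measurable_fun halfline u' -> measurable_fun halfline w' ->
  {ae mu, forall x, halfline x -> u x = u' x} ->
  {ae mu, forall x, halfline x -> w x = w' x} -> rwd k u' w'.
Proof.
move=> [lu lw H] mu' mw' uu' ww'.
have lu' := locint_eq lu mu' uu'; have lw' := locint_eq lw mw' ww'.
split=> // phi tphi.
rewrite -(Rint_test_ae lu lu' (test_deriven k tphi) uu') H//.
by rewrite (Rint_test_ae lw lw' tphi ww').
Qed.

Lemma rwd_uniq k u w w' : rwd k u w -> rwd k u w' ->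
  {ae mu, forall x, halfline x -> w x = w' x}.
Proof.
move=> [lu lw H] [_ lw' H'].
suff : {ae mu, forall x, halfline x -> w x - w' x = 0}.
  by apply: ae_imp => x E /E /eqP; rewrite subr_eq0 => /eqP.
apply: locint_test0; first exact: (locally_integrableB lw lw').
move=> phi tphi.
have -> : \int[mu]_(x in halfline) ((w x - w' x) * phi x) =
    \int[mu]_(x in halfline) (w x * phi x) - \int[mu]_(x in halfline) (w' x * phi x).
  rewrite -RintegralB//; [|exact: halfline_meas|exact: itg_test|exact: itg_test].
  by apply: Rint_eq => x _; ring.
have := H _ tphi; rewrite H'// => /(congr1 (fun z => (-1) ^+ k * z)).
by rewrite !mulrA -exprD addnn -mul2n exprM sqrrN !expr1n !mul1r => ->; rewrite subrr.
Qed.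

Lemma rwd_lin k u w u' w' c : rwd k u w -> rwd k u' w' ->
  rwd k (fun x => u x + c * u' x) (fun x => w x + c * w' x).
Proof.
move=> [lu lw H] [lu' lw' H']; split.
- exact: (locally_integrableD lu (locintZ c lu')).
- exact: (locally_integrableD lw (locintZ c lw')).
have L f g phi : locally_integrable halfline f -> locally_integrable halfline g ->
    test_function phi -> \int[mu]_(x in halfline) ((f x + c * g x) * phi x) =
    \int[mu]_(x in halfline) (f x * phi x) + c * \int[mu]_(x in halfline) (g x * phi x).
  have mh := @halfline_meas R.
  move=> lf lg tphi; rewrite -RintegralZl//; last exact: itg_test.
  rewrite -RintegralD//; [|exact: itg_test|by apply: itgZ => //; exact: itg_test].
  by apply: Rint_eq => x _; ring.
move=> phi tphi; rewrite !L//; last exact: test_deriven.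
by rewrite H// H'//; ring.
Qed.

Lemma rwd_prim F w : locitg0 w -> prim F w -> rwd 1 F w.
Proof.
move=> iw FE; split; [exact: prim_locint iw FE|exact: locitg0_locint|].
by move=> phi tphi; rewrite derive1n1 expr1 mulN1r; exact: prim_ibp iw FE tphi.
Qed.

Lemma prim_int w c : prim (fun x => c + \int[mu]_(t in `[0, x]) w t) w.
Proof. by move=> x x0; rewrite set_itv1 Rintegral_set1 addr0. Qed.

Lemma primD F w G v c : locitg0 w -> locitg0 v -> prim F w -> prim G v ->
  prim (fun x => F x + c * G x) (fun x => w x + c * v x).
Proof.
move=> iw iv FE GE x x0; rewrite RintegralD//; [|exact: iw|by apply: itgZ => //; exact: iv].
by rewrite RintegralZl//; [|exact: iv]; rewrite (FE x)// (GE x)//; ring.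
Qed.

(** The difference between u and any primitive of w has zero weak derivative, hence is a constant,
    which is then added to the primitive. *)
Lemma rwd_prim_ex u w : locitg0 w -> rwd 1 u w ->
  exists F, prim F w /\ {ae mu, forall x, halfline x -> u x = F x}.
Proof.
move=> iw uw; pose G x := 0 + \int[mu]_(t in `[0, x]) w t.
have GE : prim G w := prim_int w 0.
have [lv _ vw] := rwd_lin (-1) uw (rwd_prim iw GE).
have [|c uG] := locint_derive0 lv.
  move=> phi tphi; have := vw phi tphi; rewrite derive1n1 expr1 => ->.
  rewrite (_ : Rintegral _ _ _ = \int[mu]_(x in halfline) 0); last first.
    by apply: Rint_eq => x _; ring.
  by rewrite Rintegral_cst ?mul0r ?mulr0//; exact: halfline_meas.
exists (fun x => c + \int[mu]_(t in `[0, x]) w t); split; first exact: prim_int.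
by apply: ae_imp uG => x H /H <-; rewrite /G; ring.
Qed.

(** The derivative of a test function is one too, so the relation between u and v may be tested
    against it. *)
Lemma rwd2_1 u v w : rwd 1 u v -> rwd 2 u w -> rwd 1 v w.
Proof.
move=> [lu lv H1] [_ lw H2]; split=> // phi tphi.
have := H1 _ (test_derive tphi); rewrite derive1n1 expr1 mulN1r => E.
have := H2 _ tphi; rewrite derive1Sn derive1n1 E derive1n1 sqrrN expr1n mul1r => <-.
by rewrite mulN1r opprK.
Qed.

Lemma rwd1_2 u v w : rwd 1 u v -> rwd 1 v w -> rwd 2 u w.
Proof.
move=> [lu lv H1] [_ lw H2]; split=> // phi tphi.
have := H1 _ (test_derive tphi); rewrite derive1n1 expr1 mulN1r => E.
have := H2 _ tphi; rewrite derive1n1 expr1 mulN1r => E2.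
by rewrite derive1Sn derive1n1 E E2 opprK sqrrN expr1n mul1r.
Qed.

End WeakDerivative.

(** * Translations in L^2 *)

Section Translation.
Context {R : realType}.
Local Notation mu := (@lebesgue_measure R).
Implicit Types (D E : set R) (f g u v w : R -> R) (a b c x h : R).

Lemma measurable_shift h : measurable_fun setT (fun x : measurableTypeR R => (x + h : measurableTypeR R)).
Proof. by apply: measurable_funD. Qed.

Lemma lebesgue_measure_shift h (A : set R) : measurable A ->
  pushforward mu (fun x : R => x + h : measurableTypeR R) A = mu A.
Proof.
move=> mA; apply/esym/(lebesgue_measure_unique (mu := pushforward mu (fun x : R => x + h : measurableTypeR R))) => //=.
  exact: measurable_shift.
move=> mf _ [[a b]] _ <-.
rewrite /pushforward (_ : _ @^-1` _ = `]a - h, b - h]%classic).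
  rewrite !lebesgue_measure_itv/= !lte_fin ltrD2r; case: ifP => // _.
  by congr EFin; ring.
by apply/seteqP; split=> x /=; rewrite !in_itv/=; lra.
Qed.

(** Besides translations this has to cover reflections, which turn boundary data in time into an
    outgoing profile in space. *)
Definition mpres (phi : R -> R) : Prop :=
  measurable_fun setT (phi : measurableTypeR R -> measurableTypeR R) /\
  forall A : set R, measurable A -> pushforward mu (phi : _ -> measurableTypeR R) A = mu A.

Lemma mpres_shift h : mpres (fun x => x + h).
Proof. by split; [exact: measurable_shift|exact: lebesgue_measure_shift]. Qed.

Lemma mpres_opp : mpres (fun x => - x).
Proof.
split; last by move=> A mA; exact: (lebesgue_measureN mA).
exact: measurable_funN.
Qed.

Lemma mpres_comp phi psi : mpres phi -> mpres psi -> mpres (fun x => phi (psi x)).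
Proof.
move=> [m1 H1] [m2 H2]; split; first exact: (measurableT_comp m1 m2).
move=> A mA; rewrite -(H1 A mA) -[RHS](H2 (phi @^-1` A))//.
by rewrite -[_ @^-1` _]setTI; exact: m1.
Qed.

Lemma mpres_sub h : mpres (fun x => h - x).
Proof.
have := mpres_comp (mpres_shift h) mpres_opp.
by congr mpres; apply/funext => x; rewrite addrC.
Qed.

Lemma ge0_integral_mpres phi D (f : R -> \bar R) : mpres phi -> measurable D ->
  measurable_fun setT f -> (forall x, (0 <= f x)%E) ->
  (\int[mu]_(x in [set x | D (phi x)]) f (phi x) = \int[mu]_(x in D) f x)%E.
Proof.
move=> [mphi Hphi] mD mf f0.
rewrite -(@ge0_integral_pushforward _ _ _ _ _ _ mphi mu D f)//.
  by apply: eq_measure_integral => A mA _; exact: Hphi.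
exact: measurable_funTS.
Qed.

Lemma meas_mpres phi f : mpres phi -> measurable_fun setT f ->
  measurable_fun setT (fun x => f (phi x)).
Proof. by move=> [mphi _] mf; exact: (measurableT_comp (f := f) (g := phi) mf mphi). Qed.

Lemma meas_shift f h : measurable_fun setT f -> measurable_fun setT (fun x => f (x + h)).
Proof. exact: meas_mpres (mpres_shift h). Qed.

Lemma itg_mpres phi D f : mpres phi -> measurable D ->
  measurable_fun setT f -> itg D f -> itg [set x | D (phi x)] (fun x => f (phi x)).
Proof.
move=> mp mD mf /itgP[_ fi]; apply: itg_lty.
  by apply: measurable_funTS; exact: meas_mpres.
rewrite (@ge0_integral_mpres _ _ (fun x => (`|f x|)%:E))//.
by apply/measurable_EFinP; exact: measurableT_comp.
Qed.

Lemma Rint_mpres_ge0 phi D f : mpres phi -> measurable D -> measurable_fun setT f ->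
  (forall x, 0 <= f x) ->
  \int[mu]_(x in [set x | D (phi x)]) f (phi x) = \int[mu]_(x in D) f x.
Proof.
move=> mp mD mf f0; congr fine.
rewrite (@ge0_integral_mpres _ _ (fun x => (f x)%:E))//.
exact/measurable_EFinP.
Qed.

Lemma Rint_mpres phi D f : mpres phi -> measurable D ->
  measurable_fun setT f -> itg D f ->
  \int[mu]_(x in [set x | D (phi x)]) f (phi x) = \int[mu]_(x in D) f x.
Proof.
move=> mp mD mf fi; have ip := itg_mpres mp mD mf fi; have [mphi Hphi] := mp.
have mE : measurable_fun setT (EFin \o f) by exact/measurable_EFinP.
congr fine; rewrite -(integral_pushforward mphi mE ip mD).
by apply: eq_measure_integral => A mA _; exact: Hphi.
Qed.

Lemma itg_shift D f h : measurable D -> measurable_fun setT f -> itg D f ->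
  itg [set x | D (x + h)] (fun x => f (x + h)).
Proof. exact: itg_mpres (mpres_shift h). Qed.

Lemma Rint_shift_ge0 D f h : measurable D -> measurable_fun setT f -> (forall x, 0 <= f x) ->
  \int[mu]_(x in [set x | D (x + h)]) f (x + h) = \int[mu]_(x in D) f x.
Proof. exact: Rint_mpres_ge0 (mpres_shift h). Qed.

Lemma Rint_shift D f h : measurable D -> measurable_fun setT f -> itg D f ->
  \int[mu]_(x in [set x | D (x + h)]) f (x + h) = \int[mu]_(x in D) f x.
Proof. exact: Rint_mpres (mpres_shift h). Qed.

Definition L1_shift f := forall e, 0 < e -> exists2 d, 0 < d &
  forall h, `|h| < d -> \int[mu]_x `|f (x + h) - f x| <= e.

Lemma setT_shift h : [set x : R | [set: R] (x + h)] = setT.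
Proof. by apply/seteqP; split. Qed.

Lemma itgT_shift f h : itg setT f -> itg setT (fun x => f (x + h)).
Proof.
move=> fi; rewrite -(setT_shift h); apply: itg_shift => //.
exact: itg_meas.
Qed.

Lemma RintT_shift f h : itg setT f -> \int[mu]_x f (x + h) = \int[mu]_x f x.
Proof.
move=> fi; rewrite -{1}(setT_shift h); apply: Rint_shift => //.
exact: itg_meas.
Qed.

Lemma Rint_le D f g : measurable D -> itg D f -> itg D g -> (forall x, D x -> f x <= g x) ->
  \int[mu]_(x in D) f x <= \int[mu]_(x in D) g x.
Proof. by move=> mD fi gi fg; exact: (le_Rintegral _ fi gi). Qed.

Lemma RintD D f g : measurable D -> itg D f -> itg D g ->
  \int[mu]_(x in D) (f x + g x) = \int[mu]_(x in D) f x + \int[mu]_(x in D) g x.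
Proof. by move=> mD fi gi; exact: (RintegralD _ fi gi). Qed.

(** Translations are isometries of L^1, so continuity of translations passes to L^1 limits by a
    three-term estimate. *)
Lemma L1_shift_closure f : itg setT f ->
  (forall e, 0 < e -> exists g, [/\ itg setT g, L1_shift g & \int[mu]_x `|f x - g x| <= e]) ->
  L1_shift f.
Proof.
move=> fi H e e0; have e3 : 0 < e / 3 by rewrite divr_gt0.
have [g [gi gS fg]] := H _ e3; have [d d0 gd] := gS _ e3.
exists d => // h hd.
have mT : measurable (setT : set R) by [].
have ifg : itg setT (fun x => `|f x - g x|) by apply: itg_abs; exact: itgB.
have ifgh := itgT_shift h ifg.
have igg : itg setT (fun x => `|g (x + h) - g x|).
  by apply: itg_abs; apply: itgB => //; exact: itgT_shift.
apply: (@le_trans _ _ (\int[mu]_x (`|f (x + h) - g (x + h)| + (`|g (x + h) - g x| + `|f x - g x|)))).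
  apply: Rint_le => //.
  - by apply: itg_abs; apply: itgB => //; exact: itgT_shift.
  - by apply: itgD => //; exact: itgD.
  - move=> x _; rewrite (_ : f (x + h) - f x = f (x + h) - g (x + h) + (g (x + h) - g x - (f x - g x))); last by ring.
    by rewrite (le_trans (ler_normD _ _))// lerD2l ler_normB.
rewrite RintD//; last exact: itgD.
rewrite RintD// (RintT_shift h ifg).
by have := gd h hd; lra.
Qed.

(** A failure of continuity produces steps smaller than 1/(n+1) in absolute value. Keeping the steps
    below 1 puts all translates under one dominating function. *)
Lemma L1_shift_seq f : itg setT f ->
  (forall hn : nat -> R, hn n @[n --> \oo] --> 0 -> (forall n, `|hn n| < 1) ->
    (\int[mu]_x (`|f (x + hn n) - f x|)%:E)%E @[n --> \oo] --> 0%E) ->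
  L1_shift f.
Proof.
move=> fi H e e0; apply: contrapT => nd.
have K (n : nat) : exists h, `|h| < n.+1%:R^-1 /\ e < \int[mu]_x `|f (x + h) - f x|.
  apply: contrapT => nh; apply: nd; exists n.+1%:R^-1; first by rewrite invr_gt0.
  move=> h hn; rewrite leNgt; apply/negP => eh; apply: nh.
  by exists h.
have [hn hnP] := choice K.
have c0 : hn n @[n --> \oo] --> 0.
  apply/cvgr0Pnorm_lt => r r0.
  have := @cvg_harmonic R => /cvgr0Pnorm_lt/(_ _ r0).
  apply: filterS => n /=; apply: le_lt_trans.
  have [/ltW + _] := hnP n; move=> /le_trans; apply.
  by rewrite ger0_norm// invr_ge0.
have h1 n : `|hn n| < 1.
  by have [/lt_le_trans + _] := hnP n; apply; rewrite invf_le1// ler1n.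
have := H hn c0 h1; move/fine_cvgP => [_ /cvgr0Pnorm_lt/(_ _ e0)] [n _ /(_ n (leqnn n))].
have [_ A] := hnP n; move=> /= B.
by have := lt_le_trans A (le_trans (ler_norm _) (ltW B)); rewrite ltxx.
Qed.

Definition trunc (n : R) f x := if (- n <= x <= n) then f x else 0.

Lemma itg_trunc n f : itg `[- n, n] f -> itg setT (trunc n f).
Proof.
move=> fi; apply: (@itg_ext _ `[- n, n] setT) => //.
  by move=> x _ xn; rewrite /trunc ifF//; apply/negP => H; apply: xn; rewrite /= in_itv.
by apply: itg_eq fi => // x; rewrite /= in_itv/= /trunc => ->.
Qed.

(** The truncation is continuous except at n and -n, so its translates converge almost everywhere;
    for steps below 1 the differences are dominated by 2K on [-n-1, n+1] and vanish elsewhere. *)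
Lemma L1_shift_trunc n g : 0 < n -> continuous g -> L1_shift (trunc n g).
Proof.
move=> n0 cg.
have ig : itg `[- n, n] g by apply: itg_cont; exact: continuous_subspaceT.
have iG := itg_trunc ig.
have nn : - n <= n by lra.
have cng : {within `[- n, n], continuous (fun x => `|g x|)}.
  apply: continuous_subspaceT => x; apply: continuous_comp; first exact: cg.
  exact: norm_continuous.
have [c _ Mc] := EVT_max nn cng.
pose K := `|g c|; have K0 : 0 <= K by exact: normr_ge0.
have GK x : `|trunc n g x| <= K.
  by rewrite /trunc; case: ifPn => xn; [apply: Mc; rewrite in_itv|rewrite normr0].
apply: (L1_shift_seq iG) => hn hn0 hn1.
pose dom x := (trunc (n + 1) (fun=> 2 * K) x)%:E.
have idom : mu.-integrable setT dom.
  by apply: itg_trunc; exact: itg_cst.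
have mf k : measurable_fun setT (fun x => (`|trunc n g (x + hn k) - trunc n g x|)%:E).
  apply/measurable_EFinP; apply: measurableT_comp => //.
  by apply: measurable_funB; [apply: meas_shift|]; exact: itg_meas iG.
have [||_ _] := @dominated_convergence _ _ _ mu setT measurableT _ (cst 0%E) dom mf (measurable_cst _) _ idom.
- apply: (@ae_imp _ (fun x => x != n /\ x != - n)).
    move=> x [xn xNn] _; apply: cvg_EFin; first by near=> k.
    rewrite -[X in _ --> X](@normr0 _ R); apply: cvg_norm.
    rewrite -[X in _ --> X](subrr (trunc n g x)); apply: cvgB; last exact: cvg_cst.
    have xh : x + hn k @[k --> \oo] --> x.
      by rewrite -[X in _ --> X]addr0; apply: cvgD => //; exact: cvg_cst.
    have [xin|xout] := boolP (- n <= x <= n).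
      have xin' : - n < x < n.
        have /andP[A B] := xin.
        by rewrite !lt_neqAle A B xn eq_sym xNn.
      have E : \forall k \near \oo, g (x + hn k) = trunc n g (x + hn k).
        have /andP[lo hi] := xin'.
        have H1 := cvgr_gt _ xh _ lo; have H2 := cvgr_lt _ xh _ hi.
        near=> k; rewrite /trunc ifT//; apply/andP; split; apply/ltW; near: k; [exact: H1|exact: H2].
      rewrite {2}/trunc xin.
      apply: cvg_trans (cvg_comp _ _ xh (cg x)); exact: near_eq_cvg.
    have E : \forall k \near \oo, 0 = trunc n g (x + hn k).
      move: (xout); rewrite negb_and -!ltNge => /orP[lo|hi].
        have H1 := cvgr_lt _ xh _ lo.
        near=> k; rewrite /trunc ifF//; apply/negbTE; rewrite negb_and -!ltNge.
        by apply/orP; left; near: k; exact: H1.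
      have H1 := cvgr_gt _ xh _ hi.
      near=> k; rewrite /trunc ifF//; apply/negbTE; rewrite negb_and -!ltNge.
      by apply/orP; right; near: k; exact: H1.
    rewrite {2}/trunc (negbTE xout).
    apply: cvg_trans (@cvg_cst _ (0 : R) _ \oo _); exact: near_eq_cvg.
  have P a : {ae mu, forall x : R, x != a}.
    exists [set a]; split=> //; first exact: lebesgue_measure_set1.
    by move=> x /= /negP; rewrite negbK => /eqP.
  exact: ae_and (P n) (P (- n)).
- apply: ae_all => x k _; rewrite /= lee_fin normr_id.
  rewrite {3}/trunc; case: ifPn => xn1.
    by rewrite (le_trans (ler_normB _ _))//; have := GK (x + hn k); have := GK x; lra.
  have := hn1 k; rewrite ltr_norml => /andP[A B].
  rewrite /trunc !ifF ?subrr ?normr0//; apply/negP => H.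
    by move/negP: xn1; apply; lra.
  by move/negP: xn1; apply; lra.
rewrite integral0; apply: cvg_trans; apply: near_eq_cvg; near=> k.
by [].
Unshelve. all: by end_near. Qed.

End Translation.

(** * Continuity of translations in L^1 and L^2 *)

Section L2Translation.
Context {R : realType}.
Local Notation mu := (@lebesgue_measure R).
Implicit Types (D E : set R) (f g u v w F : R -> R) (a b c x h e : R).

Lemma trunc_approx f e : itg setT f -> 0 < e ->
  exists2 n : R, 0 < n & \int[mu]_x `|f x - trunc n f x| <= e.
Proof.
move=> fi e0; have mf := itg_meas fi.
have it (n : R) : itg setT (trunc n f) by apply: itg_trunc; exact: itgS fi.
have mn (n : nat) : measurable_fun setT (fun x => (trunc n%:R f x)%:E).
  by apply/measurable_EFinP; exact: itg_meas.
have mfE : measurable_fun setT (fun x => (f x)%:E) by exact/measurable_EFinP.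
have [|| _ + _] := @dominated_convergence _ _ _ mu setT measurableT
   (fun n x => (trunc n%:R f x)%:E) (fun x => (f x)%:E) (fun x => (`|f x|)%:E) mn mfE _ (itg_abs fi).
- apply: ae_all => x _; apply: cvg_EFin; first by near=> n.
  apply: cvg_trans (@cvg_cst _ (f x) _ \oo _); apply: near_eq_cvg; near=> n.
  rewrite /= /trunc ifT//; rewrite -ler_norml; near: n; exact: nbhs_infty_ger.
- apply: ae_all => x n _; rewrite /= lee_fin /trunc; case: ifP => // _.
  by rewrite normr0.
move=> /fine_cvgP[_ /cvgr0Pnorm_lt/(_ _ e0)][n _ /(_ n.+1 (leqnSn n))] /= H.
exists n.+1%:R; first by rewrite ltr0n.
rewrite (_ : Rintegral _ _ _ = fine (\int[mu]_x `|(trunc n.+1%:R f x)%:E - (f x)%:E|)%E).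
  by apply: le_trans (ltW H); exact: ler_norm.
by congr fine; apply: eq_integral => x _; rewrite -EFinB abse_EFin distrC.
Unshelve. all: by end_near. Qed.

(** Density: f is truncated, then approximated on [-n, n] by a continuous function, each within
    e/2. *)
Lemma L1_shiftT f : itg setT f -> L1_shift f.
Proof.
move=> fi; apply: L1_shift_closure => // e e0.
have e2 : 0 < e / 2 by rewrite divr_gt0.
have [n n0 fn] := trunc_approx fi e2.
have fin : itg `[- n, n] f by exact: itgS fi.
have [g [cg fg]] := continuous_density_L1 fin e2.
have ign : itg `[- n, n] g by apply: itg_cont; exact: continuous_subspaceT.
exists (trunc n g); split; [exact: itg_trunc|exact: L1_shift_trunc|].
have mT : measurable (setT : set R) by [].
have i1 : itg setT (fun x => `|f x - trunc n f x|).
  by apply: itg_abs; apply: itgB => //; exact: itg_trunc.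
have i2 : itg setT (trunc n (fun x => `|f x - g x|)).
  by apply: itg_trunc; apply: itg_abs; exact: itgB.
apply: (@le_trans _ _ (\int[mu]_x (`|f x - trunc n f x| + trunc n (fun x => `|f x - g x|) x))).
  apply: Rint_le => //.
  - by apply: itg_abs; apply: itgB => //; exact: itg_trunc.
  - exact: itgD.
  - by move=> x _; rewrite /trunc; case: ifPn => _; rewrite ?subrr ?normr0 ?add0r ?addr0.
rewrite RintD//.
have -> : \int[mu]_x (trunc n (fun x => `|f x - g x|) x) = \int[mu]_(x in `[- n, n]) `|f x - g x|.
  rewrite (@Rint_sub _ `[- n, n] setT)//.
    by apply: Rint_eq => x; rewrite /= in_itv/= /trunc => ->.
  by move=> x _ xn; rewrite /trunc ifF//; apply/negP => H; apply: xn; rewrite /= in_itv.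
lra.
Qed.

Lemma sqiT_shift f h : sqi setT f -> sqi setT (fun x => f (x + h)).
Proof.
move=> [mf fi]; split; first exact: meas_shift.
exact: (itgT_shift h fi).
Qed.

Lemma n2T_shift f h : sqi setT f -> n2 setT (fun x => f (x + h)) = n2 setT f.
Proof. by move=> [mf fi]; exact: (RintT_shift h fi). Qed.

Lemma sqr_sub_le a b : (a - b) ^+ 2 <= 2 * `|a * `|a| - b * `|b| |.
Proof.
wlog ba : a b / b <= a.
  move=> H; have [/H//|/ltW/H] := leP b a.
  by rewrite distrC -opprB sqrrN.
suff : (a - b) ^+ 2 <= 2 * (a * `|a| - b * `|b|).
  by move=> /le_trans; apply; rewrite ler_wpM2l// ler_norm.
have ab : 0 <= a - b by lra.
have [a0|a0] := leP 0 a; have [b0|b0] := leP 0 b.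
- rewrite (ger0_norm a0) (ger0_norm b0); have := mulr_ge0 b0 ab; nra.
- rewrite (ger0_norm a0) (ltr0_norm b0); have := sqr_ge0 (a + b); nra.
- lra.
- rewrite (ltr0_norm a0) (ltr0_norm b0).
  have a1 : 0 <= - a by lra.
  by have := mulr_ge0 a1 ab; nra.
Qed.

(* [|a - b|^2 <= 2 | a|a| - b|b| |] reduces the L^2 statement to the L^1 one. *)
Lemma L2_shift f e : sqi setT f -> 0 < e -> exists2 d, 0 < d &
  forall h, `|h| < d -> n2 setT (fun x => f (x + h) - f x) <= e.
Proof.
move=> sf e0; have mT : measurable (setT : set R) by [].
pose g x := f x * `|f x|.
have [mf fi] := sf.
have gi : itg setT g.
  apply: (@itg_le _ _ _ (fun x => f x ^+ 2)) => //.
    by apply: measurable_funM => //; exact: measurableT_comp.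
  by move=> x _; rewrite /g normrM normr_id -expr2 real_normK ?num_real.
have e2 : 0 < e / 2 by rewrite divr_gt0.
have [d d0 H] := L1_shiftT gi e2; exists d => // h hd.
have sfh := sqiB mT (sqiT_shift h sf) sf.
apply: (@le_trans _ _ (\int[mu]_x (2 * `|g (x + h) - g x|))).
  apply: Rint_le => //; first by case: sfh.
    by apply: itgZ => //; apply: itg_abs; apply: itgB => //; exact: itgT_shift.
  by move=> x _; exact: sqr_sub_le.
rewrite RintegralZl//; last by apply: itg_abs; apply: itgB => //; exact: itgT_shift.
by have := H h hd; lra.
Qed.

(** [prim] on the whole line, a form that is stable under translation. *)
Definition gprim F w := forall x y, x <= y -> F y - F x = \int[mu]_(t in `[x, y]) w t.

Lemma sqiT_itv a b w : sqi setT w -> itg `[a, b] w.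
Proof. by move=> sw; apply: sqi_itv; apply: sqiS sw. Qed.

Lemma gprim_continuous F w : sqi setT w -> gprim F w -> continuous F.
Proof.
move=> sw FE x.
have x1 : x - 1 < x + 1 by lra.
have cG := parameterized_integral_continuous (ltW x1) (sqiT_itv (x - 1) (x + 1) sw).
have cF : {within `[x - 1, x + 1], continuous F}.
  refine (@within_eq _ `[x - 1, x + 1]%classic
    (fun y => F (x - 1) + parameterized_integral mu (x - 1) y w) F _ _).
    move=> y; rewrite /= in_itv/= => /andP[y0 _].
    by rewrite /parameterized_integral -FE//; ring.
  by move=> y; apply: cvgD; [exact: cvg_cst|exact: cG].
have /(continuous_within_itvP _ x1)[+ _ _] := cF.
by apply; rewrite in_itv/=; lra.
Qed.

(** Expand the squared norm of g - m on [0, h], which is nonnegative, where m is the mean of g. *)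
Lemma jensen_itv g h : 0 < h -> sqi `[0, h] g ->
  (h^-1 * \int[mu]_(r in `[0, h]) g r) ^+ 2 <= h^-1 * \int[mu]_(r in `[0, h]) (g r) ^+ 2.
Proof.
move=> h0 sg; have mI : measurable (`[0, h]%classic : set R) by exact: measurable_itv.
set m := h^-1 * _.
have sc : sqi `[0, h] (fun=> m) by apply: sqi_cont; apply: continuous_subspaceT => x; exact: cvg_cst.
have := n2_ge0 (`[0, h]%classic : set R) (fun r => g r + (- 1) * m).
rewrite (n2D mI sg); last exact: sqiZ.
rewrite (n2Z _ mI sc) sqrrN expr1n mul1r.
have E1 : n2 `[0, h] (fun=> m) = m ^+ 2 * h.
  rewrite /n2 Rintegral_cst//; congr (_ * _).
  have E : mu (`[0, h]%classic : set R) = h%:E.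
    by rewrite lebesgue_measure_itv/= lte_fin h0 sube0.
  exact: (congr1 fine E).
have ig := sqi_itv sg.
have E2 : \int[mu]_(x in `[0, h]) (g x * (-1 * m)) = - m * (h * m).
  rewrite (_ : Rintegral _ _ _ = \int[mu]_(x in `[0, h]) ((- m) * g x)); last first.
    by apply: Rint_eq => x _; ring.
  rewrite RintegralZl//; congr (_ * _); rewrite /m mulrA mulfV ?mul1r//.
  by rewrite gt_eqF.
rewrite E1 E2 => H.
rewrite mulrC ler_pdivlMr//.
by move: H; rewrite /n2; lra.
Qed.

End L2Translation.

(** * Difference quotients of primitives converge in L^2 *)

Section DifferenceQuotient.
Context {R : realType}.
Local Notation mu := (@lebesgue_measure R).
Local Notation mR := (measurableTypeR R).
Implicit Types (D E : set R) (f g u v w F : R -> R) (a b c x h e : R).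

Lemma meas_diff2 w : measurable_fun setT w ->
  measurable_fun setT (fun z : mR * mR => w (z.1 + z.2) - w z.1 : R).
Proof.
move=> mw; apply: measurable_funB.
  apply: (measurableT_comp (f := w)) => //.
  by apply: measurable_funD; [exact: measurable_fst|exact: measurable_snd].
by apply: (measurableT_comp (f := w)) => //; exact: measurable_fst.
Qed.

Lemma gprim_shift F w h x : sqi setT w -> gprim F w -> 0 < h ->
  F (x + h) - F x = \int[mu]_(r in `[0, h]) w (x + r).
Proof.
move=> sw FE h0; rewrite FE; last by lra.
have E : [set r | `[x, x + h]%classic (r + x)] = `[0, h]%classic :> set R.
  by apply/seteqP; split=> r /=; rewrite !in_itv/=; lra.
rewrite -(@Rint_shift _ `[x, x + h] w x)//.
- by rewrite E; apply: Rint_eq => r _; rewrite addrC.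
- by case: sw.
- exact: sqiT_itv.
Qed.

Lemma sqi_diff w x a b : sqi setT w -> sqi `[a, b] (fun r => w (x + r) - w x).
Proof.
move=> sw; apply: sqiB => //.
  apply: (@sqi_eq _ _ (fun r => w (r + x))) => //; first by move=> r _; rewrite addrC.
  by apply: (@sqiS _ _ setT) => //; exact: sqiT_shift.
by apply: sqi_cont; apply: continuous_subspaceT => y; exact: cvg_cst.
Qed.

(** The error of the difference quotient at x is the mean over r in [0, h] of w(x + r) - w(x), to
    which Jensen's inequality applies. *)
Lemma dq_jensen F w h x : sqi setT w -> gprim F w -> 0 < h ->
  ((F (x + h) - F x) / h - w x) ^+ 2 <=
  h^-1 * \int[mu]_(r in `[0, h]) (w (x + r) - w x) ^+ 2.
Proof.
move=> sw FE h0; have sd := sqi_diff x 0 h sw.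
have := jensen_itv h0 sd; apply: le_trans.
rewrite le_eqVlt; apply/orP; left; apply/eqP; congr (_ ^+ 2).
rewrite RintegralB//; last first.
- exact: itg_cst.
- apply: (@itg_eq _ _ (fun r => w (r + x))) => //; first by move=> r _; rewrite addrC.
  apply: (@itgS _ _ [set r | `[x + 0, x + h]%classic (r + x)]) => //.
  - rewrite (_ : mkset _ = `[0, h]%classic)//.
    by apply/seteqP; split=> r /=; rewrite !in_itv/=; lra.
  - by move=> r /=; rewrite !in_itv/=; lra.
  apply: itg_shift => //.
  - by case: sw.
  - exact: sqiT_itv.
rewrite -(gprim_shift x sw FE h0) Rintegral_cst//.
have E : mu (`[0, h]%classic : set R) = h%:E.
  by rewrite lebesgue_measure_itv/= lte_fin h0 sube0.
rewrite [fine _](congr1 fine E) /=; field.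
by rewrite gt_eqF.
Qed.

Definition dq F w h x := (F (x + h) - F x) / h - w x.

Lemma dq_meas F w h : sqi setT w -> gprim F w -> measurable_fun setT (dq F w h).
Proof.
move=> sw FE; have cF := gprim_continuous sw FE.
apply: measurable_funB; last by case: sw.
apply: measurable_funM => //; apply: measurable_funB; last exact: cont_meas.
by apply: meas_shift; exact: cont_meas.
Qed.

(** Integrating [dq_jensen] in x and exchanging the integrals by Tonelli bounds the squared error by
    the mean over r of the squared norms of w(. + r) - w. The bound is stated in the extended reals
    because integrability is deduced from it. *)
Lemma dq_pos F w h e : sqi setT w -> gprim F w -> 0 < h -> 0 <= e ->
  (forall r, 0 <= r <= h -> n2 setT (fun x => w (x + r) - w x) <= e) ->
  (\int[mu]_x (dq F w h x ^+ 2)%:E <= e%:E)%E.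
Proof.
move=> sw FE h0 e0 He; have [mw iw] := sw.
(* The indicator of [0, h], which lets the inner integral run over the whole line as Tonelli's
   theorem expects. *)
pose k r : R := if (0 <= r <= h) then 1 else 0.
have k0 r : 0 <= k r by rewrite /k; case: ifP.
have mI : measurable (`[0, h]%classic : set R) by exact: measurable_itv.
have mk : measurable_fun setT (k : mR -> R).
  rewrite (_ : k = \1_(`[0, h]%classic : set R)); first exact: measurable_indic.
  apply/funext => x; rewrite /k indicE; case: ifPn => H.
    by rewrite mem_set//= in_itv.
  by rewrite memNset//= in_itv/=; exact/negP.
pose f (z : mR * mR) : \bar R := (h^-1 * (w (z.1 + z.2) - w z.1) ^+ 2 * k z.2)%:E.
have mf : measurable_fun setT f.
  apply/measurable_EFinP; apply: measurable_funM.
    by apply: measurable_funM => //; apply: measurable_funX; exact: meas_diff2.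
  by apply: (measurableT_comp (f := k)) => //; exact: measurable_snd.
have hV : 0 < h^-1 by rewrite invr_gt0.
have f0 z : (0 <= f z)%E.
  by rewrite lee_fin; apply: mulr_ge0 => //; apply: mulr_ge0; [exact: ltW|exact: sqr_ge0].
have kint (g : R -> R) : (\int[mu]_r (g r * k r)%:E = \int[mu]_(r in `[0%R, h]) (g r)%:E)%E.
  rewrite [RHS]integral_mkcond; apply: eq_integral => r _; rewrite patchE /k.
  case: ifPn => H; first by rewrite mem_set ?mulr1//= in_itv.
  by rewrite memNset ?mulr0//= in_itv/=; exact/negP.
apply: (@le_trans _ _ (\int[mu]_x \int[mu]_r f (x, r))%E).
  apply: ge0_le_integral => //.
  - by move=> x _; rewrite lee_fin sqr_ge0.
  - by apply/measurable_EFinP; apply: measurable_funX; exact: dq_meas.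
  - exact: measurable_fun_fubini_tonelli_F.
  - move=> x _; rewrite /f/= kint.
    have := dq_jensen x sw FE h0; have [_ isd] := sqi_diff x 0 h sw.
    rewrite -RintegralZl// -lee_fin => /le_trans; apply.
    by rewrite -itgE//; exact: itgZ.
rewrite (fubini_tonelli f)//.
apply: (@le_trans _ _ (\int[mu]_r (h^-1 * e * k r)%:E)%E); last first.
  rewrite kint itgE//; last exact: itg_cst.
  rewrite lee_fin Rintegral_cst//.
  have E : mu (`[0, h]%classic : set R) = h%:E.
    by rewrite lebesgue_measure_itv/= lte_fin h0 sube0.
  rewrite [fine _](congr1 fine E) /= mulrAC mulVf ?mul1r//.
  by rewrite gt_eqF.
apply: ge0_le_integral => //.
- by move=> r _; exact: integral_ge0.
- exact: measurable_fun_fubini_tonelli_G.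
- by apply/measurable_EFinP; apply: measurable_funM.
move=> r _; rewrite /f/=.
have sd : sqi setT (fun x => w (x + r) - w x).
  by apply: sqiB => //; exact: sqiT_shift.
rewrite (_ : (fun x => _) = (fun x => ((h^-1 * k r) * (w (x + r) - w x) ^+ 2)%:E)); last first.
  by apply/funext => x; congr EFin; ring.
rewrite itgE//; last by apply: itgZ => //; case: sd.
rewrite RintegralZl//; last by case: sd.
rewrite lee_fin mulrAC; rewrite -!mulrA ler_wpM2l ?(ltW hV)// /k.
case: ifPn => H; last by rewrite !mulr0.
by rewrite !mulr1; exact: He.
Qed.

Lemma dq_sqi F w h : sqi setT w -> gprim F w -> 0 < h -> sqi setT (dq F w h).
Proof.
move=> sw FE h0; split; first exact: dq_meas.
apply: itg_lty; first by apply: measurable_funX; exact: dq_meas.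
have H r : 0 <= r <= h -> n2 setT (fun x => w (x + r) - w x) <= 4 * n2 setT w.
  move=> _; have := @n2B_le _ setT _ _ measurableT (sqiT_shift r sw) sw.
  by rewrite n2T_shift//; lra.
have := dq_pos sw FE h0 _ H; rewrite mulr_ge0// ?n2_ge0// => /(_ isT) H2.
apply: le_lt_trans (le_trans _ H2) (ltry _); rewrite le_eqVlt; apply/orP; left; apply/eqP.
by apply: eq_integral => x _; rewrite ger0_norm ?sqr_ge0.
Qed.

Lemma dq_pos_n2 F w h e : sqi setT w -> gprim F w -> 0 < h -> 0 <= e ->
  (forall r, 0 <= r <= h -> n2 setT (fun x => w (x + r) - w x) <= e) ->
  n2 setT (dq F w h) <= e.
Proof.
move=> sw FE h0 e0 He; rewrite -lee_fin /n2 -itgE//; first exact: dq_pos.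
by case: (dq_sqi sw FE h0).
Qed.

(** Negative steps reduce to positive ones: going back by h from x is going forward by h from x - h,
    up to a translation difference of w. *)
Lemma dqN F w h x : h != 0 ->
  dq F w (- h) x = dq F w h (x - h) - (w (x - h + h) - w (x - h)).
Proof. by move=> h0; rewrite /dq subrK; field. Qed.

Lemma dq_cvg F w e : sqi setT w -> gprim F w -> 0 < e -> exists2 d, 0 < d &
  forall h, h != 0 -> `|h| < d -> sqi setT (dq F w h) /\ n2 setT (dq F w h) <= e.
Proof.
(* For negative steps two errors are added, each doubled by [n2B_le]; hence the fourth of e. *)
move=> sw FE e0; have e4 : 0 < e / 4 by rewrite divr_gt0.
have [d d0 H] := L2_shift sw e4; exists d => // h h0 hd.
have P h' : 0 < h' -> h' < d -> sqi setT (dq F w h') /\ n2 setT (dq F w h') <= e / 4.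
  move=> h'0 h'd; split; first exact: dq_sqi.
  apply: dq_pos_n2 => //; first exact: ltW.
  by move=> r /andP[r0 rh]; apply: H; rewrite ger0_norm//; lra.
have [hn|hp|/eqP] := ltgtP h 0; last by rewrite (negbTE h0).
  have [||s1 s2] := P (- h); first by rewrite oppr_gt0.
    by rewrite -(ltr0_norm hn).
  have Nh0 : - h != 0 by rewrite oppr_eq0.
  have E x : dq F w h x = dq F w (- h) (x + h) - (w ((x + h) + - h) - w (x + h)).
    by have := dqN F w x Nh0; rewrite opprK.
  have sw2 : sqi setT (fun x => w (x + - h) - w x).
    by apply: sqiB => //; exact: sqiT_shift.
  have sA := sqiT_shift h s1; have sB := sqiT_shift h sw2.
  split; first by apply: sqi_eq (sqiB _ sA sB) => // x _; rewrite E.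
  rewrite (n2_eq (fun x _ => E x)).
  have := n2B_le measurableT sA sB; rewrite (n2T_shift h s1).
  rewrite (n2T_shift h sw2).
  have := H (- h); rewrite normrN => /(_ hd); lra.
have hd2 : h < d by exact: ltr_normlW hd.
by have [s1 s2] := P h hp hd2; split=> //; lra.
Qed.

Lemma dq_sqi_neq0 F w h : sqi setT w -> gprim F w -> h != 0 -> sqi setT (dq F w h).
Proof.
move=> sw FE h0.
have [hn|hp|/eqP] := ltgtP h 0; last by rewrite (negbTE h0).
  have Nh : 0 < - h by rewrite oppr_gt0.
  have Nh0 : - h != 0 by rewrite oppr_eq0.
  have s1 := dq_sqi sw FE Nh.
  have sw2 : sqi setT (fun x => w (x + - h) - w x) := sqiB measurableT (sqiT_shift _ sw) sw.
  apply: sqi_eq (sqiB measurableT (sqiT_shift h s1) (sqiT_shift h sw2)) => // x _.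
  by have := dqN F w x Nh0; rewrite opprK => ->.
exact: dq_sqi.
Qed.

(* [F(. + a) = F + a (w + dq)], a sum of square-integrable functions. *)
Lemma shift_half_sqi F w a : sqi setT w -> gprim F w -> sqi halfline F ->
  sqi halfline (fun x => F (x + a)).
Proof.
move=> sw FE sF; have mh := @halfline_meas R.
have [->|a0] := eqVneq a 0; first by apply: sqi_eq sF => // x _; rewrite addr0.
have ST (G : R -> R) : sqi setT G -> sqi halfline G by apply: sqiS.
have sD := sqiD mh (ST _ sw) (ST _ (dq_sqi_neq0 sw FE a0)).
apply: sqi_eq (sqiD mh sF (sqiZ a mh sD)) => // x _.
by rewrite /dq; field.
Qed.

End DifferenceQuotient.

(** * Transport and the energy method *)

Section HalfLineExtension.
Context {R : realType}.
Local Notation mu := (@lebesgue_measure R).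
Implicit Types (D E : set R) (f g u v w F : R -> R) (a b c x h e t : R).

(** Extending the derivative by 0 and, in [extc], the primitive by its value at 0 keeps one the
    primitive of the other on the whole line. The extended primitive is in general not square
    integrable there, only on the half-line. *)
Definition ext0 w x := if 0 < x then w x else 0.
Definition extc F x := F (Num.max x 0).

Lemma ext0_sqi w : sqi halfline w -> sqi setT (ext0 w).
Proof.
move=> [mw iw]; have mh := @halfline_meas R.
have E : ext0 w = w \_ halfline.
  apply/funext => x; rewrite patchE /ext0; case: ifPn => x0.
    by rewrite mem_set// halflineE.
  by rewrite memNset// halflineE; exact/negP.
split; first by rewrite E; exact/(measurable_restrictT _ _).1.
apply: (itg_ext mh) => //.
  by move=> x _; rewrite halflineE /ext0 => /negP/negbTE ->; rewrite expr0n.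
by apply: itg_eq iw => // x; rewrite halflineE /ext0 => ->.
Qed.

Lemma Rint_oc a b f : itg `[a, b] f -> \int[mu]_(x in `]a, b]) f x = \int[mu]_(x in `[a, b]) f x.
Proof.
move=> fi; apply: Rintegral_itv_obnd_cbnd; apply: itgS fi => //.
by move=> x /=; rewrite !in_itv/= => /andP[/ltW -> ->].
Qed.

Lemma ext_gprim F w : sqi halfline w -> prim F w -> gprim (extc F) (ext0 w).
Proof.
move=> sw FE x y xy; have iw := sqi_locitg0 sw.
pose mx := Num.max x 0; pose my := Num.max y 0.
have x0 : 0 <= mx by rewrite /mx le_max lexx orbT.
have mxy : mx <= my by rewrite /mx /my ge_max !le_max xy lexx !orbT.
rewrite (prim_sub iw FE x0 mxy).
have [y0|y0] := leP y 0.
  have -> : mx = 0 by apply/max_idPr; exact: le_trans y0.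
  have -> : my = 0 by exact/max_idPr.
  rewrite set_itv1 Rintegral_set1 (@Rint_sub _ set0)// ?Rintegral_set0//.
  move=> z; rewrite /= in_itv/= => /andP[_ zy] _; rewrite /ext0 ifF//.
  by apply/negbTE; rewrite -leNgt; exact: le_trans y0.
have myE : my = y by apply/max_idPl; exact: ltW.
have iext a' b' := sqiT_itv a' b' (ext0_sqi sw).
rewrite -Rint_oc; last exact: itg_sub_itv x0 (lexx my) (iw my).
rewrite [RHS](@Rint_sub _ `[mx, my] `[x, y])//.
- rewrite -[RHS]Rint_oc//.
  apply: Rint_eq => z; rewrite /= in_itv/= => /andP[mz _].
  by rewrite /ext0 (le_lt_trans x0 mz).
- move=> z; rewrite /= !in_itv/= myE /mx ge_max => /andP[/andP[-> _] ->]//.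
- move=> z; rewrite /= !in_itv/= myE /mx ge_max => /andP[xz zy] H.
  rewrite /ext0; case: ifPn => // z0; exfalso; apply: H.
  by rewrite xz zy (ltW z0).
Qed.

Lemma extcE F x : 0 <= x -> extc F x = F x.
Proof. by move=> x0; rewrite /extc (max_idPl x0). Qed.

Lemma extc_sqi F : sqi halfline F -> sqi halfline (extc F).
Proof.
apply: sqi_eq; first exact: halfline_meas.
by move=> x; rewrite halflineE => x0; rewrite extcE ?ltW.
Qed.

Lemma ext0E w x : 0 < x -> ext0 w x = w x.
Proof. by rewrite /ext0 => ->. Qed.

(** Moving the graph of F to the left by h pushes exactly the part over [0, h] out of the
    half-line. *)
Lemma n2_tail F h : continuous F -> sqi halfline F -> 0 <= h ->
  n2 halfline (fun x => F (x + h)) = n2 halfline F - \int[mu]_(x in `[0, h]) F x ^+ 2.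
Proof.
move=> cF sF h0; have mh := @halfline_meas R.
have mF : measurable_fun setT (fun x => F x ^+ 2).
  by apply: measurable_funX; exact: cont_meas.
have E1 : n2 halfline (fun x => F (x + h)) = \int[mu]_(x in `]h, +oo[) F x ^+ 2.
  rewrite -(@Rint_shift_ge0 _ `]h, +oo[ (fun x => F x ^+ 2) h)//; last first.
    by move=> x; exact: sqr_ge0.
  rewrite /n2 (_ : mkset _ = halfline)//.
  by apply/seteqP; split=> x /=; rewrite halflineE in_itv/= andbT; lra.
have E2 : halfline = `]0%R, h] `|` `]h, +oo[ :> set R.
  by apply/seteqP; split=> x /=; rewrite halflineE !in_itv/= andbT; [move=> x0; case: (leP x h); [left|right]; rewrite ?x0//|case; lra].
rewrite E1 [n2 halfline F]/n2 [in RHS]E2 Rintegral_setU//; last 2 first.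
- by rewrite -E2; case: sF.
- by apply/disj_setPS => x /=; rewrite !in_itv/= andbT; lra.
rewrite Rint_oc; first by ring.
by apply: itg_cont; apply: continuous_subspaceT => x; apply: (@continuous_comp _ _ _ F (fun y : R => y ^+ 2)); [exact: cF|exact: exprn_continuous].
Qed.
End HalfLineExtension.

(** * Differentiating squared norms in time *)

Section EnergyMethod.
Context {R : realType}.
Local Notation mu := (@lebesgue_measure R).
Implicit Types (I : set R) (f g u v w F phi d : R -> R) (a c x h e t s : R) (b : \bar R).

(** Convergence to 0 at t along I for quantities that are nonnegative, which is why only an upper
    bound is asked. The point t itself is excluded, as difference quotients demand. *)
Definition tends0 I t phi := forall e, 0 < e -> exists2 r, 0 < r &
  forall s, I s -> s != t -> `|s - t| < r -> phi s <= e.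

Lemma Ico0_le b t s : 0 <= s -> s <= t -> Ico0 b t -> Ico0 b s.
Proof.
by move=> s0 st [_ tb]; split=> //; apply: le_lt_trans tb; rewrite lee_fin.
Qed.

(** The mean value theorem on [0, T]. Derivatives are relative to [Ico0 b], hence one-sided at 0, so
    the two-sided derivative inside and the continuity at both ends are extracted separately from
    the hypothesis. *)
Lemma nincr_Ico0 b phi d :
  (forall t, Ico0 b t -> tends0 (Ico0 b) t (fun s => `|(phi s - phi t) / (s - t) - d t|)) ->
  (forall t, Ico0 b t -> d t <= 0) ->
  forall t, Ico0 b t -> phi t <= phi 0.
Proof.
move=> H d0 T IT; have [T0 _] := IT.
move: T0; rewrite le_eqVlt => /orP[/eqP <-//|T0].
have I0 : Ico0 b 0 by apply: Ico0_le IT => //; exact: ltW.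
have C t : Ico0 b t -> exists2 r, 0 < r &
    forall s, Ico0 b s -> `|s - t| < r -> `|phi s - phi t| <= (`|d t| + 1) * `|s - t|.
  move=> It; have [r r0 Hr] := H t It _ ltr01; exists r => // s Is sr.
  have [->|st] := eqVneq s t; first by rewrite !subrr normr0 mulr0.
  have := Hr s Is st sr; have st0 : 0 < `|s - t| by rewrite normr_gt0 subr_eq0.
  move=> K; rewrite -ler_pdivrMr// -normfV -normrM.
  by rewrite -[X in `|X|](subrK (d t)) (le_trans (ler_normD _ _))// addrC lerD2l.
have Cv t e : Ico0 b t -> 0 < e -> exists2 r, 0 < r &
    forall s, Ico0 b s -> `|s - t| < r -> `|phi t - phi s| <= e.
  move=> It e0; have [r r0 Hr] := C t It.
  have k0 : 0 < `|d t| + 1 by rewrite ltr_pwDr.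
  exists (Num.min r (e / (`|d t| + 1))); first by rewrite lt_min r0 divr_gt0.
  move=> s Is; rewrite lt_min => /andP[sr se].
  rewrite distrC (le_trans (Hr s Is sr))// mulrC -ler_pdivlMr//.
  exact: ltW.
have D t : t \in `]0, T[ -> is_derive t 1 phi (d t).
  rewrite in_itv/= => /andP[t0 tT].
  have It : Ico0 b t by apply: Ico0_le IT; exact: ltW.
  suff K : h^-1 *: ((phi \o shift t) (h *: 1) - phi t) @[h --> 0^'] --> (d t : R).
    by apply: DeriveDef; [apply/cvg_ex; exists (d t)|apply: cvg_lim].
  apply/cvgrPdist_le => e e0; have [r r0 Hr] := H t It e e0.
  near=> h.
  have h0 : h != 0 by near: h; exact: nbhs_dnbhs_neq.
  have hr : `|h| < r by near: h; exact: dnbhs0_lt.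
  have ht : `|h| < t by near: h; exact: dnbhs0_lt.
  have hT : `|h| < T - t by near: h; apply: dnbhs0_lt; rewrite subr_gt0.
  have := Hr (h + t); rewrite addrK => /(_ _ _ hr).
  rewrite distrC /= /GRing.scale/= mulr1 [h^-1 * _]mulrC; apply.
    move: ht hT; rewrite !ltr_norml => ht hT; apply: Ico0_le IT; lra.
  by rewrite -subr_eq0 addrK.
have cphi : {within `[0, T], continuous phi}.
  apply/(continuous_within_itvP _ T0); split.
  - by move=> t /D; exact: is_derive_cont.
  - apply/cvgrPdist_le => e e0; have [r r0 Hr] := Cv 0 e I0 e0.
    near=> s; have s0 : 0 < s by near: s; exact: nbhs_right_gt.
    apply: Hr; last first.
      rewrite subr0 gtr0_norm//; near: s; exact: nbhs_right_lt.
    by apply: Ico0_le IT; [exact: ltW|near: s; exact: nbhs_right_le].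
  - apply/cvgrPdist_le => e e0; have [r r0 Hr] := Cv T e IT e0.
    near=> s; have sT : s < T by near: s; exact: nbhs_left_lt.
    apply: Hr.
      by apply: Ico0_le IT; [near: s; exact: nbhs_left_ge|exact: ltW].
    rewrite ltr0_norm ?subr_lt0// opprB ltrBlDr -ltrBlDl.
    by near: s; apply: nbhs_left_gt; rewrite ltrBlDr ltrDl.
have [c cT E] := MVT T0 D cphi.
rewrite -subr_le0 E subr0 mulr_le0_ge0 ?(ltW T0)//; apply: d0.
by move: cT; rewrite in_itv/= => /andP[c0 cT]; apply: Ico0_le IT; exact: ltW.
Unshelve. all: by end_near. Qed.

(** The derivative of |A|^2 is 2 <A, B>: with D the error of the difference quotient, A s = A t + (s
    - t)(B + D), and the square is expanded. *)
Lemma n2_deriv I (A : R -> R -> R) (B : R -> R) t : I t ->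
  (forall s, I s -> sqi halfline (A s)) -> sqi halfline B ->
  tends0 I t (fun s => n2 halfline (fun x => (s - t)^-1 * (A s x - A t x) - B x)) ->
  tends0 I t (fun s => `|(n2 halfline (A s) - n2 halfline (A t)) / (s - t) -
                         2 * \int[mu]_(x in halfline) (A t x * B x)|).
Proof.
move=> It sA sB H e e0; have mh := @halfline_meas R.
have nA := n2_ge0 halfline (A t); have nB := n2_ge0 halfline B.
(* The weight in Young's inequality for 2 <A t, D>: k |A t|^2 is at most e/3, and so is |D|^2 / k
   once |D|^2 <= k e/3. The last third, obtained through r', is for (s - t) |B + D|^2, where |D|^2
   <= 1 bounds the norm. *)
pose k := e / 3 / (n2 halfline (A t) + 1).
have k0 : 0 < k by rewrite !divr_gt0// ltr_wpDl.
have ke : 0 < Num.min 1 (k * (e / 3)) by rewrite lt_min ltr01/= mulr_gt0// divr_gt0.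
have [r r0 Hr] := H _ ke.
pose r' := e / 3 / (2 * n2 halfline B + 2).
have r'0 : 0 < r' by rewrite !divr_gt0//; lra.
exists (Num.min r r'); first by rewrite lt_min r0.
move=> s Is st; rewrite lt_min => /andP[sr sr'].
have := Hr s Is st sr; rewrite le_min.
set D := (fun x => _) => /andP[D1 D2].
have st0 : s - t != 0 by rewrite subr_eq0.
have sD : sqi halfline D by apply: sqiB => //; apply: sqiZ => //; apply: sqiB => //; exact: sA.
have sBD := sqiD mh sB sD; have sAt := sA t It.
have AE : n2 halfline (A s) = n2 halfline (fun x => A t x + (s - t) * (B x + D x)).
  by apply: n2_eq => x _; rewrite /D; field.
rewrite AE n2D//; last exact: sqiZ.
rewrite n2Z//.
have -> : \int[mu]_(x in halfline) (A t x * ((s - t) * (B x + D x))) =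
    (s - t) * (\int[mu]_(x in halfline) (A t x * B x) + \int[mu]_(x in halfline) (A t x * D x)).
  rewrite -RintegralD//; [|exact: sqiM|exact: sqiM].
  rewrite -RintegralZl//; last by apply: itgD => //; exact: sqiM.
  by apply: Rint_eq => x _; ring.
set X := \int[mu]_(x in halfline) (A t x * B x); set Y := \int[mu]_(x in halfline) (A t x * D x).
set Z := n2 halfline (fun x => B x + D x).
rewrite (_ : _ - 2 * X = 2 * Y + (s - t) * Z); last by field.
rewrite (le_trans (ler_normD _ _))//.
have h1 := n2_dot mh k0 sAt sD; rewrite -/Y in h1.
have h2 : k * n2 halfline (A t) <= e / 3.
  rewrite /k -mulrA ler_piMr//; first by rewrite ltW// divr_gt0.
  by rewrite mulrC ler_pdivrMr ?mul1r; lra.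
have h3 : k^-1 * n2 halfline D <= e / 3.
  by rewrite mulrC ler_pdivrMr// mulrC.
have h4 : `|(s - t) * Z| <= e / 3.
  have Z0 : 0 <= Z := n2_ge0 _ _.
  have Z1 : Z <= 2 * n2 halfline B + 2 by have := n2D_le mh sB sD; rewrite -/Z; lra.
  rewrite normrM (ger0_norm Z0) (le_trans (ler_pM _ _ (ltW sr') Z1))//.
  by rewrite /r' divfK// gt_eqF//; lra.
lra.
Qed.

Lemma shift_sqi_half F h : sqi setT F -> sqi halfline (fun x => F (x + h)).
Proof. by move=> sF; apply: (sqiS halfline_meas measurableT (@subsetT _ _)); exact: sqiT_shift. Qed.

Lemma n2_half_le F : sqi setT F -> n2 halfline F <= n2 setT F.
Proof. by move=> sF; apply: n2S => //; exact: halfline_meas. Qed.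

(* The derivative at h = 0 of [h |-> |F(. + h)|^2 = |F|^2 - int_0^h F^2], computed in two ways. *)
Lemma dot_prim F w : sqi halfline F -> sqi halfline w -> prim F w ->
  2 * \int[mu]_(x in halfline) (F x * w x) = - F 0 ^+ 2.
Proof.
move=> sF sw FE; have mh := @halfline_meas R.
have gE := ext_gprim sw FE; have sw' := ext0_sqi sw.
have cF := gprim_continuous sw' gE.
have FcF h x : halfline x -> 0 <= h -> extc F (x + h) = F (x + h).
  by rewrite halflineE => x0 h0; rewrite extcE//; lra.
pose I : set R := [set h | 0 <= h].
have sFc := extc_sqi sF.
have H : tends0 I 0 (fun s => n2 halfline (fun x => (s - 0)^-1 *
   ((extc F (x + s)) - extc F (x + 0)) - w x)).
  move=> e e0; have [r r0 Hr] := dq_cvg sw' gE e0; exists r => // s _ s0 sr.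
  have [||sd dn] := Hr s; first by [].
    by move: sr; rewrite subr0.
  apply: le_trans dn; apply: le_trans (n2_half_le sd); rewrite le_eqVlt; apply/orP; left; apply/eqP.
  by apply: n2_eq => x; rewrite halflineE => x0; rewrite /dq ext0E// addr0 subr0 mulrC.
have sA s : I s -> sqi halfline (fun x => extc F (x + s)).
  by move=> _; exact: shift_half_sqi sw' gE sFc.
have I0 : I 0 by rewrite /I/=.
have := n2_deriv (A := fun s x => extc F (x + s)) I0 sA sw H.
have -> : \int[mu]_(x in halfline) (extc F (x + 0) * w x) = \int[mu]_(x in halfline) (F x * w x).
  by apply: Rint_eq => x; rewrite halflineE => x0; rewrite addr0 extcE ?ltW.
set X := \int[mu]_(x in halfline) _ => H1.
suff : F 0 ^+ 2 + 2 * X = 0 by lra.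
(* One e is the error of the derivative of the squared norm, the other that of replacing the mean of
   F^2 over [0, s] by its value at 0. *)
apply: (@small_eq0 _ _ 2) => e e0.
have [r r0 Hr] := H1 e e0.
have c0 : (extc F x ^+ 2) @[x --> 0] --> F 0 ^+ 2.
  rewrite -[F 0](@extcE _ F 0)//.
  exact: (@continuous_comp _ _ _ (extc F) (fun y : R => y ^+ 2) 0 (cF 0) (@exprn_continuous _ _ _)).
move/cvgrPdist_le : c0 => /(_ e e0) /nbhs_ballP[r' r'0 Hr'].
pose s := Num.min r r' / 2.
have m0 : 0 < Num.min r r' by rewrite lt_min r0.
have s0 : 0 < s by rewrite divr_gt0.
have [sr sr'] : s < r /\ s < r'.
  have : s < Num.min r r' by rewrite /s; lra.
  by rewrite lt_min => /andP[].
have := Hr s (ltW s0); rewrite gt_eqF// subr0 gtr0_norm// => /(_ isT sr).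
rewrite (n2_tail cF sFc (ltW s0)).
rewrite (n2_eq (g := extc F)); last by move=> x _; rewrite addr0.
set J := \int[mu]_(x in `[0, s]) _ => H2.
have mI : measurable (`[0, s]%classic : set R) by exact: measurable_itv.
have iJ : itg `[0, s] (fun x => extc F x ^+ 2).
  by apply: itg_cont; apply: continuous_subspaceT => x; apply: (@continuous_comp _ _ _ (extc F) (fun y : R => y ^+ 2)); [exact: cF|exact: exprn_continuous].
have H3 : `|F 0 ^+ 2 * s - J| <= e * s.
  have E : mu (`[0, s]%classic : set R) = s%:E.
    by rewrite lebesgue_measure_itv/= lte_fin s0 sube0.
  have C c : \int[mu]_(x in `[0, s]) c = c * s.
    by rewrite Rintegral_cst// (congr1 fine E).
  rewrite -!C -RintegralB//; last exact: itg_cst.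
  apply: (le_trans (Rint_abs _ _)) => //; first by apply: itgB => //; exact: itg_cst.
  apply: Rint_le => //; [by apply: itg_abs; apply: itgB => //; exact: itg_cst|exact: itg_cst|].
  move=> x; rewrite /= in_itv/= => /andP[x0 xs]; apply: Hr'.
  by rewrite /ball/= sub0r normrN ger0_norm//; lra.
have H4 : `|F 0 ^+ 2 - J / s| <= e.
  rewrite (_ : F 0 ^+ 2 - J / s = (F 0 ^+ 2 * s - J) / s); last by field; rewrite gt_eqF.
  by rewrite normf_div (gtr0_norm s0) ler_pdivrMr.
have H2' : `|- (J / s) - 2 * X| <= e.
  by move: H2; rewrite (_ : n2 halfline (extc F) - J - n2 halfline (extc F) = - J) ?mulNr//; ring.
rewrite (_ : F 0 ^+ 2 + 2 * X = (F 0 ^+ 2 - J / s) - (- (J / s) - 2 * X)); last by ring.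
rewrite (le_trans (ler_normB _ _))//; lra.
Qed.

(** [A t] is known only almost everywhere; [F t] is its continuous representative, which carries the
    trace, and [B t] the space derivative. By [n2_deriv] and [dot_prim] the squared norm of [A t]
    has derivative [- sg * F t 0 ^+ 2], nonpositive in both cases, and it starts from 0. *)
Lemma transport_uniq b (sg : R) (A B F : R -> R -> R) :
  (forall t, Ico0 b t -> [/\ sqi halfline (A t), sqi halfline (B t), prim (F t) (B t) &
     {ae mu, forall x, halfline x -> A t x = F t x}]) ->
  (forall t, Ico0 b t -> tends0 (Ico0 b) t
     (fun s => n2 halfline (fun x => (s - t)^-1 * (A s x - A t x) - sg * B t x))) ->
  (0 <= sg \/ forall t, Ico0 b t -> F t 0 = 0) ->
  {ae mu, forall x, halfline x -> A 0 x = 0} ->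
  forall t, Ico0 b t -> {ae mu, forall x, halfline x -> A t x = 0}.
Proof.
move=> H T sg0 A0 t It; have mh := @halfline_meas R.
have [sA sB FE AF] := H t It.
apply: n2_eq0 => //.
have sFt s : Ico0 b s -> sqi halfline (F s).
  move=> Is; have [sAs sBs FEs AFs] := H s Is.
  by apply: sqi_ae AFs sAs => //; exact: prim_meas (sqi_locitg0 sBs) FEs.
pose d s := 2 * \int[mu]_(x in halfline) (A s x * (sg * B s x)).
have dE s : Ico0 b s -> d s = - sg * F s 0 ^+ 2.
  move=> Is; have [sAs sBs FEs AFs] := H s Is; have sFs := sFt s Is.
  have iFB := sqiM mh sFs sBs.
  rewrite /d (@Rint_ae _ _ _ (fun x => sg * (F s x * B s x)))//.
  - rewrite RintegralZl//.
    by rewrite mulrCA (dot_prim sFs sBs FEs); ring.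
  - exact: itg_meas (sqiM mh sAs (sqiZ sg mh sBs)).
  - exact: itg_meas (itgZ sg mh iFB).
  - by apply: ae_imp AFs => x Hx /Hx ->; ring.
have := @nincr_Ico0 b (fun s => n2 halfline (A s)) d _ _ t It.
have -> : n2 halfline (A 0) = 0.
  have I0 : Ico0 b 0 by apply: (Ico0_le _ _ It) => //; case: It.
  have [sA0 _ _ _] := H 0 I0.
  rewrite (n2_ae (g := fun=> 0) mh _ _ A0)//; last by case: sA0.
  by rewrite /n2 (_ : (fun=> _) = (fun=> 0)) ?Rintegral_cst ?mul0r//; apply/funext => x; rewrite expr0n.
move=> K; apply/eqP; rewrite eq_le n2_ge0 andbT; apply: K.
- move=> s Is; apply: n2_deriv => //; last exact: T.
    by move=> r Ir; have [] := H r Ir.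
  by apply: sqiZ => //; have [] := H s Is.
- move=> s Is; rewrite dE//; case: sg0 => [sg0|F0].
    by rewrite mulNr oppr_le0 mulr_ge0// sqr_ge0.
  by rewrite F0// expr0n mulr0.
Qed.

End EnergyMethod.

(** * Complex-valued functions on the star graph *)

Section ComplexFunctions.
Context {R : realType}.
Local Notation mu := (@lebesgue_measure R).
Local Notation C := R[i].
Implicit Types (u v w : R -> C) (p : bool) (x t : R) (c z : C) (k : nat).

(** Indexing the real and imaginary parts by a Boolean lets one quantified statement transfer a real
    lemma to both at once. *)
Definition part p z : R := if p then complex.Im z else complex.Re z.
Definition pt p u : R -> R := fun x => part p (u x).

Lemma part_eq z z' : (forall p, part p z = part p z') -> z = z'.
Proof.
move=> H; apply/eqP; rewrite eq_complex.
by have := H false; have := H true; rewrite /part => -> ->; rewrite !eqxx.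
Qed.

Lemma partD p z z' : part p (z + z') = part p z + part p z'.
Proof. by case: p; case: z => a b; case: z'. Qed.

Lemma partB p z z' : part p (z - z') = part p z - part p z'.
Proof. by case: p; case: z => a b; case: z'. Qed.

Lemma part0 p : part p 0 = 0.
Proof. by case: p. Qed.

Lemma partMr p (r : R) z : part p ((r%:C)%C * z) = r * part p z.
Proof. by case: p; case: z => a b /=; rewrite mul0r ?addr0 ?subr0. Qed.

Lemma partrM p (r : R) z : part p (z * (r%:C)%C) = part p z * r.
Proof. by rewrite mulrC partMr mulrC. Qed.

Lemma partM p z z' : part p (z * z') =
  part p z * complex.Re z' + (if p then 1 else -1) * part (~~ p) z * complex.Im z'.
Proof. by case: p; case: z => a b; case: z' => a' b' /=; ring. Qed.

Lemma part_sum p (I : finType) (F : I -> C) :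
  part p (\sum_i F i) = \sum_i part p (F i).
Proof. by apply: (big_morph (part p)); [exact: partD|exact: part0]. Qed.

Lemma normc_sqr z : Normc.normc z ^+ 2 = part false z ^+ 2 + part true z ^+ 2.
Proof. by case: z => a b /=; rewrite sqr_sqrtr// addr_ge0// sqr_ge0. Qed.

Lemma ae_eq_halfP u v : ae_eq_half u v <->
  forall p, {ae mu, forall x, halfline x -> pt p u x = pt p v x}.
Proof.
split=> [H p|H]; first by apply: ae_imp H => x E /E; rewrite /pt => ->.
apply: ae_imp (ae_and (H false) (H true)) => x [E1 E2] x0.
by apply: part_eq => -[]; [exact: E2|exact: E1].
Qed.

Lemma ae_eq_half_sym u v : ae_eq_half u v -> ae_eq_half v u.
Proof. by apply: ae_imp => x H /H ->. Qed.

Lemma ae_eq_half_trans u v w : ae_eq_half u v -> ae_eq_half v w -> ae_eq_half u w.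
Proof. by move=> H1 H2; apply: ae_imp (ae_and H1 H2) => x [E1 E2] x0; rewrite E1// E2. Qed.

Lemma cmeasurableP u : cmeasurable u <-> forall p, measurable_fun halfline (pt p u).
Proof. by split=> [[m1 m2] []//|H]; split; [exact: (H false)|exact: (H true)]. Qed.

Lemma signC k : (-1) ^+ k = ((((-1) ^+ k) : R)%:C)%C :> C.
Proof. by rewrite rmorphXn rmorphN1. Qed.

Lemma part_cintegral p u : part p (cintegral u) = \int[mu]_(x in halfline) pt p u x.
Proof. by case: p. Qed.

Lemma is_wderivP k u w : is_wderiv k u w <-> forall p, rwd k (pt p u) (pt p w).
Proof.
split=> [[lu lw H] p|H].
  split; [by case: lu; case: p|by case: lw; case: p|].
  move=> phi tphi; have /(congr1 (part p)) := H phi tphi.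
  rewrite signC partMr !part_cintegral => E.
  transitivity (\int[mu]_(x in halfline) pt p (fun x => u x * ((derive1n k phi x)%:C)%C) x).
    by apply: Rint_eq => x _; rewrite /pt partrM.
  by rewrite E; congr (_ * _); apply: Rint_eq => x _; rewrite /pt partrM.
have [l1 l2 _] := H false; have [l3 l4 _] := H true.
split=> // phi tphi; apply: part_eq => p; have [_ _ E] := H p.
rewrite signC partMr !part_cintegral.
transitivity (\int[mu]_(x in halfline) (pt p u x * derive1n k phi x)).
  by apply: Rint_eq => x _; rewrite /pt partrM.
rewrite (E phi tphi); congr (_ * _); apply: Rint_eq => x _.
by rewrite /pt partrM.
Qed.

Lemma L2P u : L2 u <-> forall p, sqi halfline (pt p u).
Proof.
have mh := @halfline_meas R.
split=> [[/cmeasurableP mu_ fin]|H].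
  have i : itg halfline (fun x => Normc.normc (u x) ^+ 2).
    apply: itg_lty.
      rewrite (_ : (fun x => _) = fun x => pt false u x ^+ 2 + pt true u x ^+ 2).
        by apply: measurable_funD; exact: measurable_funX.
      by apply/funext => x; rewrite normc_sqr.
    apply: le_lt_trans fin; rewrite le_eqVlt; apply/orP; left; apply/eqP.
    by apply: eq_integral => x _; rewrite ger0_norm ?sqr_ge0.
  move=> p; split; first exact: mu_.
  apply: (itg_le _ _ _ i) => //; first by apply: measurable_funX; exact: mu_.
  move=> x _; rewrite normc_sqr ger0_norm ?sqr_ge0// /pt.
  by case: p; rewrite ?lerDl ?lerDr sqr_ge0.
split; first by apply/cmeasurableP => p; case: (H p).
rewrite /normL2sq (_ : (fun x => _) = fun x => (pt false u x ^+ 2 + pt true u x ^+ 2)%:E).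
  by rewrite itgE ?ltry//; apply: itgD => //; [case: (H false)|case: (H true)].
by apply/funext => x; rewrite normc_sqr.
Qed.

Lemma normL2sqE u : L2 u -> normL2sq u = (n2 halfline (pt false u) + n2 halfline (pt true u))%:E.
Proof.
move=> /L2P H; have mh := @halfline_meas R.
have [[_ H1] [_ H2]] := (H false, H true).
rewrite /n2 -RintegralD// -itgE//; last exact: itgD.
by apply: eq_integral => x _; rewrite normc_sqr.
Qed.

Lemma normL2sq_ge0 u : (0 <= normL2sq u)%E.
Proof. by apply: integral_ge0 => x _; rewrite lee_fin sqr_ge0. Qed.

Lemma L2_ae u v : L2 u -> cmeasurable v -> ae_eq_half u v -> L2 v.
Proof.
move=> /L2P H /cmeasurableP mv /ae_eq_halfP uv; apply/L2P => p.
by apply: sqi_ae (uv p) (H p) => //; exact: halfline_meas.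
Qed.

Lemma normL2sq_ae u v : L2 u -> L2 v -> ae_eq_half u v -> normL2sq u = normL2sq v.
Proof.
move=> Lu Lv /ae_eq_halfP uv; rewrite !normL2sqE//.
have mh := @halfline_meas R.
move/L2P: Lu => Lu; move/L2P: Lv => Lv.
by rewrite !(n2_ae mh _ _ (uv _)); [|by case: (Lu true)|by case: (Lv true)|by case: (Lu false)|by case: (Lv false)].
Qed.

Lemma pt_lin p u v (r : R) : pt p (fun x => u x + (r%:C)%C * v x) = fun x => pt p u x + r * pt p v x.
Proof. by apply/funext => x; rewrite /pt partD partMr. Qed.

Lemma pt_B p u v : pt p (fun x => u x - v x) = fun x => pt p u x - pt p v x.
Proof. by apply/funext => x; rewrite /pt partB. Qed.

Lemma pt_D p u v : pt p (fun x => u x + v x) = fun x => pt p u x + pt p v x.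
Proof. by apply/funext => x; rewrite /pt partD. Qed.

Lemma pt_Z p u (r : R) : pt p (fun x => (r%:C)%C * u x) = fun x => r * pt p u x.
Proof. by apply/funext => x; rewrite /pt partMr. Qed.

Lemma L2B u v : L2 u -> L2 v -> L2 (fun x => u x - v x).
Proof.
move=> /L2P Lu /L2P Lv; apply/L2P => p; rewrite pt_B; apply: sqiB => //; exact: halfline_meas.
Qed.

Lemma L2D u v : L2 u -> L2 v -> L2 (fun x => u x + v x).
Proof.
move=> /L2P Lu /L2P Lv; apply/L2P => p; rewrite pt_D; apply: sqiD => //; exact: halfline_meas.
Qed.

Lemma L2Z u (r : R) : L2 u -> L2 (fun x => (r%:C)%C * u x).
Proof.
move=> /L2P Lu; apply/L2P => p; rewrite pt_Z; apply: sqiZ => //; exact: halfline_meas.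
Qed.

Lemma is_wderiv_uniq k u w w' : is_wderiv k u w -> is_wderiv k u w' -> ae_eq_half w w'.
Proof. by move=> /is_wderivP H /is_wderivP H'; apply/ae_eq_halfP => p; exact: rwd_uniq (H p) (H' p). Qed.

(** [wderiv] is a choice among the weak derivatives, so only its class is determined. *)
Lemma wderivP k u w : is_wderiv k u w ->
  is_wderiv k u (wderiv k u) /\ ae_eq_half (wderiv k u) w.
Proof.
move=> H; have H' : is_wderiv k u (wderiv k u) by exact: (xgetI (P := [set w | is_wderiv k u w]) (fun=> 0) H).
by split=> //; exact: is_wderiv_uniq H' H.
Qed.

Lemma is_wderiv_meas k u w : is_wderiv k u w -> cmeasurable u /\ cmeasurable w.
Proof.
by move=> /is_wderivP H; split; apply/cmeasurableP => p; have [l1 l2 _] := H p; exact: locint_meas.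
Qed.

Lemma is_wderiv_ae k u w u' w' : is_wderiv k u w -> cmeasurable u' -> cmeasurable w' ->
  ae_eq_half u u' -> ae_eq_half w w' -> is_wderiv k u' w'.
Proof.
move=> /is_wderivP H /cmeasurableP m /cmeasurableP m' /ae_eq_halfP e /ae_eq_halfP e'.
by apply/is_wderivP => p; exact: rwd_ae (H p) (m p) (m' p) (e p) (e' p).
Qed.

Lemma is_wderiv_lin k u w u' w' (r : R) : is_wderiv k u w -> is_wderiv k u' w' ->
  is_wderiv k (fun x => u x + (r%:C)%C * u' x) (fun x => w x + (r%:C)%C * w' x).
Proof.
move=> /is_wderivP H /is_wderivP H'; apply/is_wderivP => p; rewrite !pt_lin.
exact: rwd_lin.
Qed.

Lemma dotH_wderiv k u : dotH k u -> is_wderiv k u (wderiv k u) /\ L2 (wderiv k u).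
Proof.
move=> [w [H Lw]]; have [H1 H2] := wderivP H; split=> //.
by apply: L2_ae Lw _ (ae_eq_half_sym H2); have [] := is_wderiv_meas H1.
Qed.

Lemma normL2sq_wderiv k u w : is_wderiv k u w -> L2 w -> normL2sq (wderiv k u) = normL2sq w.
Proof.
move=> H Lw; have [H1 H2] := wderivP H; apply: normL2sq_ae => //.
by have [] := @dotH_wderiv k u; first by exists w.
Qed.

Definition cprim U W : Prop := forall p, prim (pt p U) (pt p W).

Lemma cprim_is_wderiv U W : L2 W -> cprim U W -> is_wderiv 1 U W.
Proof.
move=> /L2P LW H; apply/is_wderivP => p; apply: rwd_prim (H p).
exact: sqi_locitg0.
Qed.

(** If f is nonzero at x it is nonzero on some ]x, x + d[, which has positive measure. Looking only
    to the right of x includes the point 0, where traces are taken. *)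
Lemma within_cont_ae0 (f : R -> R) : {within `[0, +oo[, continuous f} ->
  {ae mu, forall x, halfline x -> f x = 0} -> forall x, 0 <= x -> f x = 0.
Proof.
move=> cf [B [mB B0 sB]] x x0; apply/eqP; apply: contrapT => /negP fx.
have fx0 : 0 < `|f x| by rewrite normr_gt0.
have xI : (`[0, +oo[%classic : set R) x by rewrite /= in_itv/= x0.
have [d d0 Hd] : exists2 d, 0 < d & forall y, 0 <= y -> `|x - y| < d -> f y != 0.
  move/subspace_continuousP : cf => /(_ x xI)/cvgrPdist_lt/(_ _ fx0)/nbhs_ballP[d d0 Hd].
  exists d => // y y0 xy; have := Hd y xy; rewrite /= in_itv/= y0 => /(_ isT).
  by rewrite /from_subspace/=; apply: contraL => /eqP ->; rewrite subr0 ltxx.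
have sub : `]x, (x + d)%R[ `<=` B.
  move=> y; rewrite /= in_itv/= => /andP[xy yd]; apply: sB => /=.
  have y0 : 0 < y by lra.
  rewrite halflineE => /(_ y0); apply/eqP; apply: Hd; first exact: ltW.
  by rewrite ltr0_norm; lra.
have : (mu `]x, (x + d)%R[%classic <= mu B)%E.
  by apply: le_measure => //; rewrite inE//; exact: measurable_itv.
rewrite [mu B]B0 lebesgue_measure_itv/= lte_fin ifT; last lra.
by rewrite -EFinB lee_fin; lra.
Qed.

Lemma prim_within_oo (F w : R -> R) : sqi halfline w -> prim F w -> {within `[0, +oo[, continuous F}.
Proof. by move=> sw; apply: prim_continuous; exact: sqi_locitg0. Qed.

Lemma crepE u U : (forall p, {within `[0, +oo[, continuous (pt p U)}) -> ae_eq_half u U ->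
  forall x, 0 <= x -> crep u x = U x.
Proof.
move=> cU uU x x0.
pose S := [set w : R -> C |
    [/\ {within `[0, +oo[, continuous (fun x => complex.Re (w x))},
        {within `[0, +oo[, continuous (fun x => complex.Im (w x))} &
        ae_eq_half u w]].
have SU : S U by split=> //; [exact: (cU false)|exact: (cU true)].
have [c1 c2 uc] : S (crep u) := xgetI (fun=> 0) SU.
have cc : ae_eq_half (crep u) U := ae_eq_half_trans (ae_eq_half_sym uc) uU.
apply: part_eq => p; apply/eqP; rewrite -subr_eq0; apply/eqP.
apply: (@within_cont_ae0 (fun x => pt p (crep u) x - pt p U x)) => //.
  by move=> y; apply: cvgB; [case: p; [exact: c2|exact: c1]|exact: cU].
move/ae_eq_halfP : cc => /(_ p); apply: ae_imp => y H /H ->.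
by rewrite subrr.
Qed.

Lemma crep_prim u U W : L2 W -> cprim U W -> ae_eq_half u U ->
  forall x, 0 <= x -> crep u x = U x.
Proof.
by move=> /L2P LW UW; apply: crepE => p; exact: prim_within_oo (LW p) (UW p).
Qed.

Lemma prim_ext (F G w : R -> R) : (forall x, 0 <= x -> F x = G x) -> prim F w -> prim G w.
Proof. by move=> FG H x x0; rewrite -!FG//; exact: H. Qed.

(** The primitives of the two parts form a continuous representative, and [crep] must coincide with
    it on [0, +oo[: traces can thus be computed from any primitive. *)
Lemma is_wderiv_crep u w : is_wderiv 1 u w -> L2 w ->
  cprim (crep u) w /\ ae_eq_half u (crep u).
Proof.
move=> /is_wderivP H Lw; have /L2P Lw' := Lw.
have [F1 [P1 E1]] := rwd_prim_ex (sqi_locitg0 (Lw' false)) (H false).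
have [F2 [P2 E2]] := rwd_prim_ex (sqi_locitg0 (Lw' true)) (H true).
pose U x : C := (F1 x +i* F2 x)%C.
have UW : cprim U w by case.
have uU : ae_eq_half u U by apply/ae_eq_halfP => -[].
have E := crep_prim Lw UW uU; split.
  by move=> p; apply: prim_ext (UW p) => x x0; rewrite /pt E.
by apply: ae_imp uU => x Hx x0; rewrite E ?Hx//; move: x0; rewrite halflineE; exact: ltW.
Qed.

End ComplexFunctions.

(** * Limits of squared norms *)

Section Convergence.
Context {R : realType}.
Local Notation mu := (@lebesgue_measure R).
Local Notation C := R[i].
Implicit Types (I : set R) (t s e r : R) (f : R -> \bar R) (u v w : R -> C) (p : bool) (k : nat).

Definition tendsE I t f := forall e, 0 < e -> exists2 r, 0 < r &
  forall s, I s -> s != t -> `|s - t| < r -> (f s <= e%:E)%E.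

Lemma ge0_cvg0P (F : set_system R) f : Filter F -> (forall s, (0 <= f s)%E) ->
  (f s @[s --> F] --> 0%E) <-> (forall e, 0 < e -> F [set s | (f s <= e%:E)%E]).
Proof.
move=> FF f0; split=> [H e e0|H A].
  have : nbhs (0%E : \bar R) [set y | (y < e%:E)%E].
    by apply: open_nbhs_nbhs; split; [exact: open_ereal_lt_ereal|rewrite /= lte_fin].
  move=> nb; have K : F (f @^-1` [set y | (y < e%:E)%E]) := H _ nb.
  by apply: filterS K => s /= /ltW.
rewrite /nbhs/= /nbhs/= => /nbhs_ballP[e e0 He].
have e2 : 0 < e / 2 by rewrite divr_gt0.
apply: filterS (H _ e2) => s /= fs.
have ffin : f s \is a fin_num.
  by rewrite ge0_fin_numE// (le_lt_trans fs)// ltry.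
rewrite -(fineK ffin); apply: He.
have fs0 : 0 <= fine (f s) by rewrite fine_ge0.
rewrite /ball/= sub0r normrN ger0_norm//.
have : fine (f s) <= e / 2 by rewrite -lee_fin fineK.
by have : 0 < e by []; lra.
Qed.

Lemma cvg0_tendsE I t f : (forall s, (0 <= f s)%E) ->
  (f s @[s --> within I (t^')] --> 0%E) <-> tendsE I t f.
Proof.
move=> f0; split.
  move/(ge0_cvg0P _ f0) => H e /H /nbhs_ballP[r r0 Hr]; exists r => // s Is st sr.
  by apply: Hr => //; rewrite /ball/= distrC.
move=> H; apply/ge0_cvg0P => // e /H[r r0 Hr]; apply/nbhs_ballP; exists r => //.
by move=> s; rewrite /ball/= distrC => sr st Is; exact: Hr.
Qed.

Lemma cvg0_within I t f : (forall s, (0 <= f s)%E) ->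
  (f s @[s --> within I (nbhs t)] --> 0%E) <->
  (forall e, 0 < e -> exists2 r, 0 < r &
  forall s, I s -> `|s - t| < r -> (f s <= e%:E)%E).
Proof.
move=> f0; split.
  move/(ge0_cvg0P _ f0) => H e /H /nbhs_ballP[r r0 Hr]; exists r => // s Is sr.
  by apply: Hr => //; rewrite /ball/= distrC.
move=> H; apply/ge0_cvg0P => // e /H[r r0 Hr]; apply/nbhs_ballP; exists r => //.
by move=> s; rewrite /ball/= distrC => sr Is; exact: Hr.
Qed.

Lemma tendsE_eq I t f g : (forall s, I s -> f s = g s) -> tendsE I t f -> tendsE I t g.
Proof. by move=> fg H e /H[r r0 Hr]; exists r => // s Is st sr; rewrite -fg//; exact: Hr. Qed.

Lemma tends0D I t (a b : R -> R) : tends0 I t a -> tends0 I t b ->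
  tends0 I t (fun s => a s + b s).
Proof.
move=> Ha Hb e e0; have e2 : 0 < e / 2 by rewrite divr_gt0.
have [r r0 Hr] := Ha _ e2; have [r' r'0 Hr'] := Hb _ e2.
exists (Num.min r r'); first by rewrite lt_min r0.
move=> s Is st; rewrite lt_min => /andP[sr sr'].
by have := Hr s Is st sr; have := Hr' s Is st sr'; lra.
Qed.

Lemma tends0Z I t (a : R -> R) (c : R) : 0 <= c -> tends0 I t a ->
  tends0 I t (fun s => c * a s).
Proof.
move=> c0 Ha e e0; have c1 : 0 < c + 1 by lra.
have [r r0 Hr] := Ha _ (divr_gt0 e0 c1).
exists r => // s Is st sr; have := Hr s Is st sr; rewrite ler_pdivlMr// => H.
have [a0|a0] := leP 0 (a s); last by have := mulr_ge0_le0 c0 (ltW a0); lra.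
by rewrite mulrDr mulr1 in H; lra.
Qed.

Lemma tends0_le I t (a b : R -> R) : (forall s, I s -> a s <= b s) -> tends0 I t b -> tends0 I t a.
Proof.
move=> ab Hb e e0; have [r r0 Hr] := Hb _ e0; exists r => // s Is st sr.
exact: le_trans (ab s Is) (Hr s Is st sr).
Qed.

Lemma is_wderivZ k u w (r : R) : is_wderiv k u w ->
  is_wderiv k (fun x => (r%:C)%C * u x) (fun x => (r%:C)%C * w x).
Proof.
move=> H; have := is_wderiv_lin (r - 1) H H; rewrite rmorphB rmorph1.
by congr is_wderiv; apply/funext => x; ring.
Qed.

Lemma is_wderivB k u w u' w' : is_wderiv k u w -> is_wderiv k u' w' ->
  is_wderiv k (fun x => u x - u' x) (fun x => w x - w' x).
Proof.
move=> H H'; have := is_wderiv_lin (- 1) H H'; rewrite rmorphN1.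
by congr is_wderiv; apply/funext => x; rewrite mulN1r.
Qed.

End Convergence.

Section TwoCurves.
Context {R : realType}.
Local Notation mu := (@lebesgue_measure R).
Implicit Types (b : \bar R) (sg t : R) (A B F : R -> R -> R).

(** At time t, the transport equation A_t = sg A_x in the L^2 sense, [B] being A_x and [F] the
    representative of A that has a trace. For sg = 1 the wave moves towards the vertex, for sg = -1
    away from it. *)
Definition transported b sg A B F t : Prop :=
  [/\ sqi halfline (A t), sqi halfline (B t), prim (F t) (B t),
    {ae mu, forall x, halfline x -> A t x = F t x} &
    tends0 (Ico0 b) t
     (fun s => n2 halfline (fun x => (s - t)^-1 * (A s x - A t x) - sg * B t x))].

Lemma transported_uniq b sg A B F A' B' F' :
  (forall t, Ico0 b t -> transported b sg A B F t) ->
  (forall t, Ico0 b t -> transported b sg A' B' F' t) ->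
  0 <= sg \/ (forall t, Ico0 b t -> F t 0 = F' t 0) ->
  {ae mu, forall x, halfline x -> A 0 x = A' 0 x} ->
  forall t, Ico0 b t -> {ae mu, forall x, halfline x -> A t x = A' t x}.
Proof.
move=> ST ST' H0 AA' t It; have mh := @halfline_meas R.
suff : {ae mu, forall x, halfline x -> A t x - A' t x = 0}.
  by apply: ae_imp => x E /E /eqP; rewrite subr_eq0 => /eqP.
apply: (@transport_uniq _ b sg (fun s x => A s x - A' s x) (fun s x => B s x - B' s x)
    (fun s x => F s x - F' s x)) It.
- move=> r Ir; have [sA sB PF AF _] := ST r Ir; have [sA' sB' PF' AF' _] := ST' r Ir; split.
  + exact: (sqiB mh sA sA').
  + exact: (sqiB mh sB sB').
  + have := primD (-1) (sqi_locitg0 sB) (sqi_locitg0 sB') PF PF'.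
    by congr prim; apply/funext => x; rewrite mulN1r.
  + by apply: ae_imp (ae_and AF AF') => x [E E'] x0; rewrite (E x0) (E' x0).
- move=> r Ir; have [sA sB _ _ T] := ST r Ir; have [sA' sB' _ _ T'] := ST' r Ir.
  apply: tends0_le (tends0D (tends0Z (ler0n _ 2) T) (tends0Z (ler0n _ 2) T')) => q Iq.
  have [sAq _ _ _ _] := ST q Iq; have [sAq' _ _ _ _] := ST' q Iq.
  have s1 := sqiB mh (sqiZ (q - r)^-1 mh (sqiB mh sAq sA)) (sqiZ sg mh sB).
  have s2 := sqiB mh (sqiZ (q - r)^-1 mh (sqiB mh sAq' sA')) (sqiZ sg mh sB').
  have := n2B_le mh s1 s2; apply: le_trans; rewrite le_eqVlt; apply/orP; left; apply/eqP.
  by apply: n2_eq => x _; ring.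
- case: H0 => [|H0]; first by left.
  by right=> r Ir; apply/eqP; rewrite subr_eq0; apply/eqP; exact: H0.
- by apply: ae_imp AA' => x E x0; rewrite (E x0) subrr.
Qed.

End TwoCurves.

(** * Norms and time derivatives on the graph *)

Section GraphFunctions.
Context {R : realType} {N : nat}.
Local Notation mu := (@lebesgue_measure R).
Local Notation C := R[i].
Implicit Types (I : set R) (t s e r : R) (U A : R -> graph_fun R N) (u v w B : graph_fun R N) (p : bool) (j : 'I_N).

Lemma nsqL2G_ge0 u : (0 <= nsqL2G u)%E.
Proof. by apply: sume_ge0 => j _; exact: normL2sq_ge0. Qed.

Lemma nsqL2G_ge u j : (normL2sq (u j) <= nsqL2G u)%E.
Proof.
rewrite /nsqL2G (bigD1 j)//= leeDl// sume_ge0// => i _.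
exact: normL2sq_ge0.
Qed.

Definition quot U s t : graph_fun R N := fun j x => (((s - t)^-1)%:C)%C * (U s j x - U t j x).

Lemma L2G_quot A s t B : L2G (A s) -> L2G (A t) -> L2G B -> L2G (diffG (quot A s t) B).
Proof. by move=> H1 H2 H3 j; exact: (L2B (L2Z (s - t)^-1 (L2B (H1 j) (H2 j))) (H3 j)). Qed.

Lemma is_tderivP (nsq : graph_fun R N -> \bar R) I U t v : (forall w, (0 <= nsq w)%E) ->
  is_tderiv nsq I U t v <-> tendsE I t (fun s => nsq (diffG (quot U s t) v)).
Proof. by move=> H; exact: cvg0_tendsE. Qed.

Lemma nsq_tH1G_ge0 u : (0 <= nsq_tH1G u)%E. Proof. exact: nsqL2G_ge0. Qed.

Lemma pt_quot p A s t B j :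
  pt p (diffG (quot A s t) B j) =
  fun x => (s - t)^-1 * (pt p (A s j) x - pt p (A t j) x) - pt p (B j) x.
Proof. by apply/funext => x; rewrite /pt /diffG /quot partB partMr partB. Qed.

Lemma tderiv_L2 I A t B : I t -> (forall s, I s -> L2G (A s)) -> L2G B ->
  is_tderiv nsqL2G I A t B -> forall j p, tends0 I t
    (fun s => n2 halfline (fun x => (s - t)^-1 * (pt p (A s j) x - pt p (A t j) x) - pt p (B j) x)).
Proof.
move=> It LA LB /(is_tderivP _ _ _ _ nsqL2G_ge0) H j p e e0.
have [r r0 Hr] := H e e0; exists r => // s Is st sr.
have := le_trans (nsqL2G_ge _ j) (Hr s Is st sr).
rewrite normL2sqE ?lee_fin; last by apply: L2G_quot; [exact: LA|exact: LA|].
rewrite !pt_quot.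
move=> /(le_trans _); apply.
by case: p; rewrite ?lerDl ?lerDr n2_ge0.
Qed.

Lemma derivG_quot U s t v : (forall j, dotH 1 (U s j)) -> (forall j, dotH 1 (U t j)) ->
  (forall j, dotH 1 (v j)) ->
  nsq_tH1G (diffG (quot U s t) v) =
  nsqL2G (diffG (quot (fun s => derivG 1 (U s)) s t) (derivG 1 v)).
Proof.
move=> Hs Ht Hv; apply: eq_bigr => j _.
have [D1 L1] := dotH_wderiv (Hs j); have [D2 L2_] := dotH_wderiv (Ht j).
have [D3 L3] := dotH_wderiv (Hv j).
apply: normL2sq_wderiv.
  exact: (is_wderivB (is_wderivZ (s - t)^-1 (is_wderivB D1 D2)) D3).
exact: (L2B (L2Z (s - t)^-1 (L2B L1 L2_)) L3).
Qed.

(** The quotient norm is the L^2 norm of the space derivative, so time and space derivatives commute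
    at no cost. *)
Lemma tderiv_tH1 I U t v : I t -> (forall s, I s -> forall j, dotH 1 (U s j)) ->
  (forall j, dotH 1 (v j)) ->
  is_tderiv nsq_tH1G I U t v <-> is_tderiv nsqL2G I (fun s => derivG 1 (U s)) t (derivG 1 v).
Proof.
move=> It HU Hv.
split=> /is_tderivP H; apply/is_tderivP; rewrite /=.
- exact: nsqL2G_ge0.
- by apply: tendsE_eq (H nsq_tH1G_ge0) => s Is; rewrite derivG_quot//; exact: HU.
- exact: nsq_tH1G_ge0.
- by apply: tendsE_eq (H nsqL2G_ge0) => s Is; rewrite derivG_quot//; exact: HU.
Qed.

End GraphFunctions.

(** * Uniqueness *)

Section ShiftCurves.
Context {R : realType}.
Local Notation mu := (@lebesgue_measure R).
Implicit Types (I : set R) (F w : R -> R) (a s t e sg x : R).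

(** Since sg is 1 or -1, the error at time s is, up to that sign, the difference quotient error of F
    with step sg (s - t), translated by sg t. *)
Lemma shift_tends I F w sg t : sg ^+ 2 = 1 -> sqi setT w -> gprim F w ->
  tends0 I t (fun s => n2 halfline (fun x =>
    (s - t)^-1 * (F (x + sg * s) - F (x + sg * t)) - sg * w (x + sg * t))).
Proof.
move=> sg2 sw FE e e0; have [r r0 Hr] := dq_cvg sw FE e0.
have sg0 : sg != 0 by apply/eqP => E; move: sg2 => /eqP; rewrite E expr0n eq_sym oner_eq0.
have nsg : `|sg| = 1.
  by apply/eqP; rewrite -(@eqrXn2 _ 2)// real_normK ?num_real// sg2 expr1n.
exists r => // s _ st sr.
have h0 : sg * (s - t) != 0 by rewrite mulf_neq0// subr_eq0.
have hr : `|sg * (s - t)| < r by rewrite normrM nsg mul1r.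
have [sd dn] := Hr _ h0 hr.
apply: le_trans dn; rewrite -(n2T_shift (sg * t) sd).
apply: le_trans (n2_half_le (sqiT_shift _ sd)).
have sgV : sg^-1 = sg by rewrite -[LHS]mul1r -sg2 expr2 mulfK.
have E (z : R) : z ^+ 2 = (sg * z) ^+ 2 by rewrite exprMn sg2 mul1r.
rewrite le_eqVlt; apply/orP; left; apply/eqP.
apply: Rint_eq => x _; rewrite [LHS]E; congr (_ ^+ 2).
rewrite /dq (_ : x + sg * t + sg * (s - t) = x + sg * s); last by ring.
by rewrite invfM sgV mulrBr [sg * (sg * _)]mulrA -expr2 sg2; ring.
Qed.

Lemma shift_prim F w a : sqi setT w -> gprim F w ->
  prim (fun x => F (x + a)) (fun x => w (x + a)).
Proof.
move=> sw FE x x0; rewrite add0r.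
have : F (x + a) - F a = \int[mu]_(t in `[a, x + a]) w t by apply: FE; lra.
have E : [set r | `[a, x + a]%classic (r + a)] = `[0, x]%classic :> set R.
  by apply/seteqP; split=> r /=; rewrite !in_itv/=; lra.
rewrite -(@Rint_shift _ `[a, x + a] w a)//.
- by rewrite E => <-; ring.
- by case: sw.
- exact: sqiT_itv.
Qed.

Lemma shift_cont w sg t : sqi setT w -> sg ^+ 2 = 1 ->
  forall e, 0 < e -> exists2 r, 0 < r & forall s, `|s - t| < r ->
  sqi setT (fun x => w (x + sg * s) - w (x + sg * t)) /\
  n2 halfline (fun x => w (x + sg * s) - w (x + sg * t)) <= e.
Proof.
move=> sw sg2 e e0; have [r r0 Hr] := L2_shift sw e0.
have nsg : `|sg| = 1.
  by apply/eqP; rewrite -(@eqrXn2 _ 2)// real_normK ?num_real// sg2 expr1n.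
exists r => // s sr.
have sd : sqi setT (fun x => w (x + sg * s) - w (x + sg * t)).
  by apply: sqiB => //; exact: sqiT_shift.
split=> //; apply: le_trans (n2_half_le sd) _.
have hr : `|sg * (s - t)| < r by rewrite normrM nsg mul1r.
apply: le_trans (Hr _ hr).
rewrite -[leRHS](n2T_shift (sg * t)); last by apply: sqiB => //; exact: sqiT_shift.
rewrite le_eqVlt; apply/orP; left; apply/eqP; apply: n2_eq => x _.
by congr (w _ - _); ring.
Qed.

End ShiftCurves.

(** * Travelling waves inside a solution *)

Section Solutions.
Context {R : realType} {N : nat}.
Local Notation mu := (@lebesgue_measure R).
Local Notation C := R[i].
Implicit Types (I : set R) (t s e r : R) (b : \bar R) (u : R -> graph_fun R N)
  (f g h v : graph_fun R N) (p : bool) (j k : 'I_N) (alpha : C) (sg : R).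

Lemma tH1dotH2_deriv h j : tH1dotH2G h ->
  [/\ is_wderiv 1 (h j) (derivG 1 h j), L2 (derivG 1 h j),
      is_wderiv 1 (derivG 1 h j) (derivG 2 h j) & L2 (derivG 2 h j)].
Proof.
move=> [[H1_ _] H2]; have [D1 L1] := dotH_wderiv (H1_ j).
have [D2 L2'] := dotH_wderiv (H2 j).
have D12 : is_wderiv 1 (derivG 1 h j) (derivG 2 h j).
  have /is_wderivP D1' := D1; have /is_wderivP D2' := D2.
  by apply/is_wderivP => p; exact: rwd2_1 (D1' p) (D2' p).
by split; [exact: D1|exact: L1|exact: D12|exact: L2'].
Qed.

Lemma H1G_deriv v j : H1G v ->
  [/\ L2 (v j), is_wderiv 1 (v j) (derivG 1 v j) & L2 (derivG 1 v j)].
Proof. by move=> [/(_ j)[Lv Dv] _]; have [D L] := dotH_wderiv Dv; split; [exact: Lv|exact: D|exact: L]. Qed.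

(* With sg = 1 (resp. -1), the wave travelling towards (resp. away from) the vertex. *)
Definition trav p sg v w j : R -> R := fun x => pt p (v j) x + sg * pt p (w j) x.
Definition travc p sg v w j : R -> R :=
  fun x => pt p (crep (v j)) x + sg * pt p (crep (w j)) x.

Lemma trav_prim p sg v w v1 w1 j : is_wderiv 1 (v j) (v1 j) -> L2 (v1 j) ->
  is_wderiv 1 (w j) (w1 j) -> L2 (w1 j) ->
  prim (travc p sg v w j) (trav p sg v1 w1 j) /\
  {ae mu, forall x, halfline x -> trav p sg v w j x = travc p sg v w j x}.
Proof.
move=> Dv Lv Dw Lw; have [Pv Ev] := is_wderiv_crep Dv Lv.
have [Pw Ew] := is_wderiv_crep Dw Lw; split.
  apply: primD (Pv p) (Pw p); apply: sqi_locitg0.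
    by move/L2P : Lv; exact.
  by move/L2P : Lw; exact.
by apply: ae_imp (ae_and Ev Ew) => x [E1 E2] x0; rewrite /trav /travc /pt E1// E2.
Qed.

Lemma trav_sqi p sg v w j : L2 (v j) -> L2 (w j) -> sqi halfline (trav p sg v w j).
Proof.
move=> /L2P Lv /L2P Lw; apply: sqiD; [exact: halfline_meas|exact: Lv|].
by apply: sqiZ => //; exact: halfline_meas.
Qed.

(** With a for u_t, b for u_x, c for u_tx and d for u_xx, the transport error of u_t + sg u_x splits
    into the errors of (u_t)_t = u_xx and (u_x)_t = (u_t)_x. *)
Lemma trav_alg sg (a1 a2 b1 b2 c d k : R) : sg ^+ 2 = 1 ->
  k * ((a1 + sg * b1) - (a2 + sg * b2)) - sg * (c + sg * d) =
  (k * (a1 - a2) - d) + sg * (k * (b1 - b2) - c).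
Proof.
move=> sg2; transitivity ((k * (a1 - a2) - d) + sg * (k * (b1 - b2) - c) + (1 - sg ^+ 2) * d).
  by ring.
by rewrite sg2 subrr mul0r addr0.
Qed.

(** Both errors in [trav_alg] tend to 0: one because u_tt = u_xx almost everywhere, the other
    because the derivative of u in the quotient space is that of u_x in L^2. *)
Lemma sol_trav b alpha f g u p sg t j : sg ^+ 2 = 1 ->
  solution (Ico0 b) alpha f g u -> Ico0 b t ->
  let A s := trav p sg (dt (Ico0 b) u s) (derivG 1 (u s)) j in
  let B s := trav p sg (derivG 1 (dt (Ico0 b) u s)) (derivG 2 (u s)) j in
  let F s := travc p sg (dt (Ico0 b) u s) (derivG 1 (u s)) j in
  transported b sg A B F t.
Proof.
move=> sg2 Hs It A B F; have mh := @halfline_meas R.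
have HU s k : Ico0 b s -> _ := fun Is => tH1dotH2_deriv k (sol_space Hs Is).
have HV s k : Ico0 b s -> _ := fun Is => H1G_deriv k (sol_dt Hs Is).1.
have [DU LU DUU LUU] := HU t j It; have [LV DV LVx] := HV t j It.
have [PF AF] := trav_prim p sg DV LVx DUU LUU.
split; [exact: trav_sqi LV LU|exact: trav_sqi LVx LUU|exact: PF|exact: AF|].
have LVs s : Ico0 b s -> L2G (dt (Ico0 b) u s) by move=> Is k; have [] := HV s k Is.
have LUs s : Ico0 b s -> L2G (derivG 1 (u s)) by move=> Is k; have [] := HU s k Is.
have [Ltt Dtt] := sol_dtt Hs It.
have TV := tderiv_L2 It LVs Ltt Dtt j p.
have LVxG : L2G (derivG 1 (dt (Ico0 b) u t)) by move=> k; have [] := HV t k It.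
have dU s : Ico0 b s -> forall k, dotH 1 (u s k) by move=> Is k; case: (sol_space Hs Is) => -[].
have dV k : dotH 1 (dt (Ico0 b) u t k) by have [[/(_ k)[]]] := sol_dt Hs It.
have [_ Dt] := sol_dt Hs It.
have TU := tderiv_L2 It LUs LVxG ((tderiv_tH1 It dU dV).1 Dt) j p.
apply: tends0_le (tends0D (tends0Z (ler0n _ 2) TV) (tends0Z (ler0n _ 2) TU)).
move=> s Is.
have sq (z : R -> C) : L2 z -> sqi halfline (pt p z) by move=> /L2P; exact.
have sV : sqi halfline (fun x => (s - t)^-1 * (pt p (dt (Ico0 b) u s j) x - pt p (dt (Ico0 b) u t j) x) - pt p (dtt (Ico0 b) u t j) x).
  exact: (sqiB mh (sqiZ _ mh (sqiB mh (sq _ (LVs s Is j)) (sq _ (LVs t It j)))) (sq _ (Ltt j))).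
have sU : sqi halfline (fun x => (s - t)^-1 * (pt p (derivG 1 (u s) j) x - pt p (derivG 1 (u t) j) x) - pt p (derivG 1 (dt (Ico0 b) u t) j) x).
  exact: (sqiB mh (sqiZ _ mh (sqiB mh (sq _ (LUs s Is j)) (sq _ (LUs t It j)))) (sq _ LVx)).
have sU' := sqiZ sg mh sU.
have := n2D_le mh sV sU'; rewrite (n2Z _ mh sU) sg2 mul1r; apply: le_trans.
have sA s' : Ico0 b s' -> sqi halfline (A s').
  by move=> Is'; exact: trav_sqi (LVs s' Is' j) (LUs s' Is' j).
have sB : sqi halfline (B t) := trav_sqi p sg LVx LUU.
rewrite le_eqVlt; apply/orP; left; apply/eqP; apply: (n2_ae mh).
- exact: (proj1 (sqiB mh (sqiZ _ mh (sqiB mh (sA s Is) (sA t It))) (sqiZ _ mh sB))).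
- exact: (proj1 (sqiD mh sV sU')).
have /ae_eq_halfP/(_ p) := sol_wave Hs It j; apply: ae_imp => x E x0.
by rewrite (E x0); exact: trav_alg.
Qed.

Lemma is_wderiv_cst (c : C) : is_wderiv 1 (fun=> c) (fun=> 0 : C).
Proof.
have mh := @halfline_meas R.
have L0 : L2 (fun=> 0 : C).
  by apply/L2P => p; apply: (sqi_eq mh _ (sqi0 mh)) => x _; rewrite /pt part0.
apply: (cprim_is_wderiv L0) => p x x0; rewrite /pt part0.
rewrite (_ : Rintegral _ _ _ = 0) ?addr0//.
by rewrite Rintegral_cst// mul0r.
Qed.

Lemma eq_mod_cst_derivG h h' j : dotH 1 (h j) -> dotH 1 (h' j) -> eq_mod_cst h h' ->
  ae_eq_half (derivG 1 h j) (derivG 1 h' j).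
Proof.
move=> /dotH_wderiv[D _] /dotH_wderiv[D' _] [c /(_ j) hc].
have DB := is_wderivB D D'.
have mc : cmeasurable (fun=> c) by have [] := is_wderiv_meas (is_wderiv_cst c).
have m0 : cmeasurable (fun=> 0 : C) by have [] := is_wderiv_meas (is_wderiv_cst c).
have mB : cmeasurable (fun x => wderiv 1 (h j) x - wderiv 1 (h' j) x) by have [] := is_wderiv_meas DB.
have refl (z : R -> C) : ae_eq_half z z by apply: ae_all.
have := is_wderiv_uniq (is_wderiv_ae DB mc mB hc (refl _)) (is_wderiv_cst c).
by apply: ae_imp => x E /E /eqP; rewrite subr_eq0 => /eqP.
Qed.

Definition inc f g j : R -> C := fun x => crep (derivG 1 f j) x + crep (g j) x.

Lemma part_inc p f g j x : part p (inc f g j x) = travc p 1 g (derivG 1 f) j x.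
Proof. by rewrite /inc partD /travc /pt mul1r addrC. Qed.

(** The translates of the initial incoming profile form a second transported curve with the same
    initial value. Uniqueness for sg = 1 identifies it with the incoming wave, and continuous
    representatives that agree almost everywhere have the same trace at 0. *)
Lemma sol_travc_inc b alpha f g u p t j : tH1dotH2G f -> H1G g ->
  solution (Ico0 b) alpha f g u -> Ico0 b t ->
  travc p 1 (dt (Ico0 b) u t) (derivG 1 (u t)) j 0 = part p (inc f g j t).
Proof.
move=> Hf Hg Hs It; have mh := @halfline_meas R.
have [Df Lf Dff Lff] := tH1dotH2_deriv j Hf; have [Lg Dg Lgx] := H1G_deriv j Hg.
pose P0 := travc p 1 g (derivG 1 f) j.
pose P1 := trav p 1 (derivG 1 g) (derivG 2 f) j.
have [PP aeP] : prim P0 P1 /\ {ae mu, forall x, halfline x -> trav p 1 g (derivG 1 f) j x = P0 x}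
  := trav_prim p 1 Dg Lgx Dff Lff.
have sP1 : sqi halfline P1 := trav_sqi p 1 Lgx Lff.
have sP0 : sqi halfline P0.
  by apply: sqi_ae aeP (trav_sqi p 1 Lg Lf) => //; exact: prim_meas (sqi_locitg0 sP1) PP.
have gP := ext_gprim sP1 PP; have sP1' := ext0_sqi sP1.
pose A s := trav p 1 (dt (Ico0 b) u s) (derivG 1 (u s)) j.
pose B s := trav p 1 (derivG 1 (dt (Ico0 b) u s)) (derivG 2 (u s)) j.
pose F s := travc p 1 (dt (Ico0 b) u s) (derivG 1 (u s)) j.
have ST s : Ico0 b s -> transported b 1 A B F s := fun Is => sol_trav p j (expr1n R 2) Hs Is.
pose S s x := extc P0 (x + s); pose S1 s x := ext0 P1 (x + s).
have I0 : Ico0 b 0 by apply: (Ico0_le _ _ It) => //; case: It.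
have sS s : sqi halfline (S s) := shift_half_sqi s sP1' gP (extc_sqi sP0).
have sS1 s : sqi halfline (S1 s) := shift_sqi_half s sP1'.
have pS s : prim (S s) (S1 s) := shift_prim s sP1' gP.
have SS s : Ico0 b s -> transported b 1 S S1 S s.
  move=> Is; split; [exact: sS|exact: sS1|exact: pS|by apply: ae_all|].
  apply: tends0_le (shift_tends (Ico0 b) s (expr1n R 2) sP1' gP) => q _.
  rewrite le_eqVlt; apply/orP; left; apply/eqP.
  by apply: n2_eq => x _; rewrite /S /S1 !mul1r.
have D s : Ico0 b s -> {ae mu, forall x, halfline x -> A s x = S s x}.
  apply: (transported_uniq ST SS (or_introl ler01)).
  have [Hf0 Hg0] := sol_init Hs.
  have dU : dotH 1 (u 0 j) by case: (sol_space Hs I0) => -[].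
  have df : dotH 1 (f j) by case: Hf => -[].
  have E1 := eq_mod_cst_derivG dU df Hf0; have E2 := Hg0 j.
  apply: ae_imp (ae_and (ae_and E1 E2) aeP) => x [[H1 H2] H3] x0.
  rewrite /S addr0 extcE; last by move: x0; rewrite halflineE; exact: ltW.
  by rewrite -(H3 x0) /A /trav /pt (H1 x0) (H2 x0).
have [sA sB PF AF _] := ST t It.
have c1 := prim_within_oo sB PF; have c2 := prim_within_oo (sS1 t) (pS t).
have : F t 0 - S t 0 = 0.
  apply: (@within_cont_ae0 _ (fun x => F t x - S t x)) => //.
    by move=> y; apply: cvgB; [exact: c1|exact: c2].
  by apply: ae_imp (ae_and AF (D t It)) => x [E1 E2] x0; rewrite -(E1 x0) (E2 x0) subrr.
move=> /eqP; rewrite subr_eq0 => /eqP; rewrite -/(F t 0) => ->.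
by rewrite /S add0r extcE ?part_inc//; case: It.
Qed.

End Solutions.

(** * Vertex traces of a solution and what they determine *)

Section Uniqueness.
Context {R : realType} {N : nat}.
Local Notation mu := (@lebesgue_measure R).
Local Notation C := R[i].
Implicit Types (I : set R) (t s e r : R) (b : \bar R) (u : R -> graph_fun R N)
  (f g h v : graph_fun R N) (p : bool) (j k : 'I_N) (alpha : C) (sg : R).

Lemma sol_inc b alpha f g u t j : tH1dotH2G f -> H1G g ->
  solution (Ico0 b) alpha f g u -> Ico0 b t ->
  crep (dt (Ico0 b) u t j) 0 + crep (derivG 1 (u t) j) 0 = inc f g j t.
Proof.
move=> Hf Hg Hs It; apply: part_eq => p; rewrite partD.
by rewrite -(sol_travc_inc p j Hf Hg Hs It) /travc /pt mul1r.
Qed.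

Lemma sol_vertex_sum b alpha f g u t k : tH1dotH2G f -> H1G g ->
  solution (Ico0 b) alpha f g u -> Ico0 b t ->
  \sum_j inc f g j t = (N%:R - alpha) * crep (dt (Ico0 b) u t k) 0.
Proof.
move=> Hf Hg Hs It.
have E j := sol_inc j Hf Hg Hs It.
under eq_bigr => j _ do rewrite -E.
rewrite big_split/=; have := sol_vertex Hs It k.
move=> /eqP; rewrite addr_eq0 => /eqP ->.
have [[_ Hc] _] := sol_dt Hs It.
under eq_bigr => j _ do rewrite (Hc j k).
by rewrite sumr_const card_ord mulrBl mulr_natl.
Qed.

Lemma sol_trav_uniq b alpha f g u u' p sg j : sg ^+ 2 = 1 -> tH1dotH2G f ->
  solution (Ico0 b) alpha f g u -> solution (Ico0 b) alpha f g u' ->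
  0 <= sg \/ (forall t, Ico0 b t ->
    travc p sg (dt (Ico0 b) u t) (derivG 1 (u t)) j 0 =
    travc p sg (dt (Ico0 b) u' t) (derivG 1 (u' t)) j 0) ->
  forall t, Ico0 b t -> {ae mu, forall x, halfline x ->
    trav p sg (dt (Ico0 b) u t) (derivG 1 (u t)) j x =
    trav p sg (dt (Ico0 b) u' t) (derivG 1 (u' t)) j x}.
Proof.
move=> sg2 Hf Hs Hs' H0 t It; have mh := @halfline_meas R.
apply: (transported_uniq (fun s Is => sol_trav p j sg2 Hs Is)
  (fun s Is => sol_trav p j sg2 Hs' Is) H0 _ It).
have I0 : Ico0 b 0 by apply: (Ico0_le _ _ It) => //; case: It.
have [Hf0 Hg0] := sol_init Hs; have [Hf0' Hg0'] := sol_init Hs'.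
have dU : dotH 1 (u 0 j) by case: (sol_space Hs I0) => -[].
have dU' : dotH 1 (u' 0 j) by case: (sol_space Hs' I0) => -[].
have df : dotH 1 (f j) by case: Hf => -[].
have E1 := eq_mod_cst_derivG dU df Hf0; have E1' := eq_mod_cst_derivG dU' df Hf0'.
have E2 := Hg0 j; have E2' := Hg0' j.
apply: ae_imp (ae_and (ae_and E1 E2) (ae_and E1' E2')) => x [[H1 H2] [H1' H2']] x0.
by rewrite /trav /pt (H1 x0) (H2 x0) (H1' x0) (H2' x0).
Qed.

(** On each edge the difference is the constant h(0) - h'(0), and continuity at the vertex makes
    these constants the same on all edges. *)
Lemma eq_deriv_mod_cst h h' : (0 < N)%N -> dotH1G h -> dotH1G h' ->
  (forall j, ae_eq_half (derivG 1 h j) (derivG 1 h' j)) -> eq_mod_cst h h'.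
Proof.
move=> N0 [Hh Hc] [Hh' Hc'] E; pose j0 := Ordinal N0.
exists (crep (h j0) 0 - crep (h' j0) 0) => j; rewrite (Hc j0 j) (Hc' j0 j).
have [D L] := dotH_wderiv (Hh j); have [D' L'] := dotH_wderiv (Hh' j).
have D'' : is_wderiv 1 (h' j) (derivG 1 h j).
  apply: (is_wderiv_ae D' _ _ _ (ae_eq_half_sym (E j))).
  - by have [] := is_wderiv_meas D'.
  - by have [] := is_wderiv_meas D.
  - by apply: ae_all.
have [P1 E1] := is_wderiv_crep D L; have [P2 E2] := is_wderiv_crep D'' L.
apply: ae_imp (ae_and E1 E2) => x [H1 H2] x0; rewrite /diffG (H1 x0) (H2 x0).
have x0' : 0 <= x by move: x0; rewrite halflineE; exact: ltW.
apply: part_eq => p; rewrite !partB.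
have := P1 p x x0'; rewrite {1}/pt => ->; have := P2 p x x0'; rewrite {1}/pt => ->.
by rewrite /pt; ring.
Qed.

Lemma add_cancel (y z y' z' c : C) : y + z = c -> y' + z' = c -> y = y' -> z = z'.
Proof. by move=> H H' E; move: H; rewrite -H' E => /addrI. Qed.

Lemma sum_diff_inj (y z y' z' : R) : y + 1 * z = y' + 1 * z' ->
  y + -1 * z = y' + -1 * z' -> z = z'.
Proof. lra. Qed.

(** Dividing by N - alpha determines the trace of u_t, and the incoming trace then gives that of
    u_x. With the outgoing traces equal, both travelling waves agree, and u_x is half their
    difference. *)
Lemma sol_uniq b alpha f g u u' : (0 < N)%N -> alpha != N%:R ->
  tH1dotH2G f -> H1G g ->
  solution (Ico0 b) alpha f g u -> solution (Ico0 b) alpha f g u' -> same_on (Ico0 b) u u'.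
Proof.
move=> N0 aN Hf Hg Hs Hs' t It; pose k := Ordinal N0.
have V0 s j : Ico0 b s -> crep (dt (Ico0 b) u s j) 0 = crep (dt (Ico0 b) u' s j) 0.
  move=> Is; have := sol_vertex_sum j Hf Hg Hs' Is; rewrite (sol_vertex_sum j Hf Hg Hs Is).
  by apply: mulfI; rewrite subr_eq0 eq_sym.
have U0 s j : Ico0 b s -> crep (derivG 1 (u s) j) 0 = crep (derivG 1 (u' s) j) 0.
  move=> Is; exact: (add_cancel (sol_inc j Hf Hg Hs Is) (sol_inc j Hf Hg Hs' Is) (V0 s j Is)).
apply: (eq_deriv_mod_cst N0 (sol_space Hs It).1 (sol_space Hs' It).1) => j.
apply/ae_eq_halfP => p.
have E1 := @sol_trav_uniq b alpha f g u u' p 1 j (expr1n R 2) Hf Hs Hs' (or_introl ler01) t It.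
have sgN : (-1 : R) ^+ 2 = 1 by rewrite sqrrN expr1n.
have E2 : {ae mu, forall x, halfline x ->
    trav p (-1) (dt (Ico0 b) u t) (derivG 1 (u t)) j x =
    trav p (-1) (dt (Ico0 b) u' t) (derivG 1 (u' t)) j x}.
  apply: (@sol_trav_uniq b alpha f g u u' p (-1) j sgN Hf Hs Hs' _ t It); right=> s Is.
  exact: (congr2 (fun y z => part p y + -1 * part p z) (V0 s j Is) (U0 s j Is)).
apply: ae_imp (ae_and E1 E2) => x [H1 H2] x0.
exact: (sum_diff_inj (H1 x0) (H2 x0)).
Qed.

Lemma sol_inc_sum0 b f g u t : (0 < N)%N -> tH1dotH2G f -> H1G g ->
  solution (Ico0 b) N%:R f g u -> Ico0 b t -> \sum_j inc f g j t = 0.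
Proof.
move=> N0 Hf Hg Hs It.
by rewrite (sol_vertex_sum (Ordinal N0) Hf Hg Hs It) subrr mul0r.
Qed.

(** A solution on [0, t_0 + eps[ would make the incoming traces sum to 0 up to t_0 + eps/2, beyond
    the supremum. *)
Lemma no_sol_after f g eps : (0 < N)%N -> tH1dotH2G f -> H1G g ->
  t_crit f g \is a fin_num -> 0 < eps ->
  ~ exists u, solution (Ico0 (t_crit f g + eps%:E)%E) N%:R f g u.
Proof.
move=> N0 Hf Hg tfin e0 [u Hs].
pose t1 := fine (t_crit f g).
have tE : t_crit f g = t1%:E by rewrite fineK.
(* Either some t >= 0 lies in the set, or the set is empty and its supremum is -oo, which finiteness
   excludes. *)
have t10 : 0 <= t1.
  rewrite leNgt; apply/negP => t1n.
  have [E0|E0] := pselect (exists t, 0 <= t /\ forall s, 0 <= s <= t ->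
      \sum_(j < N) (crep (derivG 1 f j) s + crep (g j) s) = 0).
    have [t [t0 Ht]] := E0.
    have : (t%:E <= t_crit f g)%E by apply: ereal_sup_ubound; exists t.
    by rewrite tE lee_fin; lra.
  have : (t_crit f g <= -oo)%E.
    apply: ge_ereal_sup => _ [t Ht <-]; exfalso; apply: E0; exists t; exact: Ht.
  by rewrite tE.
have e2 : 0 < eps / 2 by rewrite divr_gt0.
have : ((t1 + eps / 2)%:E <= t_crit f g)%E.
  apply: ereal_sup_ubound; exists (t1 + eps / 2) => //; split; first by lra.
  move=> s /andP[s0 st]; apply: (sol_inc_sum0 N0 Hf Hg Hs); split=> //.
  by rewrite tE -EFinD lte_fin; lra.
by rewrite tE lee_fin; lra.
Qed.

End Uniqueness.

(** * D'Alembert solutions *)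

Section WaveCurves.
Context {R : realType}.
Local Notation mu := (@lebesgue_measure R).
Implicit Types (I : set R) (F G w v P Q : R -> R) (a c k l s t e x y T : R) (b : \bar R).

Lemma gprimD F G w v c : sqi setT w -> sqi setT v -> gprim F w -> gprim G v ->
  gprim (fun x => F x + c * G x) (fun x => w x + c * v x).
Proof.
move=> sw sv FE GE x y xy.
have iw := sqiT_itv x y sw; have iv := sqiT_itv x y sv.
rewrite RintD//; last exact: itgZ.
by rewrite RintegralZl// -FE// -GE//; ring.
Qed.

Lemma gprim_addc F w c : gprim F w -> gprim (fun x => F x + c) w.
Proof. by move=> FE x y xy; rewrite -FE//; ring. Qed.

Lemma gprim_opp F w : sqi setT w -> gprim F w ->
  gprim (fun x => F (- x)) (fun x => - w (- x)).
Proof.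
move=> sw FE x y xy; have xy' : - y <= - x by rewrite lerN2.
have E : [set r | `[(- y), (- x)]%classic (- r)] = `[x, y]%classic :> set R.
  by apply/seteqP; split=> r /=; rewrite !in_itv/=; lra.
have iw := sqiT_itv (- y) (- x) sw.
have K : \int[mu]_(r in `[x, y]) w (- r) = \int[mu]_(r in `[(- y), (- x)]) w r.
  by rewrite -E; apply: Rint_mpres => //; [exact: mpres_opp|case: sw].
rewrite (_ : Rintegral _ _ _ = \int[mu]_(r in `[x, y]) (-1 * w (- r))); last first.
  by apply: Rint_eq => r _; rewrite mulN1r.
rewrite RintegralZl//; last first.
  by rewrite -E; apply: itg_mpres => //; [exact: mpres_opp|case: sw].
by rewrite K -FE//; ring.
Qed.

Lemma sqiT_opp w : sqi setT w -> sqi setT (fun x => w (- x)).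
Proof.
move=> [mw iw]; split; first exact: meas_mpres mpres_opp mw.
have := itg_mpres mpres_opp measurableT (itg_meas iw) iw.
by rewrite (_ : mkset _ = setT)//; apply/seteqP; split.
Qed.

(* The outgoing wave: its trace at 0 is [2v - P], where P is the incoming one. *)
Definition qt (V : zmodType) (P Q v : R -> V) (y : R) : V :=
  if 0 <= y then Q y else v (- y) + v (- y) - P (- y).

(** The almost everywhere derivative of [qt], with the sign that the reflection produces for y < 0;
    the value at y = 0 is immaterial. *)
Definition qt1 (V : zmodType) (P1 Q1 v1 : R -> V) (y : R) : V :=
  if 0 < y then Q1 y else
  if y < 0 then P1 (- y) - (v1 (- y) + v1 (- y)) else 0.

Lemma qt_gprim P P1 Q Q1 v v1 T : 0 <= T ->
  prim P P1 -> sqi halfline P1 -> prim Q Q1 -> sqi halfline Q1 ->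
  sqi `[0, T] v1 -> (forall s, 0 <= s <= T -> v s = v 0 + \int[mu]_(r in `[0, s]) v1 r) ->
  v 0 + v 0 - P 0 = Q 0 ->
  exists F w, [/\ gprim F w, sqi setT w &
    forall y, - T < y -> F y = qt P Q v y /\ w y = qt1 P1 Q1 v1 y].
Proof.
move=> T0 PP sP QQ sQ sv vE v0; have mh := @halfline_meas R.
pose vT s := v (Num.min s T); pose v1T s := if (0 < s <= T) then v1 s else 0.
have mT : measurable (`]0, T]%classic : set R) by exact: measurable_itv.
have svT : sqi halfline v1T.
  have [mv iv] : sqi `]0, T] v1.
    by apply: sqiS sv => // x; rewrite /= !in_itv/= => /andP[/ltW -> ->].
  have E : v1T = v1 \_ `]0, T].
    apply/funext => x; rewrite patchE /v1T; case: ifPn => xT.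
      by rewrite mem_set//= in_itv.
    by rewrite memNset//= in_itv/=; exact/negP.
  split; first by rewrite E; apply: measurable_funTS; exact/(measurable_restrictT _ _).1.
  apply: (itg_ext mT mh) => //.
  - by move=> x; rewrite halflineE /= in_itv/= => /andP[].
  - by move=> x _; rewrite /= in_itv/= /v1T => /negP/negbTE ->; rewrite expr0n.
  - by apply: itg_eq iv => // x; rewrite /= in_itv/= /v1T => ->.
have pvT : prim vT v1T.
  move=> x x0; rewrite /vT (min_idPl T0).
  pose m := Num.min x T.
  have m0 : 0 <= m by rewrite le_min x0.
  have mT' : m <= T by rewrite ge_min lexx orbT.
  have mx : m <= x by rewrite ge_min lexx.
  rewrite -/m vE ?m0//; congr (_ + _).
  have iv1 : itg `[0, m] v1 by exact: itg_sub_itv (lexx 0) mT' (sqi_itv sv).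
  have iv2 := sqi_locitg0 svT.
  rewrite -Rint_oc// -[RHS]Rint_oc//.
  rewrite [RHS](@Rint_sub _ `]0, m] `]0, x])//.
  - apply: Rint_eq => r; rewrite /= in_itv/= /v1T => /andP[r0 rm].
    by rewrite r0 (le_trans rm mT').
  - by move=> r; rewrite /= !in_itv/= => /andP[-> rm]; exact: le_trans rm mx.
  - move=> r; rewrite /= !in_itv/= /v1T => /andP[r0 rx] H.
    rewrite ifF//; apply/negP => /andP[_ rT]; apply: H.
    by rewrite r0 /m le_min rx.
pose W x := vT x + 1 * vT x + -1 * P x.
pose W1 x := v1T x + 1 * v1T x + -1 * P1 x.
have iv := sqi_locitg0 svT.
have svv := sqiD mh svT (sqiZ 1 mh svT).
have sW : sqi halfline W1 := sqiD mh svv (sqiZ (-1) mh sP).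
have pW : prim W W1 := primD (-1) (sqi_locitg0 svv) (sqi_locitg0 sP) (primD 1 iv iv pvT pvT) PP.
have gQ := ext_gprim sQ QQ; have sQe := ext0_sqi sQ.
have gW := gprim_opp (ext0_sqi sW) (ext_gprim sW pW).
have sWo := sqiT_opp (ext0_sqi sW).
have sWo' : sqi setT (fun x => - ext0 W1 (- x)) := sqiN measurableT sWo.
(* On either side of 0 one of the two extensions is constant, equal to Q 0, which is therefore
   subtracted. *)
exists (fun y => extc Q y + 1 * extc W (- y) + - Q 0).
exists (fun y => ext0 Q1 y + 1 * (- ext0 W1 (- y))); split.
- exact: (gprim_addc _ (gprimD 1 sQe sWo' gQ gW)).
- exact: sqiD measurableT sQe (sqiZ 1 measurableT sWo').
move=> y yT; rewrite /qt /qt1 /extc /ext0 !mul1r oppr_gt0; split.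
  case: ifPn => y0.
    have yN : - y <= 0 by rewrite oppr_le0.
    rewrite (max_idPl y0) (max_idPr yN) /W /vT (min_idPl T0) -v0; ring.
  have y0' : y < 0 by rewrite ltNge.
  have yN : 0 <= - y by rewrite oppr_ge0 ltW.
  have yT' : - y <= T by rewrite lerNl ltW.
  rewrite (max_idPr (ltW y0')) (max_idPl yN) /W /vT (min_idPl yT'); ring.
have [y0|y0] := ltP 0 y.
  by rewrite ltNge (ltW y0)/= oppr0 addr0.
rewrite add0r; case: ifPn => y0'; last by rewrite oppr0.
have yN : 0 < - y by rewrite oppr_gt0.
have yT' : - y <= T by rewrite lerNl ltW.
by rewrite /W1 /v1T yN yT'/=; ring.
Qed.

End WaveCurves.

(** * D'Alembert's formula on one edge *)

Section WaveData.
Context {R : realType}.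
Local Notation mu := (@lebesgue_measure R).
Implicit Types (I D : set R) (F G w v P Q : R -> R) (a c k l s t e x y T : R) (b : \bar R).

Lemma Ico0_right b t : Ico0 b t -> exists2 T, t < T & Ico0 b T.
Proof.
case: b => [b||] [t0 tb].
- rewrite lte_fin in tb; exists ((t + b) / 2); first lra.
  by split; [lra|rewrite lte_fin; lra].
- by exists (t + 1); [lra|split; [lra|rewrite ltry]].
- by [].
Qed.

Lemma prim_extw F w w' : sqi halfline w -> sqi halfline w' ->
  (forall x, 0 < x -> w x = w' x) -> prim F w -> prim F w'.
Proof.
move=> sw sw' E FE x x0; rewrite FE//; congr (_ + _).
rewrite -Rint_oc; last exact: sqi_locitg0.
rewrite -[RHS]Rint_oc; last exact: sqi_locitg0.
by apply: Rint_eq => y; rewrite /= in_itv/= => /andP[y0 _]; exact: E.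
Qed.

(** Real data on one edge: the incoming profile P, the initial outgoing profile Q and the boundary
    velocity v. Square integrability of v1 is asked only on [0, T] with T in [Ico0 b], which leaves
    room for blow-up at b; [wd_0] is the compatibility condition at the corner x = t = 0. *)
Record wave_data b P P1 Q Q1 v v1 : Prop := WaveData {
  wd_P : prim P P1; wd_sP : sqi halfline P; wd_sP1 : sqi halfline P1;
  wd_Q : prim Q Q1; wd_sQ : sqi halfline Q; wd_sQ1 : sqi halfline Q1;
  wd_v : forall s, Ico0 b s -> v s = v 0 + \int[mu]_(r in `[0, s]) v1 r;
  wd_sv : forall T, Ico0 b T -> sqi `[0, T] v1;
  wd_0 : v 0 + v 0 - P 0 = Q 0 }.

(** The coefficients (1/2, 1/2) give u_t and (1/2, -1/2) give u_x. Keeping k and l general treats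
    both at once: differentiation in time turns l into -l, differentiation in x leaves it. *)
Definition wv P Q v k l t x : R := k * P (x + t) + l * qt P Q v (x - t).
Definition wv1 P Q v k l t x : R := k * P (x + t) + l * qt1 P Q v (x - t).

(** Limits at time t involve only nearby times, so some T > t in the interval is fixed and the
    outgoing profile is replaced by a primitive on the whole line that agrees with it at all times s
    < T. *)
Lemma wave_data_local b P P1 Q Q1 v v1 t : wave_data b P P1 Q Q1 v v1 -> Ico0 b t ->
  exists T F w, [/\ t < T, gprim F w, sqi setT w, sqi halfline F &
    (forall s x, s < T -> 0 <= x -> F (x + -1 * s) = qt P Q v (x - s)) /\
    (forall s x, s < T -> 0 <= x -> w (x + -1 * s) = qt1 P1 Q1 v1 (x - s))].
Proof.
move=> W It; have [T tT IT] := Ico0_right It; have [t0 _] := It.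
have T0 : 0 <= T by lra.
have vE s : 0 <= s <= T -> v s = v 0 + \int[mu]_(r in `[0, s]) v1 r.
  by move=> /andP[s0 sT]; apply: (wd_v W); apply: Ico0_le IT.
have [F [w [gF sw FE]]] := qt_gprim T0 (wd_P W) (wd_sP1 W) (wd_Q W) (wd_sQ1 W)
  (wd_sv W IT) vE (wd_0 W).
exists T, F, w; split=> //.
- apply: sqi_eq (wd_sQ W); first exact: halfline_meas.
  move=> x; rewrite halflineE => x0; have [|-> _] := FE x; first by lra.
  by rewrite /qt (ltW x0).
- split=> s x sT x0; first by rewrite mulN1r; apply: (FE _ _).1; lra.
  by rewrite mulN1r; apply: (FE _ _).2; lra.
Qed.

Lemma n2_lin2 D f g k l : measurable D -> sqi D f -> sqi D g ->
  n2 D (fun x => k * f x + l * g x) <= 2 * k ^+ 2 * n2 D f + 2 * l ^+ 2 * n2 D g.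
Proof.
move=> mD sf sg.
have := n2D_le mD (sqiZ k mD sf) (sqiZ l mD sg).
by rewrite (n2Z _ mD sf) (n2Z _ mD sg) !mulrA.
Qed.

Section Curves.
Context (b : \bar R) (P P1 Q Q1 v v1 : R -> R) (W : wave_data b P P1 Q Q1 v v1).

Let gP := ext_gprim (wd_sP1 W) (wd_P W).
Let sP1 := ext0_sqi (wd_sP1 W).

Let sPc := extc_sqi (wd_sP W).

Let sPs t : 0 <= t -> sqi halfline (fun x => P (x + t)).
Proof.
move=> t0; apply: sqi_eq (shift_half_sqi t sP1 gP sPc); first exact: halfline_meas.
by move=> x; rewrite halflineE => x0; rewrite extcE//; lra.
Qed.

Let sP1s t : 0 <= t -> sqi halfline (fun x => P1 (x + t)).
Proof.
move=> t0; apply: sqi_eq (shift_sqi_half t sP1); first exact: halfline_meas.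
by move=> x; rewrite halflineE => x0; rewrite ext0E//; lra.
Qed.

Lemma wv_sqi k l t : Ico0 b t ->
  sqi halfline (wv P Q v k l t) /\ sqi halfline (wv1 P1 Q1 v1 k l t).
Proof.
move=> It; have [T [F [w [tT gF sw sF [FE wE]]]]] := wave_data_local W It.
have mh := @halfline_meas R; have [t0 _] := It.
split.
  have := sqiD mh (sqiZ k mh (sPs t0)) (sqiZ l mh (shift_half_sqi (-1 * t) sw gF sF)).
  by apply: sqi_eq => // x; rewrite halflineE => x0; rewrite /wv FE// ltW.
have := sqiD mh (sqiZ k mh (sP1s t0)) (sqiZ l mh (shift_sqi_half (-1 * t) sw)).
by apply: sqi_eq => // x; rewrite halflineE => x0; rewrite /wv1 wE// ltW.
Qed.

Lemma wv_prim k l t : Ico0 b t -> prim (wv P Q v k l t) (wv1 P1 Q1 v1 k l t).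
Proof.
move=> It; have [T [F [w [tT gF sw sF [FE wE]]]]] := wave_data_local W It.
have mh := @halfline_meas R; have [t0 _] := It.
have s1 := shift_sqi_half t sP1; have s2 := shift_sqi_half (-1 * t) sw.
have p1 := shift_prim t sP1 gP; have p2 := shift_prim (-1 * t) sw gF.
have q1 : prim (fun x => k * extc P (x + t)) (fun x => k * ext0 P1 (x + t)).
  move=> x x0; rewrite RintegralZl//; last exact: sqi_locitg0.
  by rewrite (p1 x x0); ring.
have q := primD l (sqi_locitg0 (sqiZ k mh s1)) (sqi_locitg0 s2) q1 p2.
have q' : prim (wv P Q v k l t) (fun x => k * ext0 P1 (x + t) + l * w (x + -1 * t)).
  by apply: prim_ext q => x x0; rewrite /wv FE// extcE//; lra.
apply: (prim_extw (sqiD mh (sqiZ k mh s1) (sqiZ l mh s2)) (wv_sqi k l It).2 _ q').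
by move=> x x0; rewrite /wv1 wE ?ext0E ?(ltW x0)//; lra.
Qed.

Lemma wv_tends k l t : Ico0 b t -> tends0 (Ico0 b) t (fun s => n2 halfline (fun x =>
  (s - t)^-1 * (wv P Q v k l s x - wv P Q v k l t x) - wv1 P1 Q1 v1 k (- l) t x)).
Proof.
move=> It; have [T [F [w [tT gF sw sF [FE wE]]]]] := wave_data_local W It.
have mh := @halfline_meas R; have [t0 _] := It.
have sgN : (-1 : R) ^+ 2 = 1 by rewrite sqrrN expr1n.
pose D1 s x := (s - t)^-1 * (extc P (x + 1 * s) - extc P (x + 1 * t)) - 1 * ext0 P1 (x + 1 * t).
pose D2 s x := (s - t)^-1 * (F (x + -1 * s) - F (x + -1 * t)) - -1 * w (x + -1 * t).
have sD1 s : sqi halfline (D1 s).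
  apply: (sqiB mh); last by apply: (sqiZ 1 mh); exact: shift_sqi_half.
  by apply: (sqiZ _ mh); apply: (sqiB mh); exact: (shift_half_sqi _ sP1 gP sPc).
have sD2 s : sqi halfline (D2 s).
  apply: (sqiB mh); last by apply: (sqiZ _ mh); exact: shift_sqi_half.
  by apply: (sqiZ _ mh); apply: (sqiB mh); exact: (shift_half_sqi _ sw gF sF).
have T1 := shift_tends (Ico0 b) t (expr1n R 2) sP1 gP.
have T2 := shift_tends (Ico0 b) t sgN sw gF.
have k0 : 0 <= 2 * k ^+ 2 by rewrite mulr_ge0// sqr_ge0.
have l0 : 0 <= 2 * l ^+ 2 by rewrite mulr_ge0// sqr_ge0.
move=> e e0; have [r r0 Hr] := tends0D (tends0Z k0 T1) (tends0Z l0 T2) e0.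
(* The second bound keeps s below T, where the whole-line profile still represents the wave. *)
exists (Num.min r (T - t)); first by rewrite lt_min r0 subr_gt0.
move=> s Is st; rewrite lt_min => /andP[sr sT].
apply: le_trans (Hr s Is st sr); apply: le_trans (n2_lin2 k l mh (sD1 s) (sD2 s)).
have [s0 _] := Is; have sT' : s < T by move: sT; rewrite ltr_norml; lra.
rewrite le_eqVlt; apply/orP; left; apply/eqP; apply: n2_eq => x; rewrite halflineE => x0.
have x0' := ltW x0.
rewrite /D1 /D2 /wv /wv1 !FE// !wE// !mul1r !extcE ?ext0E; [|lra|lra|lra].
ring.
Qed.

Lemma wv1_cont k l t e : Ico0 b t -> 0 < e -> exists2 r, 0 < r & forall s, Ico0 b s ->
  `|s - t| < r -> n2 halfline (fun x => wv1 P1 Q1 v1 k l s x - wv1 P1 Q1 v1 k l t x) <= e.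
Proof.
move=> It e0; have [T [F [w [tT gF sw sF [FE wE]]]]] := wave_data_local W It.
have mh := @halfline_meas R; have [t0 _] := It.
have sgN : (-1 : R) ^+ 2 = 1 by rewrite sqrrN expr1n.
pose M := 2 * k ^+ 2 + 2 * l ^+ 2 + 1.
have k0 : 0 <= k ^+ 2 by exact: sqr_ge0.
have l0 : 0 <= l ^+ 2 by exact: sqr_ge0.
have M0 : 0 < M by rewrite /M; lra.
have eM : 0 < e / M by rewrite divr_gt0.
have [r1 r10 H1] := shift_cont t sP1 (expr1n R 2) eM.
have [r2 r20 H2] := shift_cont t sw sgN eM.
exists (Num.min (Num.min r1 r2) (T - t)); first by rewrite !lt_min r10 r20 subr_gt0.
move=> s Is; rewrite !lt_min => /andP[/andP[sr1 sr2] sT].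
have [S1 E1] := H1 s sr1; have [S2 E2] := H2 s sr2.
have sub (f : R -> R) : sqi setT f -> sqi halfline f by exact: (sqiS mh measurableT (@subsetT _ _)).
have := n2_lin2 k l mh (sub _ S1) (sub _ S2).
have [s0 _] := Is; have sT' : s < T by move: sT; rewrite ltr_norml; lra.
rewrite (n2_eq (g := fun x => wv1 P1 Q1 v1 k l s x - wv1 P1 Q1 v1 k l t x)); last first.
  move=> x; rewrite halflineE => x0; have x0' := ltW x0.
  by rewrite /wv1 !wE// !mul1r !ext0E; [ring|lra|lra].
move=> /le_trans; apply.
have K1 : 2 * k ^+ 2 * n2 halfline (fun x => ext0 P1 (x + 1 * s) - ext0 P1 (x + 1 * t)) <= 2 * k ^+ 2 * (e / M).
  by apply: ler_wpM2l => //; lra.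
have K2 : 2 * l ^+ 2 * n2 halfline (fun x => w (x + -1 * s) - w (x + -1 * t)) <= 2 * l ^+ 2 * (e / M).
  by apply: ler_wpM2l => //; lra.
apply: (le_trans (lerD K1 K2)); rewrite -mulrDl.
rewrite mulrA ler_pdivrMr// mulrC ler_wpM2l ?ltW// /M; lra.
Qed.

End Curves.

Lemma tends_cont I (A : R -> R -> R) B t e : I t -> (forall s, I s -> sqi halfline (A s)) ->
  sqi halfline B ->
  tends0 I t (fun s => n2 halfline (fun x => (s - t)^-1 * (A s x - A t x) - B x)) ->
  0 < e -> exists2 r, 0 < r & forall s, I s ->
  `|s - t| < r -> n2 halfline (fun x => A s x - A t x) <= e.
Proof.
move=> It sA sB H e0; have mh := @halfline_meas R.
have [r r0 Hr] := H 1 ltr01; pose M := 2 * n2 halfline B + 2.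
have nB := n2_ge0 halfline B; have M0 : 0 < M by rewrite /M; lra.
pose d := Num.min 1 (e / M); have d0 : 0 < d by rewrite lt_min ltr01 divr_gt0.
exists (Num.min r d); first by rewrite lt_min r0.
move=> s Is; rewrite lt_min => /andP[sr sd].
have [->|st] := eqVneq s t.
  rewrite (n2_eq (g := fun=> 0)); last by move=> x _; rewrite subrr.
  rewrite (_ : n2 _ _ = 0) ?ltW// /n2 (_ : (fun=> _) = fun=> 0) ?Rintegral_cst ?mul0r//.
  by apply/funext => x; rewrite expr0n.
have := Hr s Is st sr; set D := (fun x => _ - B x) => HD.
have st0 : s - t != 0 by rewrite subr_eq0.
have sD : sqi halfline D by apply: (sqiB mh) => //; apply: (sqiZ _ mh); apply: (sqiB mh); exact: sA.
rewrite (n2_eq (g := fun x => (s - t) * (B x + D x))); last first.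
  by move=> x _; rewrite /D; field.
rewrite n2Z//; last exact: sqiD.
have K := n2D_le mh sB sD.
have K2 : n2 halfline (fun x => B x + D x) <= M by rewrite /M; lra.
have [d1 d2] : `|s - t| <= 1 /\ `|s - t| <= e / M.
  by move: (ltW sd); rewrite le_min => /andP[].
rewrite -real_normK ?num_real// expr2.
have n0 := normr_ge0 (s - t).
have K3 : `|s - t| * `|s - t| <= e / M.
  by apply: le_trans d2; rewrite ler_piMr.
apply: (le_trans (ler_pM _ (n2_ge0 _ _) K3 K2)); first exact: mulr_ge0.
by rewrite divfK// gt_eqF.
Qed.

End WaveData.

(** * From curves in L^2 to curves of graph functions *)

Section BuildSolution.
Context {R : realType} {N : nat}.
Local Notation mu := (@lebesgue_measure R).
Local Notation C := R[i].
Implicit Types (I : set R) (t s e r : R) (b : \bar R) (A B D : R -> graph_fun R N)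
  (f g h u v : graph_fun R N) (p : bool) (j k : 'I_N) (alpha : C) (sg : R).

Lemma nsqL2GE u : L2G u ->
  nsqL2G u = (\sum_j (n2 halfline (pt false (u j)) + n2 halfline (pt true (u j))))%:E.
Proof.
move=> Lu; rewrite /nsqL2G -sumEFin; apply: eq_bigr => j _; exact: normL2sqE (Lu j).
Qed.

Lemma tends0_sum I t (T : finType) (a : T -> R -> R) : (forall i, tends0 I t (a i)) ->
  tends0 I t (fun s => \sum_i a i s).
Proof.
move=> H; elim: (index_enum T) => [|i l IH].
  move=> e e0; exists 1 => // s _ _ _; rewrite big_nil; exact: ltW.
apply: tends0_le (tends0D (H i) IH) => s _.
by rewrite big_cons.
Qed.

Lemma parts_tendsE I t D : (forall s, I s -> L2G (D s)) ->
  (forall j p, tends0 I t (fun s => n2 halfline (pt p (D s j)))) ->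
  tendsE I t (fun s => nsqL2G (D s)).
Proof.
move=> LD H e e0.
have [r r0 Hr] := tends0_sum (fun j => tends0D (H j false) (H j true)) e0.
exists r => // s Is st sr; rewrite (nsqL2GE (LD s Is)) lee_fin.
exact: Hr.
Qed.

Lemma within_of_tends I t (f : R -> \bar R) : (forall s, (0 <= f s)%E) -> f t = 0%E ->
  tendsE I t f -> f s @[s --> within I (nbhs t)] --> 0%E.
Proof.
move=> f0 ft H; apply/cvg0_within => // e e0; have [r r0 Hr] := H e e0.
exists r => // s Is sr; have [->|st] := eqVneq s t; first by rewrite ft lee_fin ltW.
exact: Hr.
Qed.

Lemma nsqL2G_diffxx u : L2G u -> nsqL2G (diffG u u) = 0%E.
Proof.
move=> Lu; rewrite nsqL2GE; last by move=> j; exact: L2B (Lu j) (Lu j).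
congr EFin; apply: big1 => j _.
have E p : n2 halfline (pt p (diffG u u j)) = 0.
  rewrite (n2_eq (g := fun=> 0)); last by move=> x _; rewrite /pt /diffG subrr part0.
  rewrite /n2 (_ : (fun=> _) = fun=> 0) ?Rintegral_cst ?mul0r//; first exact: halfline_meas.
  by apply/funext => x; rewrite expr0n.
by rewrite !E addr0.
Qed.

Definition tendsL2 I A t v : Prop := forall j p, tends0 I t
  (fun s => n2 halfline (fun x => (s - t)^-1 * (pt p (A s j) x - pt p (A t j) x) - pt p (v j) x)).

Lemma L2_tderiv I A t v : I t -> (forall s, I s -> L2G (A s)) -> L2G v ->
  tendsL2 I A t v -> is_tderiv nsqL2G I A t v.
Proof.
move=> It LA Lv H; apply/is_tderivP; first exact: nsqL2G_ge0.
apply: parts_tendsE => [s Is|j p]; first exact: L2G_quot (LA s Is) (LA t It) Lv.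
by apply: tends0_le (H j p) => s Is; rewrite pt_quot.
Qed.

Lemma tendsL2_ae I A A' t v v' : I t -> (forall s, I s -> L2G (A s)) -> L2G v ->
  (forall s, I s -> L2G (A' s)) -> L2G v' ->
  (forall s, I s -> forall j, ae_eq_half (A s j) (A' s j)) ->
  (forall j, ae_eq_half (v j) (v' j)) -> tendsL2 I A t v -> tendsL2 I A' t v'.
Proof.
move=> It LA Lv LA' Lv' AA vv H j p; have mh := @halfline_meas R.
have sq (z : R -> C) : L2 z -> sqi halfline (pt p z) by move=> /L2P; exact.
apply: tends0_le (H j p) => s Is; rewrite le_eqVlt; apply/orP; left; apply/eqP.
apply: (n2_ae mh).
- exact: (proj1 (sqiB mh (sqiZ _ mh (sqiB mh (sq _ (LA' s Is j)) (sq _ (LA' t It j)))) (sq _ (Lv' j)))).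
- exact: (proj1 (sqiB mh (sqiZ _ mh (sqiB mh (sq _ (LA s Is j)) (sq _ (LA t It j)))) (sq _ (Lv j)))).
have /ae_eq_halfP/(_ p) E1 := AA s Is j; have /ae_eq_halfP/(_ p) E2 := AA t It j.
have /ae_eq_halfP/(_ p) E3 := vv j.
by apply: ae_imp (ae_and (ae_and E1 E2) E3) => x [[H1 H2] H3] x0; rewrite (H1 x0) (H2 x0) (H3 x0).
Qed.

(** Every point of [Ico0 b] has points of the interval to its right, so a derivative in norm is
    unique. This identifies the values chosen in [dt] and [dtt]. *)
Lemma tendsL2_uniq b A t v v' : Ico0 b t -> (forall s, Ico0 b s -> L2G (A s)) ->
  L2G v -> L2G v' -> tendsL2 (Ico0 b) A t v -> tendsL2 (Ico0 b) A t v' ->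
  forall j, ae_eq_half (v j) (v' j).
Proof.
move=> It LA Lv Lv' H H' j; apply/ae_eq_halfP => p; have mh := @halfline_meas R.
have sq (z : R -> C) : L2 z -> sqi halfline (pt p z) by move=> /L2P; exact.
have sv := sq _ (Lv j); have sv' := sq _ (Lv' j).
suff : {ae mu, forall x, halfline x -> pt p (v j) x - pt p (v' j) x = 0}.
  by apply: ae_imp => x E /E /eqP; rewrite subr_eq0 => /eqP.
apply: (n2_eq0 mh (sqiB mh sv sv')).
apply: (@small_eq0 _ _ 4) => e e0; rewrite ger0_norm ?n2_ge0//.
have [r r0 Hr] := H j p e e0; have [r' r'0 Hr'] := H' j p e e0.
have [T tT IT] := Ico0_right It.
(* s = t + d/2 lies within both radii and stays inside the time interval. *)
pose d := Num.min (Num.min r r') (T - t); have d0 : 0 < d by rewrite !lt_min r0 r'0 subr_gt0.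
pose s := t + d / 2; have d2 : 0 < d / 2 by rewrite divr_gt0.
have st : s - t = d / 2 by rewrite /s; ring.
have Is : Ico0 b s.
  apply: (Ico0_le _ _ IT); first by case: It => t0 _; rewrite /s; lra.
  have : d <= T - t by rewrite ge_min lexx orbT.
  by rewrite /s; lra.
have sNt : s != t by rewrite -subr_eq0 st gt_eqF.
have dd : `|s - t| < d by rewrite st ger0_norm; lra.
have [sr sr'] : `|s - t| < r /\ `|s - t| < r'.
  by move: dd; rewrite !lt_min => /andP[/andP[-> ->]].
have sQ := sqiZ (s - t)^-1 mh (sqiB mh (sq _ (LA s Is j)) (sq _ (LA t It j))).
pose q x := (s - t)^-1 * (pt p (A s j) x - pt p (A t j) x).
have K : n2 halfline (fun x => pt p (v j) x - pt p (v' j) x) <=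
    2 * n2 halfline (fun x => q x - pt p (v' j) x) + 2 * n2 halfline (fun x => q x - pt p (v j) x).
  rewrite (n2_eq (g := fun x => (q x - pt p (v' j) x) - (q x - pt p (v j) x))); last first.
    by move=> x _; ring.
  exact: n2B_le mh (sqiB mh sQ sv') (sqiB mh sQ sv).
have K1 := Hr s Is sNt sr; have K2 := Hr' s Is sNt sr'.
by move: K K1 K2; rewrite /q; lra.
Qed.

(** Restricted to ]0, 1/e], a constant c has squared norm c^2 / e, which is bounded independently of
    e. This removes the additive constant left undetermined by the quotient norm. *)
Lemma L2_cst0 (c : C) : L2 (fun=> c) -> c = 0.
Proof.
move=> /L2P H; apply: part_eq => p; rewrite part0; apply/eqP; rewrite -sqrf_eq0; apply/eqP.
have mh := @halfline_meas R; have sc := H p.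
apply: (@small_eq0 _ _ (n2 halfline (pt p (fun=> c)))) => e e0.
rewrite ger0_norm ?sqr_ge0//.
have mE : measurable (`]0%R, e^-1]%classic : set R) by exact: measurable_itv.
have e1 : 0 < e^-1 by rewrite invr_gt0.
have sub : `]0%R, e^-1]%classic `<=` @halfline R.
  by move=> x; rewrite halflineE /= in_itv/= => /andP[].
have := n2S mE mh sub sc; rewrite {1}/n2 /pt Rintegral_cst//.
have -> : fine (mu (`]0%R, e^-1]%classic : set R)) = e^-1.
  by rewrite lebesgue_measure_itv/= lte_fin e1 sube0.
by rewrite ler_pdivrMr.
Qed.

(** Recovers u from u_x. Modulo constants nothing is lost by letting all edges vanish at the vertex,
    and continuity there becomes automatic. *)
Definition primG u : graph_fun R N := fun j x =>
  ((\int[mu]_(y in `[0, x]) complex.Re (u j y)) +i* (\int[mu]_(y in `[0, x]) complex.Im (u j y)))%C.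

Lemma primG0 u j : primG u j 0 = 0.
Proof. by rewrite /primG set_itv1 !Rintegral_set1. Qed.

Lemma primG_cprim u j : cprim (primG u j) (u j).
Proof. by move=> p x x0; rewrite /pt primG0 part0 add0r; case: p. Qed.

Lemma primG_wderiv u j : L2 (u j) -> is_wderiv 1 (primG u j) (u j).
Proof. by move=> Lu; exact: cprim_is_wderiv Lu (@primG_cprim u j). Qed.

Lemma primG_dotH1G u : L2G u -> dotH1G (primG u).
Proof.
move=> Lu; have refl (z : R -> C) : ae_eq_half z z by apply: ae_all.
have c0 j : crep (primG u j) 0 = 0.
  by rewrite (crep_prim (Lu j) (@primG_cprim u j) (refl _) (lexx 0)) primG0.
split; last by move=> j k; rewrite !c0.
by move=> j; exists (u j); split; [exact: primG_wderiv (Lu j)|exact: Lu].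
Qed.

(** The wave problem as a first-order system: U = u_x, V = u_t, W = u_xx = u_tt and Z = u_tx, with
    U_t = V_x = Z and V_t = U_x = W. The function u is absent, being recovered from U by [primG]. *)
Record wave_curves b alpha f g (U V W Z : R -> graph_fun R N) : Prop := WaveCurves {
  wc_U : forall t, Ico0 b t -> L2G (U t);
  wc_V : forall t, Ico0 b t -> L2G (V t);
  wc_W : forall t, Ico0 b t -> L2G (W t);
  wc_Z : forall t, Ico0 b t -> L2G (Z t);
  wc_UW : forall t j, Ico0 b t -> cprim (U t j) (W t j);
  wc_VZ : forall t j, Ico0 b t -> cprim (V t j) (Z t j);
  wc_dU : forall t, Ico0 b t -> tendsL2 (Ico0 b) U t (Z t);
  wc_dV : forall t, Ico0 b t -> tendsL2 (Ico0 b) V t (W t);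
  wc_cU : forall t j p, Ico0 b t -> tends0 (Ico0 b) t
    (fun s => n2 halfline (fun x => pt p (U s j) x - pt p (U t j) x));
  wc_cV : forall t j p, Ico0 b t -> tends0 (Ico0 b) t
    (fun s => n2 halfline (fun x => pt p (V s j) x - pt p (V t j) x));
  wc_cW : forall t j p, Ico0 b t -> tends0 (Ico0 b) t
    (fun s => n2 halfline (fun x => pt p (W s j) x - pt p (W t j) x));
  wc_cZ : forall t j p, Ico0 b t -> tends0 (Ico0 b) t
    (fun s => n2 halfline (fun x => pt p (Z s j) x - pt p (Z t j) x));
  wc_v0 : forall t j k, Ico0 b t -> V t j 0 = V t k 0;
  wc_vertex : forall t k, Ico0 b t -> \sum_j U t j 0 + alpha * V t k 0 = 0;
  wc_f : forall j, ae_eq_half (U 0 j) (derivG 1 f j);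
  wc_g : forall j, ae_eq_half (V 0 j) (g j) }.

End BuildSolution.

(** * Curves solving the first-order system give solutions *)

Section CurvesSolve.
Context {R : realType} {N : nat}.
Local Notation mu := (@lebesgue_measure R).
Local Notation C := R[i].
Implicit Types (I : set R) (t s e r : R) (A B D : R -> graph_fun R N)
  (h u v w : graph_fun R N) (p : bool) (j k : 'I_N) (sg : R).

Lemma tendsED I t (a c : R -> \bar R) : tendsE I t a -> tendsE I t c ->
  tendsE I t (fun s => (a s + c s)%E).
Proof.
move=> Ha Hc e e0; have e2 : 0 < e / 2 by rewrite divr_gt0.
have [r r0 Hr] := Ha _ e2; have [r' r'0 Hr'] := Hc _ e2.
exists (Num.min r r'); first by rewrite lt_min r0.
move=> s Is st; rewrite lt_min => /andP[sr sr'].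
by rewrite [e]splitr EFinD; apply: leeD; [exact: Hr|exact: Hr'].
Qed.

Lemma nsqL2G_deriv_diff (k : nat) u v w w' : (forall j, is_wderiv k (u j) (w j)) ->
  (forall j, is_wderiv k (v j) (w' j)) -> L2G w -> L2G w' ->
  nsqL2G (derivG k (diffG u v)) = nsqL2G (diffG w w').
Proof.
move=> Hu Hv Lw Lw'; apply: eq_bigr => j _.
exact: (normL2sq_wderiv (is_wderivB (Hu j) (Hv j)) (L2B (Lw j) (Lw' j))).
Qed.

Lemma nsqL2G_ae_diff u v u' v' : L2G u -> L2G v -> L2G u' -> L2G v' ->
  (forall j, ae_eq_half (u j) (u' j)) -> (forall j, ae_eq_half (v j) (v' j)) ->
  nsqL2G (diffG u v) = nsqL2G (diffG u' v').
Proof.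
move=> Lu Lv Lu' Lv' Eu Ev; apply: eq_bigr => j _.
apply: (normL2sq_ae (L2B (Lu j) (Lv j)) (L2B (Lu' j) (Lv' j))).
by apply: ae_imp (ae_and (Eu j) (Ev j)) => x [E1 E2] x0; rewrite /diffG (E1 x0) (E2 x0).
Qed.

Lemma tendsE_diff I A t : I t -> (forall s, I s -> L2G (A s)) ->
  (forall j p, tends0 I t (fun s => n2 halfline (fun x => pt p (A s j) x - pt p (A t j) x))) ->
  tendsE I t (fun s => nsqL2G (diffG (A s) (A t))).
Proof.
move=> It LA H; apply: parts_tendsE => [s Is j|j p]; first exact: (L2B (LA s Is j) (LA t It j)).
by apply: tends0_le (H j p) => s Is; rewrite /diffG pt_B.
Qed.

Section Build.
Context (b : \bar R) (alpha : C) (f g : graph_fun R N) (U V W Z : R -> graph_fun R N).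
Hypotheses (N0 : (0 < N)%N) (b0 : (0 < b)%E) (Hf : dotH1G f) (H : wave_curves b alpha f g U V W Z).
Local Notation I := (Ico0 b).

Definition curve_sol t : graph_fun R N := primG (U t).
Local Notation u := curve_sol.

Let d1 t j : I t -> is_wderiv 1 (u t j) (U t j).
Proof. by move=> It; exact: (primG_wderiv (wc_U H It j)). Qed.

Let dU t j : I t -> is_wderiv 1 (U t j) (W t j).
Proof. by move=> It; exact: (cprim_is_wderiv (wc_W H It j) (wc_UW H j It)). Qed.

Let dV t j : I t -> is_wderiv 1 (V t j) (Z t j).
Proof. by move=> It; exact: (cprim_is_wderiv (wc_Z H It j) (wc_VZ H j It)). Qed.

Let d2 t j : I t -> is_wderiv 2 (u t j) (W t j).
Proof.
move=> It; have /is_wderivP H1 := d1 j It; have /is_wderivP H2 := dU j It.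
by apply/is_wderivP => p; exact: (rwd1_2 (H1 p) (H2 p)).
Qed.

Let space t : I t -> tH1dotH2G (u t).
Proof.
move=> It; split; first exact: (primG_dotH1G (wc_U H It)).
by move=> j; exists (W t j); split; [exact: d2|exact: (wc_W H It j)].
Qed.

Let e1 t j : I t -> ae_eq_half (derivG 1 (u t) j) (U t j).
Proof. by move=> It; exact: (wderivP (d1 j It)).2. Qed.

Let e2 t j : I t -> ae_eq_half (derivG 2 (u t) j) (W t j).
Proof. by move=> It; exact: (wderivP (d2 j It)).2. Qed.

Let refl (z : R -> C) : ae_eq_half z z.
Proof. by apply: ae_all. Qed.

Let HV t : I t -> H1G (V t).
Proof.
move=> It; split.
  move=> j; split; first exact: (wc_V H It j).
  by exists (Z t j); split; [exact: dV|exact: (wc_Z H It j)].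
have E j : crep (V t j) 0 = V t j 0.
  exact: (crep_prim (wc_Z H It j) (wc_VZ H j It) (refl _) (lexx 0)).
by move=> j k; rewrite !E; exact: (wc_v0 H).
Qed.

Let Ld1 t : I t -> L2G (derivG 1 (u t)).
Proof. by move=> It j; have [] := dotH_wderiv ((space It).1.1 j). Qed.

Let LdV t : I t -> L2G (derivG 1 (V t)).
Proof. by move=> It j; have [] := dotH_wderiv ((HV It).1 j).2. Qed.

Let eV t j : I t -> ae_eq_half (derivG 1 (V t) j) (Z t j).
Proof. by move=> It; exact: (wderivP (dV j It)).2. Qed.

Let du t : I t -> tendsL2 I (fun s => derivG 1 (u s)) t (derivG 1 (V t)).
Proof.
move=> It; apply: (tendsL2_ae It (wc_U H) (wc_Z H It) Ld1 (LdV It) _ _ (wc_dU H It)).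
  by move=> s Is j; exact: (ae_eq_half_sym (e1 j Is)).
by move=> j; exact: (ae_eq_half_sym (eV j It)).
Qed.

Let HuV t : I t -> is_tderiv nsq_tH1G I u t (V t).
Proof.
move=> It; apply/(tderiv_tH1 It).
- by move=> s Is j; exact: ((space Is).1.1 j).
- by move=> j; exact: ((HV It).1 j).2.
- exact: (L2_tderiv It Ld1 (LdV It) (du It)).
Qed.

Let dtP t : I t -> H1G (dt I u t) /\ is_tderiv nsq_tH1G I u t (dt I u t).
Proof.
move=> It; exact: (xgetI (P := [set v | H1G v /\ is_tderiv nsq_tH1G I u t v])
  (fun _ _ => 0) (conj (HV It) (HuV It))).
Qed.

(** [dt] and V are both derivatives of u for the quotient norm, so their space derivatives agree and
    they differ by a constant; as both are square integrable, that constant is 0. *)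
Lemma curve_sol_dt t j : I t -> ae_eq_half (dt I u t j) (V t j).
Proof.
move=> It; have [Hd Dd] := dtP It; have HVt := HV It.
have dd k : dotH 1 (dt I u t k) by exact: (Hd.1 k).2.
have Ld : L2G (derivG 1 (dt I u t)) by move=> k; have [] := dotH_wderiv (dd k).
have Dd' := (tderiv_tH1 It (fun s Is k => (space Is).1.1 k) dd).1 Dd.
have T' : tendsL2 I (fun s => derivG 1 (u s)) t (derivG 1 (dt I u t)).
  exact: (tderiv_L2 It Ld1 Ld Dd').
have E := tendsL2_uniq It Ld1 Ld (LdV It) T' (du It).
have D1 : dotH1G (dt I u t) by split; [exact: dd|exact: Hd.2].
have D2 : dotH1G (V t) by split; [by move=> k; exact: (HVt.1 k).2|exact: HVt.2].
have [c Ec] := eq_deriv_mod_cst N0 D1 D2 E.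
have mc : cmeasurable (fun=> c) by have [] := is_wderiv_meas (is_wderiv_cst c).
have c0 := L2_cst0 (L2_ae (L2B (Hd.1 j).1 (HVt.1 j).1) mc (Ec j)).
by apply: ae_imp (Ec j) => x Ex x0; have /eqP := Ex x0; rewrite c0 subr_eq0 => /eqP.
Qed.

Lemma curve_sol_deriv t j : I t -> ae_eq_half (derivG 1 (u t) j) (U t j).
Proof. exact: e1. Qed.

Let Ldt t : I t -> L2G (dt I u t).
Proof. by move=> It j; have [Hd _] := dtP It; exact: (Hd.1 j).1. Qed.

Let ddt t : I t -> tendsL2 I (dt I u) t (W t).
Proof.
move=> It; apply: (tendsL2_ae It (wc_V H) (wc_W H It) Ldt (wc_W H It) _ _ (wc_dV H It)).
  by move=> s Is j; exact: (ae_eq_half_sym (curve_sol_dt j Is)).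
by move=> j; exact: refl.
Qed.

Let dttP t : I t -> L2G (dtt I u t) /\ is_tderiv nsqL2G I (dt I u) t (dtt I u t).
Proof.
move=> It; have K := L2_tderiv It Ldt (wc_W H It) (ddt It).
exact: (xgetI (P := [set w | L2G w /\ is_tderiv nsqL2G I (dt I u) t w])
  (fun _ _ => 0) (conj (wc_W H It) K)).
Qed.

Let e3 t j : I t -> ae_eq_half (dtt I u t j) (W t j).
Proof.
move=> It; have [Ld Dd] := dttP It.
exact: (tendsL2_uniq It Ldt Ld (wc_W H It) (tderiv_L2 It Ldt Ld Dd) (ddt It) j).
Qed.

Let dZ t j : I t -> is_wderiv 1 (dt I u t j) (Z t j).
Proof.
move=> It; have [m _] := is_wderiv_meas (dotH_wderiv ((dtP It).1.1 j).2).1.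
have [_ mZ] := is_wderiv_meas (dV j It).
exact: (is_wderiv_ae (dV j It) m mZ (ae_eq_half_sym (curve_sol_dt j It)) (refl _)).
Qed.

Lemma curve_solP : solution I alpha f g u.
Proof.
have I0 : I 0 by split; [exact: lexx|exact: b0].
split.
- exact: space.
- move=> t It; apply: within_of_tends.
  + by move=> s; rewrite adde_ge0// nsqL2G_ge0.
  + rewrite /nsq_tH1dotH2G.
    rewrite (nsqL2G_deriv_diff (fun j => d1 j It) (fun j => d1 j It) (wc_U H It) (wc_U H It)).
    rewrite (nsqL2G_deriv_diff (fun j => d2 j It) (fun j => d2 j It) (wc_W H It) (wc_W H It)).
    by rewrite (nsqL2G_diffxx (wc_U H It)) (nsqL2G_diffxx (wc_W H It)) adde0.
  + have T1 := tendsE_diff It (wc_U H) (fun j p => wc_cU H j p It).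
    have T2 := tendsE_diff It (wc_W H) (fun j p => wc_cW H j p It).
    apply: (tendsE_eq _ (tendsED T1 T2)) => s Is; rewrite /nsq_tH1dotH2G.
    rewrite (nsqL2G_deriv_diff (fun j => d1 j Is) (fun j => d1 j It) (wc_U H Is) (wc_U H It)).
    by rewrite (nsqL2G_deriv_diff (fun j => d2 j Is) (fun j => d2 j It) (wc_W H Is) (wc_W H It)).
- exact: dtP.
- move=> t It; apply: within_of_tends.
  + by move=> s; rewrite adde_ge0// nsqL2G_ge0.
  + rewrite /nsqH1G.
    rewrite (nsqL2G_deriv_diff (fun j => dZ j It) (fun j => dZ j It) (wc_Z H It) (wc_Z H It)).
    by rewrite (nsqL2G_diffxx (Ldt It)) (nsqL2G_diffxx (wc_Z H It)) adde0.
  + have T1 := tendsE_diff It (wc_V H) (fun j p => wc_cV H j p It).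
    have T2 := tendsE_diff It (wc_Z H) (fun j p => wc_cZ H j p It).
    apply: (tendsE_eq _ (tendsED T1 T2)) => s Is; rewrite /nsqH1G.
    rewrite (nsqL2G_deriv_diff (fun j => dZ j Is) (fun j => dZ j It) (wc_Z H Is) (wc_Z H It)).
    by rewrite (nsqL2G_ae_diff (Ldt Is) (Ldt It) (wc_V H Is) (wc_V H It)
      (fun j => curve_sol_dt j Is) (fun j => curve_sol_dt j It)).
- exact: dttP.
- move=> t It; apply: within_of_tends; first by move=> s; exact: nsqL2G_ge0.
  + exact: (nsqL2G_diffxx (dttP It).1).
  + apply: (tendsE_eq _ (tendsE_diff It (wc_W H) (fun j p => wc_cW H j p It))) => s Is.
    by rewrite (nsqL2G_ae_diff (dttP Is).1 (dttP It).1 (wc_W H Is) (wc_W H It)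
      (fun j => e3 j Is) (fun j => e3 j It)).
- by move=> t It j; exact: (ae_eq_half_trans (e3 j It) (ae_eq_half_sym (e2 j It))).
- by move=> t It; exact: (space It).1.2.
- move=> t It k.
  rewrite (crep_prim (wc_Z H It k) (wc_VZ H k It) (curve_sol_dt k It) (lexx 0)).
  rewrite -[RHS](wc_vertex H k It); congr (_ + _); apply: eq_bigr => j _.
  exact: (crep_prim (wc_W H It j) (wc_UW H j It) (e1 j It) (lexx 0)).
- split.
    apply: (eq_deriv_mod_cst N0 (space I0).1 Hf) => j.
    exact: (ae_eq_half_trans (e1 j I0) (wc_f H j)).
  by move=> j; exact: (ae_eq_half_trans (curve_sol_dt j I0) (wc_g H j)).
Qed.

Lemma curve_sol_energy t : I t -> energy I u t =
  (\sum_j (n2 halfline (pt false (V t j)) + n2 halfline (pt true (V t j)) +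
           (n2 halfline (pt false (U t j)) + n2 halfline (pt true (U t j)))))%:E.
Proof.
move=> It; rewrite /energy big_split/= EFinD -(nsqL2GE (wc_V H It)) -(nsqL2GE (wc_U H It)).
congr (_ + _)%E; apply: eq_bigr => j _.
  exact: (normL2sq_ae (Ldt It j) (wc_V H It j) (curve_sol_dt j It)).
exact: (normL2sq_ae (Ld1 It j) (wc_U H It j) (e1 j It)).
Qed.

End Build.
End CurvesSolve.

(** * D'Alembert curves on the star graph for a given vertex velocity *)

Section DAlembert.
Context {R : realType} {N : nat}.
Local Notation mu := (@lebesgue_measure R).
Local Notation C := R[i].
Implicit Types (I : set R) (t s e r x : R) (h u w : graph_fun R N) (p : bool) (j k : 'I_N).

Definition of_parts (F : bool -> R -> R) : R -> C := fun x => (F false x +i* F true x)%C.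

Lemma pt_of_parts p (F : bool -> R -> R) : pt p (of_parts F) = F p.
Proof. by case: p. Qed.

Lemma L2_of_parts (F : bool -> R -> R) : (forall p, sqi halfline (F p)) -> L2 (of_parts F).
Proof. by move=> H; apply/L2P => p; rewrite pt_of_parts. Qed.

Lemma cprimD (A B A' B' : R -> C) : cprim A B -> cprim A' B' -> L2 B -> L2 B' ->
  cprim (fun x => A x + A' x) (fun x => B x + B' x).
Proof.
move=> H H' /L2P L /L2P L' p x x0; rewrite !pt_D (H p x x0) (H' p x x0).
by rewrite RintD//; [ring|exact: sqi_locitg0|exact: sqi_locitg0].
Qed.

Lemma cprimB (A B A' B' : R -> C) : cprim A B -> cprim A' B' -> L2 B -> L2 B' ->
  cprim (fun x => A x - A' x) (fun x => B x - B' x).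
Proof.
move=> H H' /L2P L /L2P L' p x x0; rewrite !pt_B (H p x x0) (H' p x x0).
by rewrite RintegralB//; [ring|exact: sqi_locitg0|exact: sqi_locitg0].
Qed.

Lemma crep_L2 (A B : R -> C) : is_wderiv 1 A B -> L2 A -> L2 B ->
  cprim (crep A) B /\ L2 (crep A).
Proof.
move=> D LA LB; have [P E] := is_wderiv_crep D LB; split=> //.
by apply: L2_ae LA _ E; have [] := is_wderiv_meas (cprim_is_wderiv LB P).
Qed.

Lemma wv_0 b P P1 Q Q1 v v1 (k l t : R) : @wave_data R b P P1 Q Q1 v v1 -> 0 <= t ->
  wv P Q v k l t 0 = k * P t + l * (v t + v t - P t).
Proof.
move=> Wd t0; rewrite /wv /qt add0r sub0r opprK.
(* Only t = 0 falls in the branch of [qt] that returns Q, where the corner condition gives the same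
   value. *)
case: ifPn => // H; have -> : t = 0 by move: H; rewrite oppr_ge0; lra.
by rewrite oppr0 (wd_0 Wd).
Qed.

Lemma wv_at0 (P Q v : R -> R) (k l x : R) : 0 <= x -> wv P Q v k l 0 x = k * P x + l * Q x.
Proof. by move=> x0; rewrite /wv addr0 subr0 /qt x0. Qed.

Section Solve.
Context (b : \bar R) (alpha : C) (f g : graph_fun R N) (v v1 : R -> C).
Hypotheses (N0 : (0 < N)%N) (b0 : (0 < b)%E) (Hf : tH1dotH2G f) (Hg : H1G g).
Hypothesis v_int : forall p s, Ico0 b s ->
  pt p v s = pt p v 0 + \int[mu]_(r in `[0, s]) pt p v1 r.
Hypothesis v1_sqi : forall p T, Ico0 b T -> sqi `[0, T] (pt p v1).
Hypothesis v_g : forall j, v 0 = crep (g j) 0.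
Hypothesis v_sum : forall t, Ico0 b t -> \sum_j inc f g j t = (N%:R - alpha) * v t.
Local Notation I := (Ico0 b).

Definition out f g j : R -> C := fun x => crep (g j) x - crep (derivG 1 f j) x.
Definition inc1 f g : graph_fun R N := fun j x => derivG 2 f j x + derivG 1 g j x.
Definition out1 f g : graph_fun R N := fun j x => derivG 1 g j x - derivG 2 f j x.

Lemma inc_prim j : [/\ cprim (inc f g j) (inc1 f g j), L2 (inc f g j) & L2 (inc1 f g j)].
Proof.
have [Df Lf Dff Lff] := tH1dotH2_deriv j Hf; have [Lg Dg Lgx] := H1G_deriv j Hg.
have [Pf cLf] := crep_L2 Dff Lf Lff; have [Pg cLg] := crep_L2 Dg Lg Lgx.
by split; [exact: cprimD|exact: L2D|exact: L2D].
Qed.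

Lemma out_prim j : [/\ cprim (out f g j) (out1 f g j), L2 (out f g j) & L2 (out1 f g j)].
Proof.
have [Df Lf Dff Lff] := tH1dotH2_deriv j Hf; have [Lg Dg Lgx] := H1G_deriv j Hg.
have [Pf cLf] := crep_L2 Dff Lf Lff; have [Pg cLg] := crep_L2 Dg Lg Lgx.
by split; [exact: cprimB|exact: L2B|exact: L2B].
Qed.

Lemma wave_dataP p j : wave_data b (pt p (inc f g j)) (pt p (inc1 f g j))
  (pt p (out f g j)) (pt p (out1 f g j)) (pt p v) (pt p v1).
Proof.
have [Pi /L2P Li /L2P Li1] := inc_prim j; have [Po /L2P Lo /L2P Lo1] := out_prim j.
split.
- exact: Pi.
- exact: Li.
- exact: Li1.
- exact: Po.
- exact: Lo.
- exact: Lo1.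
- exact: v_int.
- exact: v1_sqi.
- by rewrite /pt (v_g j) /inc /out partD partB; ring.
Qed.

Definition curve (k l : R) t : graph_fun R N := fun j =>
  of_parts (fun p => wv (pt p (inc f g j)) (pt p (out f g j)) (pt p v) k l t).
Definition curve1 (k l : R) t : graph_fun R N := fun j =>
  of_parts (fun p => wv1 (pt p (inc1 f g j)) (pt p (out1 f g j)) (pt p v1) k l t).

Let L2c (k l : R) t : I t -> L2G (curve k l t) /\ L2G (curve1 k l t).
Proof.
move=> It; split=> j; apply: L2_of_parts => p.
  exact: (wv_sqi (wave_dataP p j) k l It).1.
exact: (wv_sqi (wave_dataP p j) k l It).2.
Qed.

Let primc (k l : R) t j : I t -> cprim (curve k l t j) (curve1 k l t j).
Proof. by move=> It p; rewrite !pt_of_parts; exact: (wv_prim (wave_dataP p j) k l It). Qed.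

Let tendsc (k l : R) t : I t -> tendsL2 I (curve k l) t (curve1 k (- l) t).
Proof.
move=> It j p; apply: tends0_le (wv_tends (wave_dataP p j) k l It) => s Is.
by rewrite !pt_of_parts.
Qed.

Let contc (k l : R) t j p : I t -> tends0 I t
  (fun s => n2 halfline (fun x => pt p (curve k l s j) x - pt p (curve k l t j) x)).
Proof.
move=> It e e0; have Wd := wave_dataP p j.
have [r r0 Hr] := tends_cont It (fun s Is => (wv_sqi Wd k l Is).1)
  (wv_sqi Wd k (- l) It).2 (wv_tends Wd k l It) e0.
by exists r => // s Is _ sr; rewrite !pt_of_parts; exact: Hr.
Qed.

Let contc1 (k l : R) t j p : I t -> tends0 I t
  (fun s => n2 halfline (fun x => pt p (curve1 k l s j) x - pt p (curve1 k l t j) x)).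
Proof.
move=> It e e0; have Wd := wave_dataP p j.
have [r r0 Hr] := wv1_cont Wd k l It e0.
by exists r => // s Is _ sr; rewrite !pt_of_parts; exact: Hr.
Qed.

Lemma curve_diff0 t j : 0 <= t -> curve 2^-1 (- 2^-1) t j 0 = inc f g j t - v t.
Proof.
move=> t0; apply: part_eq => p; rewrite -[LHS]/(pt p (curve _ _ _ _) 0) pt_of_parts.
by rewrite (wv_0 _ _ (wave_dataP p j) t0) partB /pt; field.
Qed.

Lemma curve_sum0 t j : 0 <= t -> curve 2^-1 2^-1 t j 0 = v t.
Proof.
move=> t0; apply: part_eq => p; rewrite -[LHS]/(pt p (curve _ _ _ _) 0) pt_of_parts.
by rewrite (wv_0 _ _ (wave_dataP p j) t0) /pt; field.
Qed.

Lemma dalembert_curves : wave_curves b alpha f g (curve 2^-1 (- 2^-1)) (curve 2^-1 2^-1)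
  (curve1 2^-1 (- 2^-1)) (curve1 2^-1 2^-1).
Proof.
have half2 (z z' : R) : 2^-1 * (z + z') + - 2^-1 * (z' - z) = z by field.
have half2' (z z' : R) : 2^-1 * (z + z') + 2^-1 * (z' - z) = z' by field.
split.
- by move=> t It; exact: (L2c _ _ It).1.
- by move=> t It; exact: (L2c _ _ It).1.
- by move=> t It; exact: (L2c _ _ It).2.
- by move=> t It; exact: (L2c _ _ It).2.
- by move=> t j It; exact: primc.
- by move=> t j It; exact: primc.
- by move=> t It; have := @tendsc 2^-1 (- 2^-1) t It; rewrite opprK.
- by move=> t It; exact: tendsc.
- by move=> t j p It; exact: contc.
- by move=> t j p It; exact: contc.
- by move=> t j p It; exact: contc1.
- by move=> t j p It; exact: contc1.
- by move=> t j k It; rewrite !curve_sum0//; case: It.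
(* The trace of u_x on edge j is inc_j - v, so the vertex condition reads sum_j inc_j - (N - alpha)
   v = 0, which is [v_sum]. *)
- move=> t k It; have [t0 _] := It; rewrite curve_sum0//.
  rewrite (eq_bigr (fun j => inc f g j t - v t)); last by move=> j _; rewrite curve_diff0.
  by rewrite sumrB v_sum// sumr_const card_ord -mulr_natl; ring.
- move=> j; apply/ae_eq_halfP => p; rewrite pt_of_parts.
  have [_ _ Dff Lff] := tH1dotH2_deriv j Hf; have [_ Ef] := is_wderiv_crep Dff Lff.
  have /ae_eq_halfP/(_ p) E := Ef; apply: ae_imp E => x E x0.
  rewrite (E x0) wv_at0; first by rewrite /pt /inc /out partD partB half2.
  by move: x0; rewrite halflineE => /ltW.
- move=> j; apply/ae_eq_halfP => p; rewrite pt_of_parts.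
  have [_ Dg Lgx] := H1G_deriv j Hg; have [_ Eg] := is_wderiv_crep Dg Lgx.
  have /ae_eq_halfP/(_ p) E := Eg; apply: ae_imp E => x E x0.
  rewrite (E x0) wv_at0; first by rewrite /pt /inc /out partD partB half2'.
  by move: x0; rewrite halflineE => /ltW.
Qed.

Definition dalembert : R -> graph_fun R N := curve_sol (curve 2^-1 (- 2^-1)).

Lemma dalembertP : solution I alpha f g dalembert.
Proof. exact: (curve_solP N0 b0 Hf.1 dalembert_curves). Qed.

End Solve.
End DAlembert.

(** * Energy *)

Section WaveEnergy.
Context {R : realType}.
Local Notation mu := (@lebesgue_measure R).
Implicit Types (D : set R) (F G w P Q v : R -> R) (a c k l s t e x y T : R) (b : \bar R).

(** The parallelogram identity for the halves of F and G. *)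
Lemma n2_pm D F G : measurable D -> sqi D F -> sqi D G ->
  n2 D (fun x => 2^-1 * F x + 2^-1 * G x) + n2 D (fun x => 2^-1 * F x + - 2^-1 * G x) =
  2^-1 * (n2 D F + n2 D G).
Proof.
move=> mD sF sG; have sF2 := sqiZ 2^-1 mD sF.
rewrite (n2D mD sF2 (sqiZ _ mD sG)) (n2D mD sF2 (sqiZ _ mD sG)) !(n2Z _ mD sF) !(n2Z _ mD sG).
have -> : \int[mu]_(x in D) (2^-1 * F x * (- 2^-1 * G x)) =
  -1 * \int[mu]_(x in D) (2^-1 * F x * (2^-1 * G x)).
  rewrite -RintegralZl//; last exact: sqiM mD sF2 (sqiZ _ mD sG).
  by apply: Rint_eq => x _; ring.
by field.
Qed.

Lemma sqi_primitive T v (v1 : R -> R) : 0 <= T ->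
  (forall s, 0 <= s <= T -> v s = v 0 + \int[mu]_(r in `[0, s]) v1 r) ->
  sqi `[0, T] v1 -> sqi `[0, T] v.
Proof. by move=> T0 vE /sqi_itv iv; apply: sqi_cont; exact: prim_within vE iv. Qed.

Section Energy.
Context (b : \bar R) (P P1 Q Q1 v v1 : R -> R) (W : wave_data b P P1 Q Q1 v v1).

Let sqi_l t : Ico0 b t -> sqi halfline (fun x => P (x + t)).
Proof.
move=> It; apply: sqi_eq (wv_sqi W 1 0 It).1; first exact: halfline_meas.
by move=> x _; rewrite /wv; ring.
Qed.

Let sqi_r t : Ico0 b t -> sqi halfline (fun x => qt P Q v (x - t)).
Proof.
move=> It; apply: sqi_eq (wv_sqi W 0 1 It).1; first exact: halfline_meas.
by move=> x _; rewrite /wv; ring.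
Qed.

Let n2_in t : Ico0 b t -> n2 halfline (fun x => P (x + t)) = n2 halfline P - n2 `[0, t] P.
Proof.
move=> [t0 _]; have gE := ext_gprim (wd_sP1 W) (wd_P W).
have cP := gprim_continuous (ext0_sqi (wd_sP1 W)) gE.
have sP := extc_sqi (wd_sP W).
have := n2_tail cP sP t0.
rewrite (n2_eq (g := fun x => P (x + t))); last first.
  by move=> x; rewrite halflineE => x0; rewrite extcE//; lra.
move=> ->; congr (_ - _).
  by apply: n2_eq => x; rewrite halflineE => x0; rewrite extcE ?ltW.
by apply: Rint_eq => x; rewrite /= in_itv/= => /andP[x0 _]; rewrite extcE.
Qed.

(** Translated by t, the outgoing wave becomes Q on the half-line, and [n2_tail] counts what lies
    over [0, t]; the reflection x to t - x turns this part into the outgoing trace as a function of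
    time. *)
Let n2_out t : Ico0 b t -> n2 halfline (fun x => qt P Q v (x - t)) =
  n2 halfline Q + n2 `[0, t] (fun s => v s + v s - P s).
Proof.
move=> It; have [T [F [w [tT gF sw sF [FE _]]]]] := wave_data_local W It.
have [t0 _] := It; have cF := gprim_continuous sw gF.
have FE' y : - t <= y -> F y = qt P Q v y.
  move=> ty; rewrite -[X in qt _ _ _ X](addrK t y) -FE//; first by rewrite mulN1r addrK.
  lra.
pose G x := F (x - t).
have cG : continuous G.
  move=> x; apply: (@continuous_comp _ _ _ (fun x : R => x - t) F); last exact: cF.
  by apply: continuousD; [exact: cvg_id|exact: cvg_cst].
have sG : sqi halfline G.
  apply: sqi_eq (sqi_r It); first exact: halfline_meas.
  by move=> x; rewrite halflineE => x0; rewrite /G FE'//; lra.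
have := n2_tail cG sG t0; rewrite (n2_eq (g := Q)); last first.
  by move=> x; rewrite halflineE => x0; rewrite /G addrK FE' ?/qt ?(ltW x0)//; lra.
rewrite (n2_eq (f := G) (g := fun x => qt P Q v (x - t))); last first.
  by move=> x; rewrite halflineE => x0; rewrite /G FE'//; lra.
move=> ->; rewrite -addrA -[LHS]addr0; congr (_ + _).
suff -> : \int[mu]_(x in `[0, t]) G x ^+ 2 = n2 `[0, t] (fun s => v s + v s - P s) by ring.
have mG : measurable_fun setT (fun x => F (- x) ^+ 2).
  have mF : measurable_fun setT F by exact: cont_meas.
  by apply: measurable_funX; exact: meas_mpres mpres_opp mF.
rewrite (Rint_eq (g := fun x => F (- (t - x)) ^+ 2)); last by move=> x _; rewrite opprB.
have E : [set x | `[0, t]%classic (t - x)] = `[0, t]%classic :> set R.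
  by apply/seteqP; split=> x /=; rewrite !in_itv/=; lra.
have := Rint_mpres_ge0 (mpres_sub t) (measurable_itv `[0, t]) mG (fun x => sqr_ge0 _).
rewrite E => ->; apply: Rint_eq => x; rewrite /= in_itv/= => /andP[x0 xt].
rewrite FE'; last lra.
rewrite /qt opprK; case: ifPn => // x0'; have -> : x = 0 by move: x0'; rewrite oppr_ge0; lra.
by rewrite oppr0 (wd_0 W).
Qed.

Lemma wave_energy t : Ico0 b t ->
  n2 halfline (wv P Q v 2^-1 2^-1 t) + n2 halfline (wv P Q v 2^-1 (- 2^-1) t) =
  2^-1 * (n2 halfline P - n2 `[0, t] P +
          (n2 halfline Q + n2 `[0, t] (fun s => v s + v s - P s))).
Proof.
move=> It; rewrite -(n2_in It) -(n2_out It).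
exact: (n2_pm halfline_meas (sqi_l It) (sqi_r It)).
Qed.

Lemma wave_energy_tail t : Ico0 b t -> n2 `[0, t] P <= n2 halfline P.
Proof. by move=> It; rewrite -subr_ge0 -n2_in//; exact: n2_ge0. Qed.

Lemma wave_data_sqi T : Ico0 b T -> sqi `[0, T] P /\ sqi `[0, T] v.
Proof.
move=> IT; split; first exact: sqi_half_itv (wd_sP W).
have [T0 _] := IT; apply: sqi_primitive T0 _ (wd_sv W IT) => s /andP[s0 sT].
exact: (wd_v W (Ico0_le s0 sT IT)).
Qed.

End Energy.

(** The power of 2 comes from iterating |a + b|^2 <= 2 |a|^2 + 2 |b|^2; it depends only on the
    number of terms. *)
Lemma n2_sum (T : Type) (l : seq T) (F : T -> R -> R) D : measurable D ->
  (forall i, sqi D (F i)) -> sqi D (fun x => \sum_(i <- l) F i x) /\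
  n2 D (fun x => \sum_(i <- l) F i x) <= 2 ^+ size l * \sum_(i <- l) n2 D (F i).
Proof.
move=> mD sF; elim: l => [|i l [s IH]].
  have E : (fun x => \sum_(i <- [::]) F i x) = fun=> 0.
    by apply/funext => x; rewrite big_nil.
  rewrite E big_nil mulr0; split; first exact: sqi0.
  rewrite /n2 (_ : (fun=> _) = fun=> 0); last by apply/funext => x; rewrite expr0n.
  by rewrite Rintegral_cst ?mul0r.
have E : (fun x => \sum_(i <- i :: l) F i x) = fun x => F i x + \sum_(i <- l) F i x.
  by apply/funext => x; rewrite big_cons.
rewrite E big_cons; split; first exact: sqiD.
apply: (le_trans (n2D_le mD (sF i) s)); rewrite mulrDr /= exprS.
apply: lerD; last by rewrite -mulrA ler_wpM2l.
by rewrite ler_wpM2r ?n2_ge0// ler_peMr// exprn_ege1// ler1n.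
Qed.

End WaveEnergy.

(** * Weights that are not square integrable up to the end point *)

Section BlowUpWeight.
Context {R : realType}.
Local Notation mu := (@lebesgue_measure R).
Implicit Types (F f th : R -> R) (a s t x y T M : R) (b : \bar R).

Lemma Rint_is_derive F f s : 0 <= s -> (forall x, 0 <= x <= s -> is_derive x 1 F (f x)) ->
  (forall x, 0 <= x <= s -> {for x, continuous f}) ->
  \int[mu]_(r in `[0, s]) f r = F s - F 0.
Proof.
rewrite le_eqVlt => /predU1P[<- _ _|s0 D cf].
  by rewrite set_itv1 Rintegral_set1 subrr.
have cw : {within `[0, s], continuous f}.
  apply: continuous_in_subspaceT => x; rewrite inE /= in_itv/=; exact: cf.
have E1 : {in `]0, s[, derive1 F =1 f}.
  move=> x; rewrite in_itv/= => /andP[x0 xs]; rewrite derive1E.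
  have axc : 0 <= x <= s by rewrite (ltW x0) (ltW xs).
  by have := D x axc => -[].
by rewrite /Rintegral (continuous_FTC2 s0 cw (derivable_cc s0 D) E1).
Qed.

Lemma nondecreasing_n2_ge th t m : 0 <= m <= t -> itg `[0, t] (fun x => th x ^+ 2) ->
  (forall x, m <= x <= t -> 0 <= th m <= th x) -> (t - m) * th m ^+ 2 <= n2 `[0, t] th.
Proof.
move=> /andP[m0 mt] ith H.
have it' : itg `[m, t] (fun x => th x ^+ 2) by exact: itg_sub_itv m0 (lexx t) ith.
rewrite /n2 (Rint_chasles m0 mt ith).
have K : (t - m) * th m ^+ 2 <= \int[mu]_(x in `[m, t]) th x ^+ 2.
  have -> : (t - m) * th m ^+ 2 = \int[mu]_(x in `[m, t]) th m ^+ 2.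
    rewrite Rintegral_cst// mulrC; congr (_ * _).
    suff E : mu (`[m, t]%classic : set R) = (t - m)%:E by exact: (esym (congr1 fine E)).
    rewrite lebesgue_measure_itv/= lte_fin -EFinB.
    by case: ltgtP mt => // <- _; rewrite subrr.
  apply: Rint_le => //; first exact: itg_cst.
  move=> x; rewrite /= in_itv/= => /H /andP[h0 h1].
  by rewrite ler_pXn2r// nnegrE// (le_trans h0 h1).
have K0 : 0 <= \int[mu]_(x in `[0, m]) th x ^+ 2 by exact: n2_ge0.
by move: K K0; lra.
Qed.

(** For b infinite the identity will do; for b finite, 1/(b - x) - 1/b, whose square is not
    integrable at b. Both vanish at 0, so that the initial vertex velocity is left unchanged. The
    lower bounds keep only a final stretch [m, t], on which the monotone weight is at least its
    value at m. *)
Lemma blowup_weight b : (0 < b)%E -> exists th th1 : R -> R,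
  [/\ forall s, Ico0 b s -> th s = th 0 + \int[mu]_(r in `[0, s]) th1 r,
      forall T, Ico0 b T -> sqi `[0, T] th1,
      th 0 = 0 /\ (forall s, Ico0 b s -> 0 <= th s), (exists2 s, Ico0 b s & th s != 0) &
      forall M, exists2 s, Ico0 b s & forall t, s < t -> (t%:E < b)%E -> M < n2 `[0, t] th].
Proof.
case: b => [b||]//; last first.
  move=> _; exists id, (fun=> 1); have D x : is_derive x 1 (id : R -> R) 1 by exact: is_derive_id.
  have it t : itg `[0, t] (fun x : R => x ^+ 2).
    by apply: itg_cont; apply: continuous_subspaceT; exact: exprn_continuous.
  split=> [s [s0 _]|T _||| M].
  - rewrite (Rint_is_derive s0 (fun x _ => D x)); first by rewrite addrC subrK.
    by move=> x _; exact: cvg_cst.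
  - by apply: sqi_cont => x; exact: cvg_cst.
  - by split=> // s [].
  - by exists 1; [split; [exact: ler01|rewrite ltry]|exact: oner_neq0].
  exists (`|M| + 1); first by split; [rewrite addr_ge0|rewrite ltry].
  move=> t Mt _; have n0 := normr_ge0 M; have M' := ler_norm M.
  have m1 : 0 <= (1 : R) <= t by rewrite ler01 /=; lra.
  have := nondecreasing_n2_ge m1 (it t); rewrite expr1n mulr1 => H.
  apply: lt_le_trans (H _); first lra.
  by move=> x /andP[x1 _]; rewrite ler01.
rewrite lte_fin => b0; pose th x := (b - x)^-1 - b^-1; pose th1 x := (b - x) ^- 2.
have Dl x : is_derive x 1 (fun y : R => b - y) (-1).
  have := is_deriveB (is_derive_cst b x 1) (is_derive_id x 1).
  by rewrite sub0r.
have D x : x < b -> is_derive x 1 th (th1 x).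
  move=> xb; have bx : b - x != 0 by rewrite subr_eq0 gt_eqF.
  have := is_deriveB (@is_deriveV R (fun y : R => b - y) x (-1) 1 bx (Dl x)) (is_derive_cst b^-1 x 1).
  by rewrite subr0 /th1; congr is_derive; rewrite /GRing.scale/= mulrN1 opprK.
have cl x : {for x, continuous (fun y : R => b - y)} by exact: is_derive_cont (Dl x).
have c1 x : x < b -> {for x, continuous th1}.
  move=> xb; have bx : (b - x) ^+ 2 != 0 by rewrite expf_neq0// subr_eq0 gt_eqF.
  apply: cvgV => //; apply: (@continuous_comp _ _ _ (fun y : R => b - y) (fun z : R => z ^+ 2)); first exact: cl.
  exact: exprn_continuous.
have mono x y : x <= y -> y < b -> th x <= th y.
  move=> xy yb; rewrite lerD2r lef_pV2 ?posrE ?subr_gt0//; last exact: le_lt_trans yb.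
  by rewrite lerD2l lerN2.
have th0 : th 0 = 0 by rewrite /th subr0 subrr.
have it t : t < b -> itg `[0, t] (fun x : R => th x ^+ 2).
  move=> tb; apply: itg_cont; apply: continuous_in_subspaceT => x; rewrite inE /= in_itv/= => /andP[_ xt].
  apply: (@continuous_comp _ _ _ th (fun z : R => z ^+ 2)); last exact: exprn_continuous.
  by apply: is_derive_cont; exact: D (le_lt_trans xt tb).
exists th, th1; split=> [s [s0]|T []||| M].
- rewrite lte_fin => sb.
  have D' x (xs : 0 <= x <= s) : is_derive x 1 th (th1 x).
    by apply: D; move: xs => /andP[_ xs]; exact: le_lt_trans xs sb.
  rewrite (Rint_is_derive s0 D'); first by rewrite addrC subrK.
  by move=> x /andP[_ xs]; apply: c1; exact: le_lt_trans xs sb.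
- move=> T0; rewrite lte_fin => Tb; apply: sqi_cont; apply: continuous_in_subspaceT => x.
  by rewrite inE /= in_itv/= => /andP[_ xT]; apply: c1; exact: le_lt_trans xT Tb.
- by split=> // s [s0]; rewrite lte_fin => sb; rewrite -th0; exact: mono.
- exists (b / 2); first by split; [lra|rewrite lte_fin; lra].
  have b1 : b != 0 by rewrite gt_eqF.
  have -> : th (b / 2) = b^-1.
    by rewrite /th (_ : b - b / 2 = b / 2); [field|field].
  by rewrite invr_neq0.
(* With e = b - t < b/4 and m = t - e, the weight at m is (b - 2e) / (2eb), with b - 2e >= b/2;
   hence e times its square is at least 1/(16e), which exceeds |M| + 1 when e < K. *)
pose K := (16 * (`|M| + 1))^-1; have n0 := normr_ge0 M.
have M1 : 0 < 16 * (`|M| + 1) by lra.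
have K0 : 0 < K by rewrite invr_gt0.
pose d := Num.min (b / 4) K; have d0 : 0 < d by rewrite lt_min K0 divr_gt0.
have [d4 dK] : d <= b / 4 /\ d <= K by rewrite !ge_min !lexx orbT.
exists (b - d); first by split; [lra|rewrite lte_fin; lra].
move=> t dt; rewrite lte_fin => tb; pose e := b - t.
have e0 : 0 < e by rewrite subr_gt0.
have eK : e < K by rewrite /e; lra.
have e4 : e < b / 4 by rewrite /e; lra.
have mt : 0 <= t - e <= t by apply/andP; split; rewrite /e; lra.
have := nondecreasing_n2_ge mt (it t tb).
have -> : t - (t - e) = e by ring.
have -> : th (t - e) = (b - 2 * e) / (2 * e * b).
  rewrite /th (_ : b - (t - e) = 2 * e); last by rewrite /e; ring.
  by field; rewrite !gt_eqF.
move=> H; apply: lt_le_trans (H _); last first.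
  move=> x /andP[mx xt]; rewrite divr_ge0//=; [|lra|by rewrite !mulr_ge0// ltW].
  have <- : th (t - e) = (b - 2 * e) / (2 * e * b).
    rewrite /th (_ : b - (t - e) = 2 * e); last by rewrite /e; ring.
    by field; rewrite !gt_eqF.
  by apply: mono mx _; exact: le_lt_trans xt tb.
have eM : 16 * (`|M| + 1) * e < 1 by rewrite mulrC -ltr_pdivlMr// div1r.
have be : b / 2 <= b - 2 * e by lra.
have -> : e * ((b - 2 * e) / (2 * e * b)) ^+ 2 = (b - 2 * e) ^+ 2 / (4 * e * b ^+ 2).
  by field; rewrite !gt_eqF.
have q0 : 0 < 4 * e * b ^+ 2 by rewrite !mulr_gt0// exprn_gt0.
apply: (le_lt_trans (ler_norm M)); rewrite ltr_pdivlMr//.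
have b2 : (b / 2) ^+ 2 <= (b - 2 * e) ^+ 2 by rewrite ler_pXn2r// nnegrE; lra.
apply: lt_le_trans b2.
rewrite (_ : _ * _ = (4 * `|M| * e) * b ^+ 2); last by ring.
rewrite (_ : (b / 2) ^+ 2 = 4^-1 * b ^+ 2); last by field.
rewrite ltr_pM2r ?exprn_gt0//; nra.
Qed.

End BlowUpWeight.

(** * Energy of d'Alembert solutions and the case alpha <> N *)

Section EnergyBound.
Context {R : realType} {N : nat}.
Local Notation mu := (@lebesgue_measure R).
Local Notation C := R[i].
Implicit Types (t s x : R) (p : bool) (j k : 'I_N) (A B : R -> C) (z : C).

Lemma primZ (F w : R -> R) (c : R) : locitg0 w -> prim F w ->
  prim (fun x => c * F x) (fun x => c * w x).
Proof.
move=> lw FE x x0; rewrite RintegralZl//; last exact: lw.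
by rewrite (FE x x0); ring.
Qed.

Definition rot p z : R := (if p then 1 else -1) * complex.Im z.

Lemma pt_M p A z :
  pt p (fun x => A x * z) = fun x => complex.Re z * pt p A x + rot p z * pt (~~ p) A x.
Proof. by apply/funext => x; rewrite /pt partM /rot; ring. Qed.

Lemma cprimM A B z : cprim A B -> L2 B ->
  cprim (fun x => A x * z) (fun x => B x * z) /\ L2 (fun x => B x * z).
Proof.
move=> AB /L2P LB; have mh := @halfline_meas R; split.
  move=> p; rewrite !pt_M; have l1 := sqi_locitg0 (sqiZ (complex.Re z) mh (LB p)).
  exact: (primD (rot p z) l1 (sqi_locitg0 (LB (~~ p))) (primZ _ (sqi_locitg0 (LB p)) (AB p)) (AB (~~ p))).
apply/L2P => p; rewrite pt_M; exact: (sqiD mh (sqiZ _ mh (LB p)) (sqiZ _ mh (LB (~~ p)))).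
Qed.

Lemma cprim_sum (T : Type) (l : seq T) (A B : T -> R -> C) :
  (forall i, cprim (A i) (B i)) -> (forall i, L2 (B i)) ->
  cprim (fun x => \sum_(i <- l) A i x) (fun x => \sum_(i <- l) B i x) /\
  L2 (fun x => \sum_(i <- l) B i x).
Proof.
move=> AB LB; elim: l => [|i l [IH1 IH2]].
  have E (F : T -> R -> C) : (fun x => \sum_(i <- [::]) F i x) = fun=> 0.
    by apply/funext => x; rewrite big_nil.
  rewrite !E; have mh := @halfline_meas R.
  have L0 : L2 (fun=> 0 : C).
    by apply/L2P => p; rewrite /pt part0; exact: sqi0.
  split=> // p x x0; rewrite /pt part0 add0r.
  by rewrite Rintegral_cst ?mul0r.
have E (F : T -> R -> C) : (fun x => \sum_(i <- i :: l) F i x) = fun x => F i x + \sum_(i <- l) F i x.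
  by apply/funext => x; rewrite big_cons.
by rewrite !E; split; [exact: cprimD|exact: L2D].
Qed.

Lemma n2_set1 (f : R -> R) : n2 `[0, 0] f = 0.
Proof. by rewrite /n2 set_itv1 Rintegral_set1. Qed.

(** The vertex condition on the data, in terms of incoming traces: it makes the velocity obtained by
    dividing by N - alpha start from g(0). *)
Lemma inc_sum_0 alpha (f g : graph_fun R N) k : DomW alpha (f, g) ->
  \sum_j inc f g j 0 = (N%:R - alpha) * crep (g k) 0.
Proof.
case=> /= Hf Hg /(_ k) E; rewrite big_split/=.
have -> : \sum_j crep (derivG 1 f j) 0 = - (alpha * crep (g k) 0).
  by apply/eqP; rewrite -addr_eq0; apply/eqP.
rewrite (eq_bigr (fun=> crep (g k) 0)); last by move=> j _; exact: Hg.2.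
by rewrite sumr_const card_ord -mulr_natl; ring.
Qed.

Section Bound.
Context (b : \bar R) (alpha : C) (f g : graph_fun R N) (v v1 : R -> C).
Hypotheses (N0 : (0 < N)%N) (b0 : (0 < b)%E) (Hf : tH1dotH2G f) (Hg : H1G g).
Hypothesis v_int : forall p s, Ico0 b s ->
  pt p v s = pt p v 0 + \int[mu]_(r in `[0, s]) pt p v1 r.
Hypothesis v1_sqi : forall p T, Ico0 b T -> sqi `[0, T] (pt p v1).
Hypothesis v_g : forall j, v 0 = crep (g j) 0.
Hypothesis v_sum : forall t, Ico0 b t -> \sum_j inc f g j t = (N%:R - alpha) * v t.
Local Notation I := (Ico0 b).
Local Notation P p j := (pt p (inc f g j)).
Local Notation Q p j := (pt p (out f g j)).
Local Notation Y p j := (fun s => pt p v s + pt p v s - P p j s).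

Definition edge_energy p j t : R := 2^-1 * (n2 halfline (P p j) - n2 `[0, t] (P p j) +
  (n2 halfline (Q p j) + n2 `[0, t] (Y p j))).

Lemma dalembert_energy t : I t -> energy I (dalembert f g v) t =
  (\sum_j (edge_energy false j t + edge_energy true j t))%:E.
Proof.
move=> It; rewrite (curve_sol_energy N0 (dalembert_curves Hf Hg v_int v1_sqi v_g v_sum) It).
congr EFin; apply: eq_bigr => j _.
have E p := wave_energy (wave_dataP Hf Hg v_int v1_sqi v_g p j) It.
by rewrite !pt_of_parts /edge_energy -!E; ring.
Qed.

Lemma edge_energy_ge p j t : I t -> 2^-1 * n2 `[0, t] (Y p j) <= edge_energy p j t.
Proof.
move=> It; have := wave_energy_tail (wave_dataP Hf Hg v_int v1_sqi v_g p j) It.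
have := n2_ge0 halfline (Q p j).
by rewrite /edge_energy; lra.
Qed.

Definition edge_inc j t := n2 `[0, t] (P false j) + n2 `[0, t] (P true j).

Lemma edge_energy_inc j t : I t ->
  edge_inc j t <= 2 * (edge_energy false j 0 + edge_energy true j 0).
Proof.
move=> It; have H p := wave_energy_tail (wave_dataP Hf Hg v_int v1_sqi v_g p j) It.
have H0 := H false; have H1 := H true.
have := n2_ge0 halfline (Q false j); have := n2_ge0 halfline (Q true j).
by rewrite /edge_inc /edge_energy !n2_set1; lra.
Qed.

(** From |2v - P|^2 <= 8 |v|^2 + 2 |P|^2: one of the two |P|^2 on [0, t] is compensated by the part
    of P that has left the edge, and the overall factor 1/2 leaves one half and 4. *)
Lemma edge_energy_le p j t (V : R) : I t -> n2 `[0, t] (pt p v) <= V ->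
  edge_energy p j t <= edge_energy p j 0 + 2^-1 * n2 `[0, t] (P p j) + 4 * V.
Proof.
move=> It nV; have [sP sv] := wave_data_sqi (wave_dataP Hf Hg v_int v1_sqi v_g p j) It.
have mt : measurable (`[0, t]%classic : set R) by exact: measurable_itv.
have := n2_lin2 2 (-1) mt sv sP.
rewrite (n2_eq (g := Y p j)); last by move=> x _; ring.
by rewrite /edge_energy !n2_set1; lra.
Qed.

End Bound.

Section Unbalanced.
Context (alpha : C) (f g : graph_fun R N).
Hypotheses (N0 : (0 < N)%N) (Hd : DomW alpha (f, g)) (aN : alpha != N%:R).

Let z : C := (N%:R - alpha)^-1.
Let v : R -> C := fun s => (\sum_j inc f g j s) * z.
Let v1 : R -> C := fun s => (\sum_j inc1 f g j s) * z.
Local Notation I := (Ico0 (+oo%E : \bar R)).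

Let Hf : tH1dotH2G f. Proof. by case: Hd. Qed.
Let Hg : H1G g. Proof. by case: Hd. Qed.
Let b0 : (0 < +oo :> \bar R)%E. Proof. by []. Qed.
Let zN : (N%:R - alpha) * z = 1.
Proof. by rewrite divff// subr_eq0 eq_sym. Qed.

Let inc_sum : cprim (fun s => \sum_j inc f g j s) (fun s => \sum_j inc1 f g j s) /\
  L2 (fun s => \sum_j inc1 f g j s).
Proof.
by apply: cprim_sum => j; have [] := inc_prim Hf Hg j.
Qed.

Let v_prim : cprim v v1 /\ L2 v1.
Proof. by have [H1 H2] := inc_sum; exact: cprimM. Qed.

Let v_int p s : I s -> pt p v s = pt p v 0 + \int[mu]_(r in `[0, s]) pt p v1 r.
Proof. by move=> [s0 _]; exact: (v_prim.1 p s s0). Qed.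

Let v1_sqi p T : I T -> sqi `[0, T] (pt p v1).
Proof. by move=> _; have /L2P := v_prim.2 => /(_ p); exact: sqi_half_itv. Qed.

Let v_g j : v 0 = crep (g j) 0.
Proof. by rewrite /v (inc_sum_0 j Hd) mulrAC zN mul1r. Qed.

Let v_sum t : I t -> \sum_j inc f g j t = (N%:R - alpha) * v t.
Proof. by move=> _; rewrite /v mulrCA zN mulr1. Qed.

Let K : R := ((Normc.normc (alpha - N%:R)) ^+ 2)^-1.

Let KE : complex.Re z ^+ 2 + complex.Im z ^+ 2 = K.
Proof.
rewrite -[LHS](normc_sqr z) /z Normc.normcV -opprB exprVn /K.
by rewrite (normcN (alpha - N%:R)).
Qed.

(** One factor 2 comes from splitting the product with z into its parts, K is |z|^2, and 2^N is that
    of [n2_sum]. *)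
Let n2_v p t : n2 `[0, t] (pt p v) <= 2 * K * 2 ^+ N * \sum_j edge_inc f g j t.
Proof.
have mt : measurable (`[0, t]%classic : set R) by exact: measurable_itv.
have sP q j : sqi `[0, t] (pt q (inc f g j)).
  by have [_ /L2P/(_ q)/sqi_half_itv] := inc_prim Hf Hg j; exact.
pose S q : R -> R := fun x => \sum_j pt q (inc f g j) x.
have SE q : pt q (fun x => \sum_j inc f g j x) = S q.
  by apply/funext => x; rewrite /pt part_sum.
have [sS nS] : (forall q, sqi `[0, t] (S q)) /\
    forall q, n2 `[0, t] (S q) <= 2 ^+ N * \sum_j n2 `[0, t] (pt q (inc f g j)).
  split=> q; have [] := n2_sum (index_enum 'I_N) mt (sP q) => //.
  by move=> _; rewrite [size _](_ : _ = N)// -[RHS](card_ord N) cardE enumT.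
rewrite /v pt_M !SE; apply: (le_trans (n2_lin2 _ _ mt (sS p) (sS (~~ p)))).
have rE : rot p z ^+ 2 = complex.Im z ^+ 2.
  by rewrite /rot exprMn; case: p; rewrite ?sqrrN expr1n mul1r.
have r0 := sqr_ge0 (complex.Re z); have i0 := sqr_ge0 (complex.Im z).
rewrite rE /edge_inc big_split/= mulrDr.
have {}nS q : n2 `[0, t] (S q) <= 2 ^+ N * \sum_j n2 `[0, t] (pt q (inc f g j)) by exact: nS.
have n0 q := n2_ge0 `[0, t] (S q).
have rK : 2 * complex.Re z ^+ 2 <= 2 * K by rewrite -KE; lra.
have iK : 2 * complex.Im z ^+ 2 <= 2 * K by rewrite -KE; lra.
have le q : n2 `[0, t] (S q) * (2 * K) <=
    2 * K * 2 ^+ N * \sum_j n2 `[0, t] (pt q (inc f g j)).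
  by rewrite mulrC -mulrA ler_wpM2l//; rewrite -KE; lra.
apply: (@le_trans _ _ (n2 `[0, t] (S p) * (2 * K) + n2 `[0, t] (S (~~ p)) * (2 * K))).
  by apply: lerD; rewrite mulrC ler_wpM2l.
have lf := le false; have lt := le true; clear rE; case: p => /=; lra.
Qed.

(** With E0 the initial energy and X the incoming energy up to t, X <= 2 E0. Each edge gains at most
    half its share of X plus 8 V, that is 4 V for each part, where V = 2 K 2^N X. Summing, the
    energy is at most 2 E0 + 32 N 2^N K E0. *)
Lemma unbalanced_sol : exists u : R -> graph_fun R N,
  solution I alpha f g u /\ forall t, 0 <= t ->
  (energy I u t <= ((2 + 32 * N%:R * 2 ^+ N) * (1 + K))%:E * energy I u 0)%E.
Proof.
exists (dalembert f g v); split; first exact: dalembertP N0 b0 Hf Hg v_int v1_sqi v_g v_sum.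
move=> t t0; have It s : 0 <= s -> I s by move=> s0; split=> //; rewrite ltry.
rewrite !(dalembert_energy N0 Hf Hg v_int v1_sqi v_g v_sum); [|exact: It|exact: It].
rewrite -EFinM lee_fin; set E0 := (X in _ <= _ * X).
have X2 : \sum_j edge_inc f g j t <= 2 * E0.
  rewrite /E0 mulr_sumr; apply: ler_sum => j _.
  exact: (edge_energy_inc Hf Hg v_int v1_sqi v_g j (It t t0)).
have X0 : 0 <= \sum_j edge_inc f g j t.
  by apply: sumr_ge0 => j _; rewrite addr_ge0// n2_ge0.
have K0 : 0 <= K by rewrite -KE addr_ge0// sqr_ge0.
set X := \sum_j edge_inc f g j t in X2 X0.
have c0 : 0 <= 2 * K * 2 ^+ N by rewrite !mulr_ge0// exprn_ge0.
pose V := 2 * K * 2 ^+ N * X.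
have B p j := edge_energy_le Hf Hg v_int v1_sqi v_g j (It t t0) (n2_v p t).
apply: (@le_trans _ _ (E0 + 2^-1 * X + N%:R * (8 * V))).
  have -> : E0 + 2^-1 * X + N%:R * (8 * V) = \sum_j (edge_energy f g v false j 0 +
      edge_energy f g v true j 0 + 2^-1 * edge_inc f g j t + 8 * V).
    by rewrite [RHS]big_split/= [Y in _ = Y + _]big_split/= -mulr_sumr sumr_const card_ord mulr_natl.
  apply: ler_sum => j _; have := B false j; have := B true j.
  by rewrite -/X -/V /edge_inc; lra.
have VX : V <= 2 * K * 2 ^+ N * (2 * E0) by rewrite /V ler_wpM2l.
have NV : N%:R * (8 * V) <= N%:R * (8 * (2 * K * 2 ^+ N * (2 * E0))).
  by rewrite ler_wpM2l// ler_wpM2l.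
have E00 : 0 <= E0 by lra.
have a0 : 0 <= N%:R * 2 ^+ N * E0 by rewrite !mulr_ge0// exprn_ge0.
have a1 : 0 <= E0 * K by rewrite mulr_ge0.
apply: (@le_trans _ _ (2 * E0 + 32 * (N%:R * 2 ^+ N * E0) * K)).
  have -> : 32 * (N%:R * 2 ^+ N * E0) * K = N%:R * (8 * (2 * K * 2 ^+ N * (2 * E0))) by ring.
  by lra.
rewrite (_ : (2 + _) * _ * _ = 2 * E0 + 32 * (N%:R * 2 ^+ N * E0) * K +
  (2 * (E0 * K) + 32 * (N%:R * 2 ^+ N * E0))); first by lra.
by ring.
Qed.

End Unbalanced.
End EnergyBound.

(** * The case alpha = N: infinitely many solutions and blow-up *)

Section Balanced.
Context {R : realType} {N : nat}.
Local Notation mu := (@lebesgue_measure R).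
Local Notation C := R[i].
Implicit Types (t s x : R) (p : bool) (j k : 'I_N) (n : nat).

Lemma t_crit_sum0 (f g : graph_fun R N) t : Ico0 (t_crit f g) t -> \sum_j inc f g j t = 0.
Proof.
move=> [t0] /ereal_sup_gt[_ [s [s0 Hs] <-]]; rewrite lte_fin => ts.
by apply: Hs; rewrite t0 ltW.
Qed.

Lemma infinite_set_inj (T : Type) (A : set T) (F : nat -> T) :
  (forall n, A (F n)) -> injective F -> infinite_set A.
Proof.
move=> AF inj fA; apply: infinite_nat.
have E : F @^-1` A = [set: nat] by apply/seteqP; split=> // n _; exact: AF.
rewrite -E; apply: card_le_finite fA; apply: card_ge_preimage => n m _ _; exact: inj.
Qed.

Lemma eq_mod_cst_refl (h : graph_fun R N) : eq_mod_cst h h.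
Proof. by exists 0 => j; apply: ae_all => x _; rewrite /diffG subrr. Qed.

Context (f g : graph_fun R N) (j0 : 'I_N).
Hypotheses (Hd : DomW N%:R (f, g)) (b0 : (0 < t_crit f g)%E).
Local Notation I := (Ico0 (t_crit f g)).

Let Hf : tH1dotH2G f. Proof. by case: Hd. Qed.
Let Hg : H1G g. Proof. by case: Hd. Qed.
Let N0 : (0 < N)%N. Proof. exact: leq_ltn_trans (leq0n _) (ltn_ord j0). Qed.

Local Notation c p := (pt p (out f g j0) 0).

(* The sign makes the added boundary velocity reinforce the outgoing wave. *)
Definition reinforcing_sign : R := if 0 <= c false then 1 else -1.
Local Notation sigma := reinforcing_sign.
Local Notation co n p := (if p then 0 else sigma * n%:R).

(** Without the weight, this velocity makes the outgoing trace 2v - inc on edge [j0] constant, equal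
    to its initial value c. The perturbation n th, in the real part only, then adds 2 sigma n th to
    that trace. *)
Definition vertex_velocity (th : R -> R) n : R -> C := of_parts (fun p s =>
  2^-1 * (pt p (inc f g j0) s + c p) + co n p * th s).

Section Weight.
Context (th th1 : R -> R).
Hypotheses (th_int : forall s, I s -> th s = th 0 + \int[mu]_(r in `[0, s]) th1 r)
  (th1_sqi : forall T, I T -> sqi `[0, T] th1) (th_0 : th 0 = 0)
  (th_ge0 : forall s, I s -> 0 <= th s).

Local Notation v := (vertex_velocity th).
Let v1 n : R -> C := of_parts (fun p s =>
  2^-1 * pt p (inc1 f g j0) s + co n p * th1 s).

Let sP1 p T : sqi `[0, T] (pt p (inc1 f g j0)).
Proof. by have [_ _ /L2P/(_ p)/sqi_half_itv] := inc_prim Hf Hg j0; exact. Qed.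

Let v_int n p s : I s -> pt p (v n) s = pt p (v n) 0 + \int[mu]_(r in `[0, s]) pt p (v1 n) r.
Proof.
move=> Is; rewrite !pt_of_parts; have [s0 _] := Is.
have ms : measurable (`[0, s]%classic : set R) by exact: measurable_itv.
have iP := sqi_itv (sP1 p s); have it := sqi_itv (th1_sqi Is).
rewrite RintD//; [|exact: itgZ|exact: itgZ].
rewrite !RintegralZl//.
have [P _ _] := inc_prim Hf Hg j0.
by rewrite (P p s s0) (th_int Is); ring.
Qed.

Let v1_sqi n p T : I T -> sqi `[0, T] (pt p (v1 n)).
Proof.
move=> IT; rewrite pt_of_parts; have mT : measurable (`[0, T]%classic : set R) by exact: measurable_itv.
exact: (sqiD mT (sqiZ _ mT (sP1 p T)) (sqiZ _ mT (th1_sqi IT))).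
Qed.

Let v_g n j : v n 0 = crep (g j) 0.
Proof.
rewrite (Hg.2 j j0); apply: part_eq => p; rewrite -[LHS]/(pt p (v n) 0) pt_of_parts th_0.
by rewrite /inc /out /pt partD partB; field.
Qed.

Let v_sum n t : I t -> \sum_j inc f g j t = (N%:R - N%:R) * v n t.
Proof. by move=> It; rewrite subrr mul0r; exact: t_crit_sum0. Qed.

Local Notation u n := (dalembert f g (v n)).

Lemma weight_solP n : solution I N%:R f g (u n).
Proof. exact: (dalembertP N0 b0 Hf Hg (@v_int n) (@v1_sqi n) (v_g n) (@v_sum n)). Qed.

(** Equal classes have the same u_x, whose trace on edge [j0] is inc - v; so the two velocities
    agree at t, where the weight is nonzero. *)
Lemma weight_sol_inj t n m : I t -> th t != 0 -> eq_mod_cst (u n t) (u m t) -> n = m.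
Proof.
move=> It tht E; have [t0 _] := It.
have Sn := sol_space (weight_solP n) It; have Sm := sol_space (weight_solP m) It.
have En := curve_sol_deriv (dalembert_curves Hf Hg (@v_int n) (@v1_sqi n) (v_g n) (@v_sum n)) j0 It.
have Em := curve_sol_deriv (dalembert_curves Hf Hg (@v_int m) (@v1_sqi m) (v_g m) (@v_sum m)) j0 It.
have Ed := eq_mod_cst_derivG (Sn.1.1 j0) (Sm.1.1 j0) E.
have Wn := dalembert_curves Hf Hg (@v_int n) (@v1_sqi n) (v_g n) (@v_sum n).
have Wm := dalembert_curves Hf Hg (@v_int m) (@v1_sqi m) (v_g m) (@v_sum m).
have Cn := crep_prim (wc_W Wn It j0) (wc_UW Wn j0 It) En (lexx 0).
have Cm := crep_prim (wc_W Wm It j0) (wc_UW Wm j0 It) (ae_eq_half_trans Ed Em) (lexx 0).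
move: Cn; rewrite Cm (curve_diff0 Hf Hg (@v_int n) (@v1_sqi n) (v_g n))//.
rewrite (curve_diff0 Hf Hg (@v_int m) (@v1_sqi m) (v_g m))// => /addrI/oppr_inj/(congr1 (part false)).
rewrite -[LHS]/(pt false (v m) t) -[RHS]/(pt false (v n) t) !pt_of_parts => /addrI.
rewrite -!mulrA => /(mulfI _) H; have {H} : m%:R * th t = n%:R * th t :> R.
  by apply: H; rewrite /reinforcing_sign; case: ifP => _; rewrite ?oppr_eq0 oner_neq0.
by move/(mulIf tht)/eqP; rewrite eqr_nat => /eqP.
Qed.

(** Only the outgoing part of the real energy on edge [j0] is kept. There the trace is c + 2 sigma
    th with c sigma >= 0 and th >= 0, so its square is at least 2 th^2; this 2 makes up for the half
    in [edge_energy]. *)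
Lemma weight_sol_energy t : I t -> ((n2 `[0, t] th)%:E <= energy I (u 1) t)%E.
Proof.
move=> It; have [t0 _] := It.
have mt : measurable (`[0, t]%classic : set R) by exact: measurable_itv.
rewrite (dalembert_energy N0 Hf Hg (@v_int 1) (@v1_sqi 1) (v_g 1) (@v_sum 1) It) lee_fin.
have ge p j := edge_energy_ge Hf Hg (@v_int 1) (@v1_sqi 1) (v_g 1) p j It.
have ge0 p j : 0 <= edge_energy f g (v 1) p j t.
  by apply: le_trans (ge p j); rewrite mulr_ge0// n2_ge0.
rewrite (bigD1 j0)//=.
have S0 : 0 <= \sum_(i < N | i != j0) (edge_energy f g (v 1) false i t + edge_energy f g (v 1) true i t).
  by apply: sumr_ge0 => j _; rewrite addr_ge0.
have := ge false j0; have := ge0 true j0.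
set Y := n2 _ _; suff : 2 * n2 `[0, t] th <= Y.
  move: S0; have := n2_ge0 `[0, t] th.
  by set S := \sum_(_ < N | _) _; lra.
have sth : sqi `[0, t] th.
  apply: (sqi_primitive t0 _ (th1_sqi It)) => s /andP[s0 st].
  exact: (th_int (Ico0_le s0 st It)).
have sY : sqi `[0, t] (fun s => c false + 2 * (sigma * th s)).
  apply: sqiD => //; first by apply: sqi_cont => x; exact: cvg_cst.
  by apply: (sqiZ _ mt); exact: sqiZ.
have -> : Y = n2 `[0, t] (fun s => c false + 2 * (sigma * th s)).
  by apply: n2_eq => s _; rewrite !pt_of_parts mulr1; field.
have -> : 2 * n2 `[0, t] th = \int[mu]_(s in `[0, t]) (2 * th s ^+ 2).
  by rewrite RintegralZl//; case: sth.
apply: (Rint_le mt).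
- by apply: itgZ => //; case: sth.
- by have [] := sY.
move=> s; rewrite /= in_itv/= => /andP[s0 st].
have ts := th_ge0 (Ico0_le s0 st It).
have s2 : sigma ^+ 2 = 1 by rewrite /reinforcing_sign; case: ifP; rewrite ?sqrrN expr1n.
have sc : 0 <= c false * sigma.
  by rewrite /reinforcing_sign; case: (leP 0 (c false)) => H; rewrite ?mulr1 ?mulrN1 ?oppr_ge0 // ltW.
rewrite (_ : (c false + _) ^+ 2 = c false ^+ 2 + 4 * (c false * sigma * th s) + 4 * (sigma ^+ 2 * th s ^+ 2)); last by ring.
have a0 : 0 <= c false * sigma * th s by rewrite mulr_ge0.
have a1 := sqr_ge0 (c false); have a2 := sqr_ge0 (th s).
by rewrite s2 mul1r; lra.
Qed.

End Weight.

Lemma balanced_sols : infinite_set (solution_classes I N%:R f g) /\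
  exists u : R -> graph_fun R N, solution I N%:R f g u /\
    forall M : R, exists t1 : R, I t1 /\
      forall t : R, t1 < t -> (t%:E < t_crit f g)%E -> (M%:E < energy I u t)%E.
Proof.
have [th [th1 [ti t1s [th0 thp] [t It tht] blow]]] := blowup_weight b0.
have P := weight_solP ti t1s th0.
pose F n := dalembert f g (vertex_velocity th n).
split.
  apply: (@infinite_set_inj _ _ (fun n => [set w | same_on I (F n) w])).
    by move=> n; exists (F n); [exact: P|].
  (* Distinct n give distinct classes, not merely distinct functions: the comparison is made at a
     single time t at which the weight is nonzero. *)
  move=> n m /= E; apply: (weight_sol_inj ti t1s th0 It tht).
  suff : same_on I (F n) (F m) by move=> /(_ t It); exact.
  have : [set w | same_on I (F m) w] (F m) by move=> s _; exact: eq_mod_cst_refl.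
  by rewrite -E.
exists (F 1); split; first exact: P.
move=> M; have [s Is Hs] := blow M; exists s; split=> // t' st' tb.
have It' : I t' by split=> //; apply: ltW; apply: le_lt_trans st'; case: Is.
apply: lt_le_trans (weight_sol_energy ti t1s th0 thp It').
by rewrite lte_fin; exact: Hs.
Qed.

End Balanced.

Theorem theorem2p4 (R : realType) (N : nat) (N_gt0 : (0 < N)%N) :
  (exists C : R, 0 < C /\
    forall (alpha : R[i]) (f g : graph_fun R N),
      0 < complex.Re alpha -> DomW alpha (f, g) -> alpha != N%:R ->
      exists u : R -> graph_fun R N,
        [/\ solution (Ico0 +oo%E) alpha f g u,
            forall u', solution (Ico0 +oo%E) alpha f g u' ->
              same_on (Ico0 +oo%E) u u' &
            forall t : R, 0 <= t ->
              (energy (Ico0 +oo%E) u t <=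
                (C * (1 + ((Normc.normc (alpha - N%:R)) ^+ 2)^-1))%:E *
                energy (Ico0 +oo%E) u 0)%E])
  /\
  (forall (alpha : R[i]) (f g : graph_fun R N),
    0 < complex.Re alpha -> DomW alpha (f, g) -> alpha = N%:R ->
    ((0 < t_crit f g)%E ->
      infinite_set (solution_classes (Ico0 (t_crit f g)) alpha f g) /\
      exists u : R -> graph_fun R N,
        solution (Ico0 (t_crit f g)) alpha f g u /\
        forall M : R, exists t1 : R, Ico0 (t_crit f g) t1 /\
          forall t : R, t1 < t -> (t%:E < t_crit f g)%E ->
            (M%:E < energy (Ico0 (t_crit f g)) u t)%E) /\
    (t_crit f g \is a fin_num ->
      forall eps : R, 0 < eps ->
        ~ exists u : R -> graph_fun R N,
            solution (Ico0 (t_crit f g + eps%:E)) alpha f g u)).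
Proof.
split.
  exists (2 + 32 * N%:R * 2 ^+ N); split.
    by rewrite ltr_pwDl// !mulr_ge0// exprn_ge0.
  move=> alpha f g _ Hd aN; have [u [Su Eu]] := unbalanced_sol N_gt0 Hd aN.
  exists u; split=> //; case: Hd => /= Hf Hg _ u' Su'.
  exact: (sol_uniq N_gt0 aN Hf Hg Su Su').
move=> alpha f g _ Hd E; rewrite {}E in Hd *; split=> [b0|fin eps e0].
  exact: (balanced_sols (Ordinal N_gt0) Hd b0).
by case: Hd => /= Hf Hg _; exact: no_sol_after N_gt0 Hf Hg fin e0.
Qed.
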